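(* Let $X$ be a noetherian $\mathrm{FA}$-scheme. Let $F$ be a closed subset of $X$ of positive codimension in $X$. Let $x_0\in X$, and consider the cycle $[\overline{\{x_0\}}]\in\mathcal Z(X)$. Let $Q$ be an $\mathfrak m_{X,x_0}$-primary ideal of $\mathcal O_{X,x_0}$. Then $e(Q)[\overline{\{x_0\}}]$, where $e(Q)=e(Q,\mathcal O_{X,x_0})$, is rationally equivalent in $X$ to a cycle $Z$ which generically avoids $F$, i.e., such that no irreducible cycle occurring in $Z$ is contained in $F$.
   Context: A scheme $X$ is an $\mathrm{FA}$-scheme if every finite subset of $X$ is contained in an affine open subset of $X$. A closed subset $F$ has positive codimension in $X$ if no irreducible component of $F$ is an irreducible component of $X$ ($F=\emptyset$ allowed). $\mathcal Z(X)$ is the free abelian group on the integral closed subschemes of $X$; its elements are called cycles. For an integral closed subscheme $Y$ of $X$ and $g\in k(Y)^*$, put $[\operatorname{div}(g)]=\sum_x \operatorname{ord}_x(g)[\overline{\{x\}}]$, the sum over the points $x$ of codimension $1$ in $Y$, where $\operatorname{ord}_x(g)=\ell(\mathcal O_{Y,x}/(a))-\ell(\mathcal O_{Y,x}/(b))$ if $g=a/b$ with $a,b\in\mathcal O_{Y,x}\setminus\{0\}$. Two cycles are rationally equivalent in $X$ if their difference is a finite sum $\sum_i[\operatorname{div}(g_i)]$ with $g_i\in k(Y_i)^*$ and $Y_i$ integral closed subschemes of $X$. Hilbert-Samuel multiplicity: for a noetherian local ring $(A,\mathfrak m)$ of dimension $d$ and an $\mathfrak m$-primary ideal $Q$, $\ell_A(A/Q^n)$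 agrees for large $n$ with a polynomial in $n$ of degree $d$; $e(Q,A)$ is $d!$ times its coefficient of $n^d$. *)

(* Defs.v *)
From HB Require Import structures.
From mathcomp Require Import all_boot all_order all_algebra ring.
From mathcomp Require Import all_classical.
From mathcomp Require Import topology_structure initial_topology subtype_topology.
From mathcomp Require Export freeg.

Set Implicit Arguments.
Unset Strict Implicit.
Unset Printing Implicit Defensive.

Import Order.TTheory GRing.Theory Num.Theory.
Local Open Scope classical_set_scope.
Local Open Scope ring_scope.
Local Open Scope quotient_scope.

(* Rings are commutative with unit, and the zero ring is allowed
   ([comPzRingType]): it is the ring of sections over the empty open set. *)

(* Stalks, localizations and quotients by ideals are all obtained as quotients
   of a setoid with ring operations. *)

Record ring_setoid := RingSetoid {
  rs_car : Type;
  rs_eq : rs_car -> rs_car -> Prop;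
  rs_zero : rs_car;
  rs_one : rs_car;
  rs_opp : rs_car -> rs_car;
  rs_add : rs_car -> rs_car -> rs_car;
  rs_mul : rs_car -> rs_car -> rs_car;
  rs_refl : forall a, rs_eq a a;
  rs_sym : forall a b, rs_eq a b -> rs_eq b a;
  rs_trans : forall a b c, rs_eq a b -> rs_eq b c -> rs_eq a c;
  rs_opp_eq : forall a b, rs_eq a b -> rs_eq (rs_opp a) (rs_opp b);
  rs_add_eq : forall a a' b b',
    rs_eq a a' -> rs_eq b b' -> rs_eq (rs_add a b) (rs_add a' b');
  rs_mul_eq : forall a a' b b',
    rs_eq a a' -> rs_eq b b' -> rs_eq (rs_mul a b) (rs_mul a' b');
  rs_addA : forall a b c,
    rs_eq (rs_add a (rs_add b c)) (rs_add (rs_add a b) c);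
  rs_addC : forall a b, rs_eq (rs_add a b) (rs_add b a);
  rs_add0 : forall a, rs_eq (rs_add rs_zero a) a;
  rs_addN : forall a, rs_eq (rs_add (rs_opp a) a) rs_zero;
  rs_mulA : forall a b c,
    rs_eq (rs_mul a (rs_mul b c)) (rs_mul (rs_mul a b) c);
  rs_mulC : forall a b, rs_eq (rs_mul a b) (rs_mul b a);
  rs_mul1 : forall a, rs_eq (rs_mul rs_one a) a;
  rs_mulDl : forall a b c,
    rs_eq (rs_mul (rs_add a b) c) (rs_add (rs_mul a c) (rs_mul b c)) }.

Section RingOfSetoid.
Variable S : ring_setoid.

Definition rs_ctype : choiceType := {classic rs_car S}.
Definition rs_rel (a b : rs_ctype) : bool := `[< rs_eq a b >].

Lemma rs_rel_refl : reflexive rs_rel.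
Proof. by move=> a; apply/asboolP; exact: rs_refl. Qed.

Lemma rs_rel_sym : symmetric rs_rel.
Proof. by move=> a b; apply/asboolP/asboolP; exact: rs_sym. Qed.

Lemma rs_rel_trans : transitive rs_rel.
Proof.
by move=> b a c /asboolP ab /asboolP bc; apply/asboolP; exact: rs_trans ab bc.
Qed.

Canonical rs_equiv := EquivRel rs_rel rs_rel_refl rs_rel_sym rs_rel_trans.

Definition setoid_ring : Type := {eq_quot rs_equiv}.

HB.instance Definition _ := Choice.on setoid_ring.

Definition to_ring (a : rs_car S) : setoid_ring :=
  \pi_{eq_quot rs_equiv} (a : rs_ctype).
Definition of_ring (x : setoid_ring) : rs_car S :=
  repr (x : {eq_quot rs_equiv}).

Lemma of_ringK x : to_ring (of_ring x) = x.
Proof. exact: reprK. Qed.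

Lemma to_ring_eq a b : to_ring a = to_ring b <-> rs_eq a b.
Proof.
rewrite /to_ring; split => [/eqmodP/asboolP//|ab].
by apply/eqmodP/asboolP.
Qed.

Lemma to_ringK a : rs_eq (of_ring (to_ring a)) a.
Proof. by apply/to_ring_eq; rewrite of_ringK. Qed.

Let add x y := to_ring (rs_add (of_ring x) (of_ring y)).
Let opp x := to_ring (rs_opp (of_ring x)).
Let mul x y := to_ring (rs_mul (of_ring x) (of_ring y)).

Let addE a b : add (to_ring a) (to_ring b) = to_ring (rs_add a b).
Proof. by apply/to_ring_eq/rs_add_eq; exact: to_ringK. Qed.
Let oppE a : opp (to_ring a) = to_ring (rs_opp a).
Proof. by apply/to_ring_eq/rs_opp_eq; exact: to_ringK. Qed.
Let mulE a b : mul (to_ring a) (to_ring b) = to_ring (rs_mul a b).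
Proof. by apply/to_ring_eq/rs_mul_eq; exact: to_ringK. Qed.

Let addA : associative add.
Proof.
move=> x y z; rewrite -(of_ringK x) -(of_ringK y) -(of_ringK z) !addE.
by apply/to_ring_eq; exact: rs_addA.
Qed.
Let addC : commutative add.
Proof.
move=> x y; rewrite -(of_ringK x) -(of_ringK y) !addE.
by apply/to_ring_eq; exact: rs_addC.
Qed.
Let add0 : left_id (to_ring (rs_zero S)) add.
Proof.
by move=> x; rewrite -(of_ringK x) addE; apply/to_ring_eq; exact: rs_add0.
Qed.
Let addN : left_inverse (to_ring (rs_zero S)) opp add.
Proof.
move=> x; rewrite -(of_ringK x) oppE addE.
by apply/to_ring_eq; exact: rs_addN.
Qed.
Let mulA : associative mul.
Proof.
move=> x y z; rewrite -(of_ringK x) -(of_ringK y) -(of_ringK z) !mulE.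
by apply/to_ring_eq; exact: rs_mulA.
Qed.
Let mulC : commutative mul.
Proof.
move=> x y; rewrite -(of_ringK x) -(of_ringK y) !mulE.
by apply/to_ring_eq; exact: rs_mulC.
Qed.
Let mul1 : left_id (to_ring (rs_one S)) mul.
Proof.
by move=> x; rewrite -(of_ringK x) mulE; apply/to_ring_eq; exact: rs_mul1.
Qed.
Let mulDl : left_distributive mul add.
Proof.
move=> x y z; rewrite -(of_ringK x) -(of_ringK y) -(of_ringK z).
by rewrite !(addE, mulE); apply/to_ring_eq; exact: rs_mulDl.
Qed.

HB.instance Definition _ := GRing.isZmodule.Build setoid_ring
  addA addC add0 addN.
HB.instance Definition _ := GRing.Zmodule_isComPzRing.Build setoid_ring
  mulA mulC mul1 mulDl.

Lemma to_ring0 : to_ring (rs_zero S) = 0. Proof. by []. Qed.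
Lemma to_ring1 : to_ring (rs_one S) = 1. Proof. by []. Qed.
Lemma to_ringD a b : to_ring (rs_add a b) = to_ring a + to_ring b.
Proof. by rewrite -addE. Qed.
Lemma to_ringN a : to_ring (rs_opp a) = - to_ring a.
Proof. by rewrite -oppE. Qed.
Lemma to_ringM a b : to_ring (rs_mul a b) = to_ring a * to_ring b.
Proof. by rewrite -mulE. Qed.

End RingOfSetoid.

Section Ideals.
Variable A : comPzRingType.

Definition is_ideal (I : set A) : Prop :=
  [/\ I 0, forall x y, I x -> I y -> I (x + y)
    & forall a x, I x -> I (a * x)].

Definition prime_ideal (P : set A) : Prop :=
  [/\ is_ideal P, ~ P 1 & forall x y, P (x * y) -> P x \/ P y].

Definition maximal_ideal (M : set A) : Prop :=
  [/\ is_ideal M, ~ M 1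
    & forall I, is_ideal I -> M `<=` I -> ~ I 1 -> I = M].

Definition primary_ideal (Q : set A) : Prop :=
  [/\ is_ideal Q, ~ Q 1
    & forall x y, Q (x * y) -> Q x \/ exists n, Q (y ^+ n)].

Definition radical (I : set A) : set A := [set x | exists n, I (x ^+ n)].

Definition primary_to (P Q : set A) : Prop :=
  primary_ideal Q /\ radical Q = P.

Definition ideal_span (S : set A) : set A := smallest is_ideal S.

Definition ideal_mul (I J : set A) : set A :=
  ideal_span [set x * y | x in I & y in J].

Definition ideal_exp (I : set A) (n : nat) : set A :=
  iter n (ideal_mul I) setT.

Definition noetherian_ring : Prop :=
  forall I, is_ideal I -> exists s : seq A, I = ideal_span [set` s].

Definition local_ring : Prop := exists! M, maximal_ideal M.

(* The maximal ideal of a local ring. *)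
Definition max_ideal : set A := xget set0 maximal_ideal.

Lemma ideal_span_ideal S : is_ideal (ideal_span S).
Proof.
split=> [I [[I0 _ _] _]//|x y Sx Sy I IS|a x Sx I IS].
- by case: (IS) => -[_ ID _] _; apply: ID; [exact: Sx|exact: Sy].
- by case: (IS) => -[_ _ IM] _; apply: IM; exact: Sx.
Qed.

Lemma ideal_opp I x : is_ideal I -> I x -> I (- x).
Proof. by case=> _ _ IM Ix; rewrite -mulN1r; exact: IM. Qed.

End Ideals.

Arguments max_ideal : clear implicits.

Section Quotient.
Variables (A : comPzRingType) (S : set A).

Let I := ideal_span S.
Let I_ideal : is_ideal I := ideal_span_ideal S.
Let I0 : I 0. Proof. by case: I_ideal. Qed.
Let ID x y : I x -> I y -> I (x + y). Proof. by case: I_ideal => _ + _; exact. Qed.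
Let IM a x : I x -> I (a * x). Proof. by case: I_ideal => _ _; exact. Qed.
Let IN x : I x -> I (- x). Proof. exact: ideal_opp. Qed.
Let IE x y : I x -> x = y -> I y. Proof. by move=> + <-. Qed.

Definition quot_setoid : ring_setoid.
Proof.
refine (@RingSetoid A (fun x y => I (x - y)) 0 1 -%R +%R *%R
  _ _ _ _ _ _ _ _ _ _ _ _ _ _).
- by move=> x; rewrite subrr.
- by move=> x y /IN; rewrite opprB.
- by move=> x y z xy yz; apply: (IE (ID xy yz)); ring.
- by move=> x y /IN xy; apply: (IE xy); ring.
- by move=> x x' y y' xx yy; apply: (IE (ID xx yy)); ring.
- move=> x x' y y' xx yy.
  by apply: (IE (ID (IM y xx) (IM x' yy))); ring.
- by move=> x y z; apply: (IE I0); ring.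
- by move=> x y; apply: (IE I0); ring.
- by move=> x; apply: (IE I0); ring.
- by move=> x; apply: (IE I0); ring.
- by move=> x y z; apply: (IE I0); ring.
- by move=> x y; apply: (IE I0); ring.
- by move=> x; apply: (IE I0); ring.
- by move=> x y z; apply: (IE I0); ring.
Defined.

(* The quotient of A by the ideal generated by S. *)
Definition quot_ring : comPzRingType := setoid_ring quot_setoid.

Definition quot_pi (a : A) : quot_ring := @to_ring quot_setoid a.

Lemma quot_piP a b : quot_pi a = quot_pi b <-> ideal_span S (a - b).
Proof. exact: (@to_ring_eq quot_setoid). Qed.

Lemma quot_pi_zmod_morphism : zmod_morphism quot_pi.
Proof. by move=> a b; rewrite /quot_pi -to_ringN -to_ringD. Qed.
Lemma quot_pi_monoid_morphism : monoid_morphism quot_pi.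
Proof. by split=> [//|a b]; rewrite /quot_pi -to_ringM. Qed.

HB.instance Definition _ := GRing.isZmodMorphism.Build A quot_ring quot_pi
  quot_pi_zmod_morphism.
HB.instance Definition _ := GRing.isMonoidMorphism.Build A quot_ring quot_pi
  quot_pi_monoid_morphism.

(* The same quotient, seen as an A-module. *)
Definition quot_mod : Type := quot_ring.

HB.instance Definition _ := GRing.Zmodule.on quot_mod.

Let scale (a : A) (x : quot_mod) : quot_mod := quot_pi a * (x : quot_ring).

Let scaleA a b x : scale a (scale b x) = scale (a * b) x.
Proof. by rewrite /scale mulrA rmorphM. Qed.
Let scale1 : left_id 1 scale.
Proof. by move=> x; rewrite /scale rmorph1 mul1r. Qed.
Let scaleDr : right_distributive scale +%R.
Proof. by move=> a x y; rewrite /scale mulrDr. Qed.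
Let scaleDl x : {morph scale^~ x : a b / a + b}.
Proof. by move=> a b; rewrite /scale rmorphD mulrDl. Qed.

HB.instance Definition _ := GRing.Zmodule_isLmodule.Build A quot_mod
  scaleA scale1 scaleDr scaleDl.

End Quotient.

Section Localization.
Variables (A : comPzRingType) (P : set A).
Hypothesis P_prime : prime_ideal P.

Let frac := (A * {s : A | ~ P s})%type.
Let num (x : frac) : A := x.1.
Let den (x : frac) : A := sval x.2.
Let denP x : ~ P (den x) := svalP x.2.

Let P1 : ~ P 1. Proof. by case: P_prime. Qed.
Let PM s t : ~ P s -> ~ P t -> ~ P (s * t).
Proof. by case: P_prime => _ _ Pp Ps Pt /Pp[]. Qed.

Let mk a s (h : ~ P s) : frac := (a, exist _ s h).

Definition localization_setoid : ring_setoid.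
Proof.
refine (@RingSetoid frac
  (fun x y => exists2 u, ~ P u & u * (num x * den y) = u * (num y * den x))
  (mk 0 P1) (mk 1 P1)
  (fun x => mk (- num x) (denP (x := x)))
  (fun x y => mk (num x * den y + num y * den x)
                (PM (denP (x := x)) (denP (x := y))))
  (fun x y => mk (num x * num y) (PM (denP (x := x)) (denP (x := y))))
  _ _ _ _ _ _ _ _ _ _ _ _ _ _).
- by move=> x; exists 1.
- by move=> x y [u Pu e]; exists u.
- move=> x y z [u Pu e] [v Pv f].
  exists (u * v * den y); first by do 2?apply: PM => //; exact: denP.
  transitivity (v * den z * (u * (num x * den y))); first by ring.
  rewrite e; transitivity (u * den x * (v * (num y * den z))); first by ring.
  by rewrite f; ring.
- move=> x y [u Pu e]; exists u => //=; rewrite /num /den /= in e *.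
  by rewrite mulNr mulrN e; ring.
- move=> x x' y y' [u Pu e] [v Pv f]; exists (u * v); first exact: PM.
  rewrite /num /den /= in e f *.
  set a := x.1 in e *; set s := sval x.2 in e *.
  set a' := x'.1 in e *; set s' := sval x'.2 in e *.
  set b := y.1 in f *; set t := sval y.2 in f *.
  set b' := y'.1 in f *; set t' := sval y'.2 in f *.
  transitivity (v * t * t' * (u * (a * s')) + u * s * s' * (v * (b * t'))).
    by ring.
  by rewrite e f; ring.
- move=> x x' y y' [u Pu e] [v Pv f]; exists (u * v); first exact: PM.
  rewrite /num /den /= in e f *.
  set a := x.1 in e *; set s := sval x.2 in e *.
  set a' := x'.1 in e *; set s' := sval x'.2 in e *.
  set b := y.1 in f *; set t := sval y.2 in f *.
  set b' := y'.1 in f *; set t' := sval y'.2 in f *.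
  transitivity ((u * (a * s')) * (v * (b * t'))); first by ring.
  by rewrite e f; ring.
- by move=> x y z; exists 1 => //; rewrite /num /den /=; ring.
- by move=> x y; exists 1 => //; rewrite /num /den /=; ring.
- by move=> x; exists 1 => //; rewrite /num /den /=; ring.
- by move=> x; exists 1 => //; rewrite /num /den /=; ring.
- by move=> x y z; exists 1 => //; rewrite /num /den /=; ring.
- by move=> x y; exists 1 => //; rewrite /num /den /=; ring.
- by move=> x; exists 1 => //; rewrite /num /den /=; ring.
- by move=> x y z; exists 1 => //; rewrite /num /den /=; ring.
Defined.

Definition localization : comPzRingType := setoid_ring localization_setoid.

Definition frac_loc (a s : A) (h : ~ P s) : localization :=
  @to_ring localization_setoid (mk a h).

Lemma frac_loc_eq a s (hs : ~ P s) b t (ht : ~ P t) :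
  frac_loc a hs = frac_loc b ht <->
  exists2 u, ~ P u & u * (a * t) = u * (b * s).
Proof. exact: (@to_ring_eq localization_setoid). Qed.

Lemma frac_loc0 (h : ~ P 1) : frac_loc 0 h = 0.
Proof.
rewrite -(to_ring0 localization_setoid).
by apply/(to_ring_eq (S := localization_setoid)); exists 1.
Qed.
Lemma frac_loc1 (h : ~ P 1) : frac_loc 1 h = 1.
Proof.
rewrite -(to_ring1 localization_setoid).
by apply/(to_ring_eq (S := localization_setoid)); exists 1.
Qed.
Lemma frac_locN a s (h : ~ P s) : frac_loc (- a) h = - frac_loc a h.
Proof.
rewrite /frac_loc -(to_ringN (S := localization_setoid)).
by apply/(to_ring_eq (S := localization_setoid)); exists 1.
Qed.
Lemma frac_locD a s (hs : ~ P s) b t (ht : ~ P t) (hst : ~ P (s * t)) :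
  frac_loc (a * t + b * s) hst = frac_loc a hs + frac_loc b ht.
Proof.
rewrite /frac_loc -(to_ringD (S := localization_setoid)).
by apply/(to_ring_eq (S := localization_setoid)); exists 1.
Qed.
Lemma frac_locM a s (hs : ~ P s) b t (ht : ~ P t) (hst : ~ P (s * t)) :
  frac_loc (a * b) hst = frac_loc a hs * frac_loc b ht.
Proof.
rewrite /frac_loc -(to_ringM (S := localization_setoid)).
by apply/(to_ring_eq (S := localization_setoid)); exists 1.
Qed.

End Localization.

(* Strict chains c 0 < c 1 < ... < c n of sets satisfying P. *)
Definition strict_chain T (P : set (set T)) (n : nat) (c : nat -> set T) :=
  (forall i, (i <= n)%N -> P (c i)) /\
  (forall i, (i < n)%N -> c i `<` c i.+1).

(* The supremum of the lengths of the strict chains of sets satisfying P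
   (by convention 0 if there is no maximum). *)
Definition chain_height T (P : set (set T)) : nat :=
  xget 0%N [set n | (exists c, strict_chain P n c) /\
    forall m, (exists c, strict_chain P m c) -> (m <= n)%N].

Definition is_submodule (A : pzRingType) (M : lmodType A) (N : set M) : Prop :=
  [/\ N 0, forall x y, N x -> N y -> N (x + y)
    & forall a x, N x -> N (a *: x)].

Definition module_length (A : pzRingType) (M : lmodType A) : nat :=
  chain_height (@is_submodule A M).

Definition krull_dim (A : comPzRingType) : nat := chain_height (@prime_ideal A).

(* The length over A of the quotient of A by the ideal generated by S. *)
Definition quot_length (A : comPzRingType) (S : set A) : nat :=
  @module_length A (quot_mod S).

Definition is_hs_polynomial (A : comPzRingType) (Q : set A) (p : {poly rat}) :=
  exists N : nat, forall n : nat, (N <= n)%N ->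
    (quot_length (ideal_exp Q n))%:R = p.[n%:R].

(* p is of degree d = dim A, and e is d! times its leading coefficient. *)
Definition is_hs_multiplicity (A : comPzRingType) (Q : set A) (e : nat) :=
  exists p : {poly rat}, [/\ is_hs_polynomial Q p, size p = (krull_dim A).+1
    & e%:R = ((krull_dim A)`!)%:R * p`_(krull_dim A)].

Definition hs_multiplicity (A : comPzRingType) (Q : set A) : nat :=
  xget 0%N (is_hs_multiplicity Q).

Record opens (T : topologicalType) := Opens {
  open_set :> set T;
  open_setP : open open_set }.

Lemma opensP T (U V : opens T) : open_set U = open_set V -> U = V.
Proof.
case: U V => [U oU] [V oV] /= UV; case: _ / UV in oV *.
by rewrite (Prop_irrelevance oU oV).
Qed.

Definition opensT (T : topologicalType) : opens T := Opens openT.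

Definition opensI T (U V : opens T) : opens T :=
  Opens (openI (open_setP U) (open_setP V)).

Lemma opensIl T (U V : opens T) : opensI U V `<=` U.
Proof. exact: subIsetl. Qed.

Lemma opensIr T (U V : opens T) : opensI U V `<=` V.
Proof. exact: subIsetr. Qed.

Definition preim_opens (S T : topologicalType) (f : S -> T)
    (f_cont : continuous f) (V : opens T) : opens S :=
  Opens ((iffLR (continuousP _) f_cont) _ (open_setP V)).

Lemma preim_opensS (S T : topologicalType) (f : S -> T) (fc : continuous f)
  (U V : opens T) : V `<=` U -> preim_opens fc V `<=` preim_opens fc U.
Proof. by move=> VU x /= /VU. Qed.

Definition covering (T : topologicalType) (U : opens T) (C : set (opens T)) :=
  (forall V : opens T, C V -> V `<=` U) /\ U `<=` \bigcup_(V in C) V.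

Record ringed_space := RingedSpace {
  rs_space :> topologicalType;
  sections : opens rs_space -> comPzRingType;
  restr : forall U V : opens rs_space, V `<=` U ->
    {rmorphism sections U -> sections V};
  restr_id : forall (U : opens rs_space) (h : U `<=` U) (s : sections U),
    restr h s = s;
  restr_comp : forall (U V W : opens rs_space) (h : V `<=` U) (k : W `<=` V)
      (l : W `<=` U) (s : sections U),
    restr k (restr h s) = restr l s;
  sheaf_sep : forall (U : opens rs_space) (C : set (opens rs_space)),
    covering U C -> forall s t : sections U,
    (forall (V : opens rs_space) (h : V `<=` U),
      C V -> restr h s = restr h t) -> s = t;
  sheaf_glue : forall (U : opens rs_space) (C : set (opens rs_space)),
    covering U C -> forall s : (forall V, sections V),
    (forall (V W : opens rs_space) (h : opensI V W `<=` V)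
        (k : opensI V W `<=` W),
      C V -> C W -> restr h (s V) = restr k (s W)) ->
    exists t : sections U, forall (V : opens rs_space) (h : V `<=` U),
      C V -> restr h t = s V }.

Section Stalk.
Variables (X : ringed_space) (x : X).

Record germ_rep := GermRep {
  germ_dom : opens X;
  germ_domP : open_set germ_dom x;
  germ_sec : sections germ_dom }.

Definition germ_eq (g h : germ_rep) : Prop :=
  exists (W : opens X) (gW : W `<=` germ_dom g) (hW : W `<=` germ_dom h),
    open_set W x /\ restr gW (germ_sec g) = restr hW (germ_sec h).

Let dom2 (g h : germ_rep) := opensI (germ_dom g) (germ_dom h).
Let dom2P g h : open_set (dom2 g h) x := conj (germ_domP g) (germ_domP h).
Let subl g h : dom2 g h `<=` germ_dom g := @opensIl _ _ _.
Let subr g h : dom2 g h `<=` germ_dom h := @opensIr _ _ _.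

Let gadd g h := GermRep (dom2P g h)
  (restr (@subl g h) (germ_sec g) + restr (@subr g h) (germ_sec h)).
Let gmul g h := GermRep (dom2P g h)
  (restr (@subl g h) (germ_sec g) * restr (@subr g h) (germ_sec h)).
Let gopp g := GermRep (germ_domP g) (- germ_sec g).
Let gzero := GermRep (germ_dom := opensT X) I 0.
Let gone := GermRep (germ_dom := opensT X) I 1.

Let restrE (U V W : opens X) (h : V `<=` U) (k : W `<=` V) (s : sections U) :
  restr k (restr h s) = restr (subset_trans k h) s.
Proof. exact: restr_comp. Qed.

Let restr_irr (U V : opens X) (h k : V `<=` U) (s : sections U) :
  restr h s = restr k s.
Proof. by rewrite (Prop_irrelevance h k). Qed.

Let germ_trans g h k : germ_eq g h -> germ_eq h k -> germ_eq g k.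
Proof.
move=> [W [gW [hW [Wx e]]]] [W' [hW' [kW' [Wx' e']]]].
have l : opensI W W' `<=` W by exact: subIsetl.
have r : opensI W W' `<=` W' by exact: subIsetr.
exists (opensI W W'), (subset_trans l gW), (subset_trans r kW'); split=> //.
by rewrite -!restrE e -e' !restrE; exact: restr_irr.
Qed.

Let germ_law g h : germ_dom h `<=` germ_dom g ->
  (forall (W : opens X) (gW : W `<=` germ_dom g) (hW : W `<=` germ_dom h),
    restr gW (germ_sec g) = restr hW (germ_sec h)) -> germ_eq g h.
Proof.
move=> hg e; exists (germ_dom h), hg, (@subset_refl _ _).
by split=> //; exact: germ_domP.
Qed.

Definition stalk_setoid : ring_setoid.
Proof.
refine (@RingSetoid germ_rep germ_eq gzero gone gopp gadd gmul
  _ _ _ _ _ _ _ _ _ _ _ _ _ _).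
- by move=> g; exists (germ_dom g), (@subset_refl _ _), (@subset_refl _ _);
    split=> //; exact: germ_domP.
- by move=> g h [W [gW [hW [Wx e]]]]; exists W, hW, gW.
- exact: germ_trans.
- move=> g h [W [gW [hW [Wx e]]]]; exists W, gW, hW; split=> //=.
  by rewrite !rmorphN e.
- move=> g g' h h' [W [gW [gW' [Wx e]]]] [V [hV [hV' [Vx f]]]].
  have l : opensI W V `<=` W by exact: subIsetl.
  have r : opensI W V `<=` V by exact: subIsetr.
  exists (opensI W V).
  have a : opensI W V `<=` dom2 g h by move=> y [/gW ? /hV].
  have b : opensI W V `<=` dom2 g' h' by move=> y [/gW' ? /hV'].
  exists a, b; split=> //=; rewrite !rmorphD !restrE /=.
  congr (_ + _).
    rewrite (restr_irr _ (subset_trans l gW)).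
    rewrite [RHS](restr_irr _ (subset_trans l gW')).
    by rewrite -!restrE e.
  rewrite (restr_irr _ (subset_trans r hV)).
  rewrite [RHS](restr_irr _ (subset_trans r hV')).
  by rewrite -!restrE f.
- move=> g g' h h' [W [gW [gW' [Wx e]]]] [V [hV [hV' [Vx f]]]].
  have l : opensI W V `<=` W by exact: subIsetl.
  have r : opensI W V `<=` V by exact: subIsetr.
  exists (opensI W V).
  have a : opensI W V `<=` dom2 g h by move=> y [/gW ? /hV].
  have b : opensI W V `<=` dom2 g' h' by move=> y [/gW' ? /hV'].
  exists a, b; split=> //=; rewrite !rmorphM !restrE /=.
  congr (_ * _).
    rewrite (restr_irr _ (subset_trans l gW)).
    rewrite [RHS](restr_irr _ (subset_trans l gW')).
    by rewrite -!restrE e.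
  rewrite (restr_irr _ (subset_trans r hV)).
  rewrite [RHS](restr_irr _ (subset_trans r hV')).
  by rewrite -!restrE f.
- move=> a b c; apply: germ_law => [y [[? ?] ?]//|W gW hW] /=.
  rewrite !rmorphD !restrE addrA.
  by congr (_ + _ + _); exact: restr_irr.
- move=> a b; apply: germ_law => [y [? ?]//|W gW hW] /=.
  rewrite !rmorphD !restrE /= addrC.
  by congr (_ + _); exact: restr_irr.
- move=> a; apply: germ_law => [y ?//|W gW hW] /=.
  by rewrite !rmorphD !restrE /= !rmorph0 add0r; exact: restr_irr.
- move=> a.
  exists (germ_dom a), (fun y h => conj h h), (fun _ _ => I).
  split; first exact: germ_domP.
  rewrite /= rmorphD !restrE !rmorphN rmorph0.
  by rewrite [X in - X + _](restr_irr _ (subset_trans (fun y h => conj h h)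
    (@subr (gopp a) a))) addNr.
- move=> a b c; apply: germ_law => [y [[? ?] ?]//|W gW hW] /=.
  rewrite !rmorphM !restrE mulrA.
  by congr (_ * _ * _); exact: restr_irr.
- move=> a b; apply: germ_law => [y [? ?]//|W gW hW] /=.
  rewrite !rmorphM !restrE /= mulrC.
  by congr (_ * _); exact: restr_irr.
- move=> a; apply: germ_law => [y ?//|W gW hW] /=.
  by rewrite !rmorphM !restrE /= !rmorph1 mul1r; exact: restr_irr.
- move=> a b c; apply: germ_law => [y [[? ?] [? ?]]//|W gW hW] /=.
  rewrite !(rmorphM, rmorphD) !restrE mulrDl.
  by congr (_ * _ + _ * _); exact: restr_irr.
Defined.

Definition stalk : comPzRingType := setoid_ring stalk_setoid.

Definition germ (U : opens X) (Ux : open_set U x) (s : sections U) : stalk :=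
  @to_ring stalk_setoid (GermRep Ux s).

End Stalk.

Section Germs.
Variables (X : ringed_space) (x : X).

Lemma germ_restr (U V : opens X) (h : V `<=` U) (Ux : open_set U x)
    (Vx : open_set V x) (s : sections U) :
  germ Vx (restr h s) = germ Ux s.
Proof.
apply/(to_ring_eq (S := stalk_setoid x)); exists V, (@subset_refl _ _), h.
by split=> //=; rewrite restr_id.
Qed.

Lemma germD (U : opens X) (Ux : open_set U x) (s t : sections U) :
  germ Ux (s + t) = germ Ux s + germ Ux t.
Proof.
rewrite /germ -(to_ringD (S := stalk_setoid x)).
apply/(to_ring_eq (S := stalk_setoid x)).
exists U, (@subset_refl _ _), (fun y h => conj h h).
by split=> //=; rewrite [RHS]rmorphD !(restr_comp _ _ (@subset_refl _ _))
  rmorphD.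
Qed.

Lemma germM (U : opens X) (Ux : open_set U x) (s t : sections U) :
  germ Ux (s * t) = germ Ux s * germ Ux t.
Proof.
rewrite /germ -(to_ringM (S := stalk_setoid x)).
apply/(to_ring_eq (S := stalk_setoid x)).
exists U, (@subset_refl _ _), (fun y h => conj h h).
by split=> //=; rewrite [RHS]rmorphM !(restr_comp _ _ (@subset_refl _ _))
  rmorphM.
Qed.

Lemma germN (U : opens X) (Ux : open_set U x) (s : sections U) :
  germ Ux (- s) = - germ Ux s.
Proof. by rewrite /germ -(to_ringN (S := stalk_setoid x)). Qed.

Lemma germ0 : germ (x := x) (U := opensT X) I 0 = 0.
Proof. by rewrite -(to_ring0 (stalk_setoid x)). Qed.

Lemma germ1 : germ (x := x) (U := opensT X) I 1 = 1.
Proof. by rewrite -(to_ring1 (stalk_setoid x)). Qed.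

Lemma germ_surj (a : stalk x) :
  exists (U : opens X) (Ux : open_set U x) (s : sections U), a = germ Ux s.
Proof.
exists (germ_dom (of_ring (S := stalk_setoid x) a)), (germ_domP _), (germ_sec _).
rewrite -[LHS](of_ringK (S := stalk_setoid x)) /germ; congr to_ring.
by case: (of_ring (S := stalk_setoid x) a : germ_rep x).
Qed.

End Germs.

(* The specialization map from O_{X,x} to O_{X,y}, for x in the closure
   of y. *)
Section Specialization.
Variables (X : ringed_space) (x y : X).
Hypothesis xy : closure [set y] x.

Lemma open_specialization (U : opens X) : open_set U x -> open_set U y.
Proof.
move=> Ux; have [z [-> //]] := xy (open_nbhs_nbhs (conj (open_setP U) Ux)).
Qed.

Definition specialization (a : stalk x) : stalk y :=
  let g := of_ring (S := stalk_setoid x) a in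
  germ (open_specialization (germ_domP g)) (germ_sec g).

Lemma specialization_germ (U : opens X) (Ux : open_set U x)
    (Uy : open_set U y) (s : sections U) :
  specialization (germ Ux s) = germ Uy s.
Proof.
rewrite /specialization /germ; set g := of_ring _.
have [W [gW [UW [Wx e]]]] : germ_eq g (GermRep Ux s).
  exact: (to_ringK (S := stalk_setoid x)).
apply/(to_ring_eq (S := stalk_setoid y)); exists W, gW, UW; split=> //.
exact: open_specialization.
Qed.

End Specialization.

(* K x is a ring for every point x, and a family of functions gen_val j,
   defined on open sets gen_dom j, is given. The sections over U are the
   functions on U with values in the K x that locally agree with some
   gen_val j. *)

Record local_data (T : topologicalType) (K : T -> comPzRingType) := LocalData {
  gen : Type;
  gen_dom : gen -> opens T;
  gen_val : forall (j : gen) x, open_set (gen_dom j) x -> K x;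
  gen0 : exists j, forall x, exists h : open_set (gen_dom j) x,
    gen_val h = 0;
  gen1 : exists j, forall x, exists h : open_set (gen_dom j) x,
    gen_val h = 1;
  genN : forall j, exists l, forall x (h : open_set (gen_dom j) x),
    exists k : open_set (gen_dom l) x, gen_val k = - gen_val h;
  genD : forall i j, exists l, forall x (h : open_set (gen_dom i) x)
    (h' : open_set (gen_dom j) x),
    exists k : open_set (gen_dom l) x, gen_val k = gen_val h + gen_val h';
  genM : forall i j, exists l, forall x (h : open_set (gen_dom i) x)
    (h' : open_set (gen_dom j) x),
    exists k : open_set (gen_dom l) x, gen_val k = gen_val h * gen_val h' }.

Section LocalSheaf.
Variables (T : topologicalType) (K : T -> comPzRingType) (G : local_data K).

Definition locally_gen (U : opens T) (s : forall x, open_set U x -> K x) :=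
  forall x, open_set U x -> exists (j : gen G) (W : opens T),
    [/\ open_set W x, W `<=` gen_dom j
      & forall y (Uy : open_set U y) (jy : open_set (gen_dom j) y),
          open_set W y -> s y Uy = gen_val jy].

Record local_section (U : opens T) := LocalSection {
  lsec_val : forall x, open_set U x -> K x;
  lsec_valP : locally_gen lsec_val }.

Lemma lsecP U (s t : local_section U) :
  (forall x (h : open_set U x), lsec_val s h = lsec_val t h) -> s = t.
Proof.
case: s t => [s sP] [t tP] /= st.
have {}st : s = t by apply: functional_extensionality_dep => x;
  apply: functional_extensionality_dep => h; exact: st.
by case: _ / st in tP *; rewrite (Prop_irrelevance sP tP).
Qed.

HB.instance Definition _ U := gen_eqMixin (local_section U).
HB.instance Definition _ U := gen_choiceMixin (local_section U).

Section Ops.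
Variable U : opens T.
Implicit Types s t : local_section U.

Let zeroP : locally_gen (fun x (_ : open_set U x) => 0 : K x).
Proof.
move=> x Ux; have [j jP] := gen0 G; exists j, (gen_dom j).
split=> //; first by case: (jP x).
by move=> y Uy jy _; have [h <-] := jP y; rewrite (Prop_irrelevance h jy).
Qed.

Let oneP : locally_gen (fun x (_ : open_set U x) => 1 : K x).
Proof.
move=> x Ux; have [j jP] := gen1 G; exists j, (gen_dom j).
split=> //; first by case: (jP x).
by move=> y Uy jy _; have [h <-] := jP y; rewrite (Prop_irrelevance h jy).
Qed.

Let oppP s : locally_gen (fun x h => - lsec_val s (x := x) h).
Proof.
move=> x Ux; have [j [W [Wx Wj e]]] := lsec_valP s Ux.
have [l lP] := genN j; exists l, W; split=> // [y /Wj h|y Uy ly Wy].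
  by have [] := lP y h.
have [k ke] := lP y (Wj y Wy).
by rewrite (Prop_irrelevance ly k) ke (e y Uy (Wj y Wy)).
Qed.

Let addP s t : locally_gen (fun x h => lsec_val s (x := x) h + lsec_val t h).
Proof.
move=> x Ux; have [i [V [Vx Vi e]]] := lsec_valP s Ux.
have [j [W [Wx Wj f]]] := lsec_valP t Ux.
have [l lP] := genD i j; exists l, (opensI V W); split=> //.
  by move=> y [/Vi h /Wj h']; have [] := lP y h h'.
move=> y Uy ly [Vy Wy]; have [k ke] := lP y (Vi y Vy) (Wj y Wy).
rewrite (Prop_irrelevance ly k) ke.
by rewrite (e y Uy (Vi y Vy)) // (f y Uy (Wj y Wy)).
Qed.

Let mulP s t : locally_gen (fun x h => lsec_val s (x := x) h * lsec_val t h).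
Proof.
move=> x Ux; have [i [V [Vx Vi e]]] := lsec_valP s Ux.
have [j [W [Wx Wj f]]] := lsec_valP t Ux.
have [l lP] := genM i j; exists l, (opensI V W); split=> //.
  by move=> y [/Vi h /Wj h']; have [] := lP y h h'.
move=> y Uy ly [Vy Wy]; have [k ke] := lP y (Vi y Vy) (Wj y Wy).
rewrite (Prop_irrelevance ly k) ke.
by rewrite (e y Uy (Vi y Vy)) // (f y Uy (Wj y Wy)).
Qed.

Let zero := LocalSection zeroP.
Let one := LocalSection oneP.
Let opp s := LocalSection (oppP s).
Let add s t := LocalSection (addP s t).
Let mul s t := LocalSection (mulP s t).

Let addA : associative add.
Proof. by move=> r s t; apply: lsecP => x h /=; rewrite addrA. Qed.
Let addC : commutative add.
Proof. by move=> s t; apply: lsecP => x h /=; rewrite addrC. Qed.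
Let add0 : left_id zero add.
Proof. by move=> s; apply: lsecP => x h /=; rewrite add0r. Qed.
Let addN : left_inverse zero opp add.
Proof. by move=> s; apply: lsecP => x h /=; rewrite addNr. Qed.
Let mulA : associative mul.
Proof. by move=> r s t; apply: lsecP => x h /=; rewrite mulrA. Qed.
Let mulC : commutative mul.
Proof. by move=> s t; apply: lsecP => x h /=; rewrite mulrC. Qed.
Let mul1 : left_id one mul.
Proof. by move=> s; apply: lsecP => x h /=; rewrite mul1r. Qed.
Let mulDl : left_distributive mul add.
Proof. by move=> r s t; apply: lsecP => x h /=; rewrite mulrDl. Qed.

HB.instance Definition _ := GRing.isZmodule.Build (local_section U)
  addA addC add0 addN.
HB.instance Definition _ := GRing.Zmodule_isComPzRing.Build (local_section U)
  mulA mulC mul1 mulDl.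

End Ops.

Section Restriction.
Variables (U V : opens T) (VU : V `<=` U).

Lemma lsec_restr_subproof (s : local_section U) :
  locally_gen (fun x (Vx : open_set V x) => lsec_val s (VU Vx)).
Proof.
move=> x Vx; have [j [W [Wx Wj e]]] := lsec_valP s (VU Vx).
by exists j, W; split=> // y Vy jy Wy; exact: e.
Qed.

Definition lsec_restr (s : local_section U) : local_section V :=
  LocalSection (lsec_restr_subproof s).

Lemma lsec_restr_zmod_morphism : zmod_morphism lsec_restr.
Proof. by move=> s t; apply: lsecP. Qed.
Lemma lsec_restr_monoid_morphism : monoid_morphism lsec_restr.
Proof. by split=> [|s t]; apply: lsecP. Qed.

HB.instance Definition _ := GRing.isZmodMorphism.Build
  (local_section U) (local_section V) lsec_restr lsec_restr_zmod_morphism.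
HB.instance Definition _ := GRing.isMonoidMorphism.Build
  (local_section U) (local_section V) lsec_restr lsec_restr_monoid_morphism.

End Restriction.

Definition local_sheaf : ringed_space.
Proof.
refine (@RingedSpace T local_section
  (fun U V VU => lsec_restr VU : {rmorphism _ -> _}) _ _ _ _).
- by move=> U h s; apply: lsecP => x Ux /=; congr lsec_val; exact: Prop_irrelevance.
- by move=> U V W h k l s; apply: lsecP => x Wx /=; congr lsec_val;
    exact: Prop_irrelevance.
- move=> U C [CU UC] s t st; apply: lsecP => x Ux.
  have [V CV Vx] := UC x Ux.
  have /(congr1 (fun r => lsec_val r Vx)) /= := st V (CU V CV) CV.
  by rewrite (Prop_irrelevance (CU V CV x Vx) Ux).
- move=> U C [CU UC] s s_eq.
  have s_eq' (V W : opens T) x (Vx : open_set V x) (Wx : open_set W x) :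
      C V -> C W -> lsec_val (s V) Vx = lsec_val (s W) Wx.
    move=> CV CW.
    have := s_eq V W (@subIsetl _ _ _) (@subIsetr _ _ _) CV CW.
    move=> /(congr1 (fun r => lsec_val r (conj Vx Wx : open_set (opensI V W) x))) /=.
    by rewrite (Prop_irrelevance (subIsetl _) Vx)
      (Prop_irrelevance (subIsetr _) Wx).
  have pick x (Ux : open_set U x) : {V : opens T | C V /\ open_set V x}.
    by apply: cid; have [V CV Vx] := UC x Ux; exists V.
  pose t x (Ux : open_set U x) : K x :=
    lsec_val (s (sval (pick x Ux))) (svalP (pick x Ux)).2.
  have tE (V : opens T) x (Vx : open_set V x) (Ux : open_set U x) :
      C V -> t x Ux = lsec_val (s V) Vx.
    by move=> CV; apply: s_eq' => //; case: (svalP (pick x Ux)).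
  have tP : locally_gen t.
    move=> x Ux; have [V CV Vx] := UC x Ux.
    have [j [W [Wx Wj e]]] := lsec_valP (s V) Vx.
    exists j, (opensI V W); split=> // [y [_ /Wj]//|y Uy jy [Vy Wy]].
    by rewrite (tE V y Vy Uy CV); exact: e.
  exists (LocalSection tP) => V h CV; apply: lsecP => x Vx /=; exact: tE.
Defined.

End LocalSheaf.

Section Spectrum.
Variable A : comPzRingType.

Record spec := Spec { spec_set :> set A; spec_prime : prime_ideal spec_set }.

HB.instance Definition _ := gen_eqMixin spec.
HB.instance Definition _ := gen_choiceMixin spec.

(* The closed sets are the V(E) = {P | E is contained in P}. *)
Definition zariski_open : set_system spec :=
  [set U | exists E : set A, U = [set P : spec | ~ E `<=` P]].

Lemma zariski_openT : zariski_open setT.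
Proof.
exists setT; apply/seteqP; split=> // P _ /= h.
by case: (spec_prime P) => _ + _; apply; exact: h.
Qed.

Lemma zariski_openI : setI_closed zariski_open.
Proof.
move=> _ _ [E ->] [F ->]; exists [set x * y | x in E & y in F].
apply/seteqP; split=> P /=.
  move=> [/existsNP[x /not_implyP[Ex Px]] /existsNP[y /not_implyP[Fy Py]]] h.
  case: (spec_prime P) => _ _ /(_ x y)[]//.
  by apply: h; exists x => //; exists y.
case: (spec_prime P) => -[_ _ PM] _ _ h; split=> EP; apply: h.
  by move=> _ [x Ex] [y Fy] <-; rewrite mulrC; apply: PM; exact: EP.
by move=> _ [x Ex] [y Fy] <-; apply: PM; exact: EP.
Qed.

Lemma zariski_open_bigcup (I : Type) (f : I -> set spec) :
  (forall i, zariski_open (f i)) -> zariski_open (\bigcup_i f i).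
Proof.
move=> /choice[E fE]; exists (\bigcup_i E i); apply/seteqP; split=> P /=.
  move=> [i _]; rewrite fE /= => h EP; apply: h => x Ex.
  by apply: EP; exists i.
move=> /existsNP[x /not_implyP[[i _ Ex] Px]].
by exists i => //; rewrite fE /= => /(_ x Ex).
Qed.

HB.instance Definition _ := isOpenTopological.Build spec
  zariski_openT zariski_openI zariski_open_bigcup.

Definition basic_open_subproof (f : A) : open [set P : spec | ~ spec_set P f].
Proof.
exists [set f]; apply/seteqP; split=> P /= h.
  by move=> /(_ f erefl).
by move=> Pf; apply: h => _ ->.
Qed.

Definition basic_open (f : A) : opens spec := Opens (basic_open_subproof f).

Definition spec_stalk (P : spec) : comPzRingType :=
  localization (spec_prime P).

(* The fraction a/f on the open set D(f). *)
Definition spec_frac (af : A * A) (P : spec)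
    (h : open_set (basic_open af.2) P) : spec_stalk P :=
  frac_loc (spec_prime P) af.1 h.

Definition spec_local_data : local_data spec_stalk.
Proof.
refine (@LocalData spec spec_stalk (A * A)%type (fun af => basic_open af.2)
  spec_frac _ _ _ _ _).
- exists (0, 1) => P; have P1 : ~ spec_set P 1 by case: (spec_prime P).
  by exists P1; exact: frac_loc0.
- exists (1, 1) => P; have P1 : ~ spec_set P 1 by case: (spec_prime P).
  by exists P1; exact: frac_loc1.
- by move=> [a f]; exists (- a, f) => P h; exists h; exact: frac_locN.
- move=> [a f] [b g]; exists (a * g + b * f, f * g) => P h k.
  have l : ~ spec_set P (f * g) by case: (spec_prime P) => _ _ Pp /Pp[].
  by exists l; exact: frac_locD.
- move=> [a f] [b g]; exists (a * b, f * g) => P h k.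
  have l : ~ spec_set P (f * g) by case: (spec_prime P) => _ _ Pp /Pp[].
  by exists l; exact: frac_locM.
Defined.

(* A section of the structure sheaf over U is a function on U with value at P
   in A_P which is locally of the form a/f. *)
Definition Spec_space : ringed_space := local_sheaf spec_local_data.

End Spectrum.

Record rs_morphism (X Y : ringed_space) := RSMorphism {
  rsm_fun :> X -> Y;
  rsm_cont : continuous rsm_fun;
  rsm_comorphism : forall V : opens Y,
    {rmorphism sections V -> sections (preim_opens rsm_cont V)};
  rsm_natural : forall (U V : opens Y) (h : V `<=` U) (s : sections U),
    rsm_comorphism V (restr h s) =
    restr (preim_opensS (fc := rsm_cont) h) (rsm_comorphism U s) }.

(* f is an isomorphism from X to the ringed space (U, O_Y|U) for some open
   subset U of Y. *)
Definition open_immersion (X Y : ringed_space) (f : rs_morphism X Y) : Prop :=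
  [/\ injective f, forall U : set X, open U -> open (f @` U)
    & forall V : opens Y, V `<=` range f -> bijective (rsm_comorphism f V)].

Definition iso_to_Spec (X : ringed_space) (U : set X) (A : comPzRingType) :=
  exists f : rs_morphism (Spec_space A) X, open_immersion f /\ range f = U.

Definition affine_open (X : ringed_space) (U : set X) : Prop :=
  exists A : comPzRingType, iso_to_Spec U A.

(* A locally ringed space covered by affine open subsets. *)
Record scheme := Scheme {
  scheme_space :> ringed_space;
  scheme_local : forall x : scheme_space, local_ring (stalk x);
  scheme_affine : forall x : scheme_space,
    exists U : set scheme_space, affine_open U /\ U x }.

Definition noetherian_scheme (X : scheme) : Prop :=
  exists C : set (set X), [/\ finite_set C, \bigcup_(U in C) U = setT
    & forall U, C U -> exists A, noetherian_ring A /\ iso_to_Spec U A].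

Definition FA_scheme (X : scheme) : Prop :=
  forall S : set X, finite_set S -> exists U : set X, affine_open U /\ S `<=` U.

Section Irreducible.
Variable T : topologicalType.

Definition irreducible (Z : set T) : Prop := Z !=set0 /\
  forall A B : set T, closed A -> closed B ->
    Z `<=` A `|` B -> Z `<=` A \/ Z `<=` B.

Definition irreducible_component (F Z : set T) : Prop :=
  [/\ Z `<=` F, irreducible Z
    & forall Z', Z' `<=` F -> irreducible Z' -> Z `<=` Z' -> Z' = Z].

Definition positive_codimension (F : set T) : Prop :=
  forall Z, irreducible_component F Z -> ~ irreducible_component setT Z.

Lemma irreducible_closure1 (x : T) : irreducible (closure [set x]).
Proof.
split; first by exists x; apply: subset_closure.
move=> A B Ac Bc h; have [Ax|Bx] : (A `|` B) x.
- by apply: h; exact: subset_closure.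
- by left; rewrite ((closure_id A).1 Ac); apply: closure_subset => _ ->.
- by right; rewrite ((closure_id B).1 Bc); apply: closure_subset => _ ->.
Qed.

End Irreducible.

(* An integral closed subscheme of X is an irreducible closed subset with its
   reduced induced structure, which is [reduced_space] below. *)
Record integral_closed (X : scheme) := IntegralClosed {
  ic_set :> set X;
  ic_closed : closed ic_set;
  ic_irreducible : irreducible ic_set }.

HB.instance Definition _ X := gen_eqMixin (integral_closed X).
HB.instance Definition _ X := gen_choiceMixin (integral_closed X).

Definition point_closure (X : scheme) (x : X) : integral_closed X :=
  IntegralClosed (@closed_closure _ [set x]) (irreducible_closure1 x).

Section ReducedSpace.
Variables (X : scheme) (Y : set X).

Definition residue_ring (y : Y) : comPzRingType :=
  quot_ring (max_ideal (stalk (set_val y))).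

Lemma set_val_continuous : continuous (set_val : Y -> X).
Proof. exact: initial_continuous. Qed.

Definition residue_val (s : {U : opens X & sections U}) (y : Y)
    (h : open_set (preim_opens set_val_continuous (projT1 s)) y) : residue_ring y :=
  quot_pi (max_ideal (stalk (set_val y))) (germ h (projT2 s)).

Definition reduced_local_data : local_data residue_ring.
Proof.
refine (@LocalData Y residue_ring {U : opens X & sections U}
  (fun s => preim_opens set_val_continuous (projT1 s)) residue_val _ _ _ _ _).
- exists (existT _ (opensT X) (0 : sections (opensT X))) => y; exists I.
  by rewrite /residue_val germ0 rmorph0.
- exists (existT _ (opensT X) (1 : sections (opensT X))) => y; exists I.
  by rewrite /residue_val germ1 rmorph1.
- move=> [U s]; exists (existT _ U (- s)) => y h; exists h.
  by rewrite /residue_val germN rmorphN.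
- move=> [U s] [V t]; exists (existT _ (opensI U V)
    (restr (@opensIl _ U V) s + restr (@opensIr _ U V) t)) => y h k.
  exists (conj h k); rewrite /residue_val /= -rmorphD.
  by rewrite -(germ_restr (@opensIl _ U V) h (conj h k))
    -(germ_restr (@opensIr _ U V) k (conj h k)) -germD.
- move=> [U s] [V t]; exists (existT _ (opensI U V)
    (restr (@opensIl _ U V) s * restr (@opensIr _ U V) t)) => y h k.
  exists (conj h k); rewrite /residue_val /= -rmorphM.
  by rewrite -(germ_restr (@opensIl _ U V) h (conj h k))
    -(germ_restr (@opensIr _ U V) k (conj h k)) -germM.
Defined.

(* The reduced induced structure on Y: the sections are the functions with
   value at y in the residue field of O_{X,y} which are locally induced by
   sections of O_X. *)
Definition reduced_space : ringed_space := local_sheaf reduced_local_data.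

End ReducedSpace.

Section Divisors.
Variable X : scheme.

Definition cycle_group := {freeg integral_closed X}.

HB.instance Definition _ := GRing.Zmodule.on cycle_group.

(* g is a nonzero element of k(Y) = O_{Y,eta}, for eta the generic point
   of Y. *)
Record rat_function := RatFunction {
  rf_Y : integral_closed X;
  rf_eta : reduced_space rf_Y;
  rf_generic : closure [set rf_eta] = setT;
  rf_g : stalk rf_eta;
  rf_neq0 : rf_g <> 0 }.

Lemma rf_specialize (f : rat_function) (x : reduced_space (rf_Y f)) :
  closure [set rf_eta f] x.
Proof. by rewrite rf_generic. Qed.

(* ord_x(g) = l(O_{Y,x}/(a)) - l(O_{Y,x}/(b)) if g = a/b with a, b nonzero
   elements of O_{Y,x}. *)
Definition ord (f : rat_function) (x : reduced_space (rf_Y f)) : int :=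
  xget 0 [set n : int | exists a b : stalk x, [/\ a <> 0, b <> 0,
    rf_g f * specialization (@rf_specialize f x) b =
      specialization (@rf_specialize f x) a
    & n = (quot_length [set a])%:Z - (quot_length [set b])%:Z]].

(* The sum has finite support when X is noetherian; otherwise [\sum_(_ \in _)]
   may take the value 0 by convention. *)
Definition div (f : rat_function) : cycle_group :=
  \sum_(x \in [set x : reduced_space (rf_Y f) | krull_dim (stalk x) = 1%N])
    << ord x *g point_closure (set_val x) >>.

Definition rationally_equivalent (Z Z' : cycle_group) : Prop :=
  exists fs : seq rat_function, Z - Z' = \sum_(f <- fs) div f.

Definition generically_avoids (F : set X) (Z : cycle_group) : Prop :=
  forall Y : integral_closed X, Y \in dom Z -> ~ Y `<=` F.

End Divisors.

(* Main.v *)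
(* Write A = O_{X,x0}, m for its maximal ideal and d = dim A.  Call an integer n
   movable if n[x0] is rationally equivalent to a cycle generically avoiding F;
   the n with n and -n movable form a subgroup G of Z.

   If P is a prime of A with dim A/P = 1 whose generic point is not in F, and
   f in m is not in P, then the length of A/(P + f) is in G: on the curve-like
   subscheme Y defined by P, the finitely many points of codimension 1 lying in
   F, together with x0, are in an affine open subset, where prime avoidance
   produces a function with the same order as f at x0 and invertible at the
   other points.

   It remains to see that e(Q) is in G.  For an ideal J let L_J(n) be the length
   of A/(J + Q^n).  For every large k there is a superficial f in Q^k, outside
   any finite set of nonmaximal primes, such that L_{J+f}(n+k) = L_J(n+k) - L_J(n)
   for n large, after replacing J by its saturation.  If L_J is a polynomial with
   d! times its n^d coefficient equal to e, then the corresponding number for J + f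
   is k e.  Using k and k + 1 avoids any assumption on the residue field, and by
   induction one gets down to dimension 1, where the length of A/(J + f) is a sum
   of lengths of A/(P + f) with P as above. *)
From HB Require Import structures.
Require Import Defs.
From mathcomp Require Import all_boot all_order all_algebra ring.
From mathcomp Require Import all_classical topology_structure.
From mathcomp Require Import initial_topology subtype_topology.

Set Implicit Arguments.
Unset Strict Implicit.
Unset Printing Implicit Defensive.

Import Order.TTheory GRing.Theory Num.Theory.
Local Open Scope classical_set_scope.
Local Open Scope ring_scope.

(** * Ideals and chain conditions *)

(** Over a finite residue field a superficial element of degree 1 may not exist. Homogeneous primes
    of the Rees algebra can however be avoided in every large degree k, and (k + 1)e - ke = e
    removes the factor k; the factor d produced by taking a difference of polynomials is absorbed by
    d!.

    Saturating J makes f a nonzerodivisor modulo J. It alters L_J only by a constant, which leaves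
    the coefficient of n^d with d > 0 intact, and it keeps every nonmaximal prime over J.

    F enters through its ideal IF in A. Positive codimension bounds the dimension of A/IF by d - 1.
    Each f is taken outside the nonmaximal minimal primes over J and over J + IF, so that both
    dimension bounds drop together. In dimension 1 no nonmaximal prime over J contains IF any more,
    which is what the argument on the curve Y requires.

    Lengths are heights of intervals in the lattice of ideals, and homogeneous ideals of the Rees
    algebra are families of ideals of A; the induction thus stays inside the single ring A. *)

Section IdealTheory.
Variable A : comPzRingType.
Implicit Types (I J K Q : set A) (f x y : A).

Lemma idl0 I : is_ideal I -> I 0. Proof. by case. Qed.
Lemma idlD I x y : is_ideal I -> I x -> I y -> I (x + y).
Proof. by case=> _ + _; exact. Qed.
Lemma idlM I x y : is_ideal I -> I y -> I (x * y).
Proof. by case=> _ _; exact. Qed.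
Lemma idlMr I x y : is_ideal I -> I x -> I (x * y).
Proof. by move=> hI Ix; rewrite mulrC; exact: idlM. Qed.
Lemma idlB I x y : is_ideal I -> I x -> I y -> I (x - y).
Proof. by move=> hI Ix Iy; apply: idlD => //; exact: ideal_opp. Qed.
Lemma idlDl I x y : is_ideal I -> I x -> I (x + y) -> I y.
Proof. by move=> hI Ix /(idlB hI) /(_ Ix); rewrite addrC addKr. Qed.
Lemma idlT_eq I : is_ideal I -> I 1 -> I = setT.
Proof.
by move=> hI I1; apply/seteqP; split=> // x _; rewrite -[x]mulr1; exact: idlM.
Qed.
Lemma is_idealT : is_ideal [set: A]. Proof. by []. Qed.
Lemma is_ideal1 : is_ideal [set 0 : A].
Proof.
by split=> [//|x y -> ->|a x ->]; [exact: addr0|exact: mulr0].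
Qed.
Lemma is_idealI I J : is_ideal I -> is_ideal J -> is_ideal (I `&` J).
Proof.
move=> hI hJ; split=> [|x y [? ?] [? ?]|a x [? ?]]; split.
all: by [exact: idl0 | exact: idlD | exact: idlM].
Qed.

Definition iadd I J : set A := [set x | exists i j, [/\ I i, J j & x = i + j]].
Definition iscale f I : set A := [set x | exists2 y, I y & x = f * y].
Definition icolon J f : set A := [set x | J (f * x)].

Lemma is_ideal_iadd I J : is_ideal I -> is_ideal J -> is_ideal (iadd I J).
Proof.
move=> hI hJ; split.
- by exists 0, 0; rewrite addr0; split=> //; exact: idl0.
- move=> _ _ [i [j [Ii Jj ->]]] [i' [j' [Ii' Jj' ->]]].
  by exists (i + i'), (j + j'); rewrite addrACA; split=> //; exact: idlD.
- move=> a _ [i [j [Ii Jj ->]]].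
  by exists (a * i), (a * j); rewrite mulrDr; split=> //; exact: idlM.
Qed.

Lemma is_ideal_iscale f I : is_ideal I -> is_ideal (iscale f I).
Proof.
move=> hI; split.
- by exists 0; rewrite ?mulr0 //; exact: idl0.
- by move=> _ _ [x Ix ->] [y Iy ->]; exists (x + y); rewrite ?mulrDr //; exact: idlD.
- by move=> a _ [x Ix ->]; exists (a * x); rewrite ?(mulrCA a) //; exact: idlM.
Qed.

Lemma is_ideal_icolon J f : is_ideal J -> is_ideal (icolon J f).
Proof.
move=> hJ; split; rewrite /icolon /=.
- by rewrite mulr0; exact: idl0.
- by move=> x y ? ?; rewrite mulrDr; exact: idlD.
- by move=> a x ?; rewrite mulrCA; exact: idlM.
Qed.

Lemma iaddl I J : is_ideal J -> I `<=` iadd I J.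
Proof. by move=> hJ x Ix; exists x, 0; rewrite addr0; split=> //; exact: idl0. Qed.
Lemma iaddr I J : is_ideal I -> J `<=` iadd I J.
Proof. by move=> hI x Ix; exists 0, x; rewrite add0r; split=> //; exact: idl0. Qed.
Lemma iadd_sub I J K : is_ideal K -> I `<=` K -> J `<=` K -> iadd I J `<=` K.
Proof. by move=> hK IK JK _ [i [j [/IK Ii /JK Jj ->]]]; exact: idlD. Qed.
Lemma iadd_mono I J I' J' : I `<=` I' -> J `<=` J' -> iadd I J `<=` iadd I' J'.
Proof. by move=> h k _ [i [j [/h Ii /k Jj ->]]]; exists i, j. Qed.

Definition iaddp J f : set A := iadd J (iscale f setT).
Lemma is_ideal_iaddp J f : is_ideal J -> is_ideal (iaddp J f).
Proof. by move=> hJ; apply: is_ideal_iadd => //; exact: is_ideal_iscale. Qed.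
Lemma iaddpl J f : J `<=` iaddp J f.
Proof. by apply: iaddl; exact: is_ideal_iscale. Qed.
Lemma iaddpr J f : is_ideal J -> iaddp J f f.
Proof. by move=> hJ; apply: iaddr => //; exists 1; rewrite ?mulr1. Qed.
Lemma iaddp_sub J f K : is_ideal K -> J `<=` K -> K f -> iaddp J f `<=` K.
Proof.
by move=> hK JK Kf; apply: iadd_sub => // _ [y _ ->]; exact: idlMr.
Qed.
Lemma iaddpP J f x : iaddp J f x <-> exists y, exists2 j, J j & x = j + f * y.
Proof.
split=> [[j [_ [Jj [y _ ->] ->]]]|[y [j Jj ->]]]; first by exists y, j.
by exists j, (f * y); split=> //; exists y.
Qed.

Lemma ideal_mul_sub I J K : is_ideal K ->
  (forall x y, I x -> J y -> K (x * y)) -> ideal_mul I J `<=` K.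
Proof.
by move=> hK h x; apply; split=> // _ [i Ii] [j Jj] <-; exact: h.
Qed.
Lemma ideal_mul_in I J x y : I x -> J y -> ideal_mul I J (x * y).
Proof. by move=> Ix Jy K [_]; apply; exists x => //; exists y. Qed.
Lemma is_ideal_mul I J : is_ideal (ideal_mul I J).
Proof. exact: ideal_span_ideal. Qed.

Lemma is_ideal_exp Q n : is_ideal (ideal_exp Q n).
Proof. by case: n => [|n]; [exact: is_idealT | exact: is_ideal_mul]. Qed.
Hint Resolve is_ideal_exp : core.

Lemma ideal_expD Q m n x y :
  ideal_exp Q m x -> ideal_exp Q n y -> ideal_exp Q (m + n) (x * y).
Proof.
move=> + Qy; elim: m x => [|m IH] x; first by move=> _; exact: idlM.
move=> Qx; suff: ideal_exp Q m.+1 `<=` [set x | ideal_exp Q (m + n).+1 (x * y)].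
  by apply.
apply: ideal_mul_sub => [|u v Qu Qv /=].
  have hI := is_ideal_exp Q (m + n).+1; split=> [|a b|a b]; rewrite /mkset.
  - by rewrite mul0r; exact: idl0.
  - by rewrite mulrDl; exact: idlD.
  - by rewrite -mulrA; exact: idlM.
by rewrite -mulrA; apply: ideal_mul_in => //; exact: IH.
Qed.

(** Elimination form of Q^(m+n) = Q^m Q^n. The induction on m replaces K by the colon ideal (K : u),
    a device that recurs whenever a product of ideals is to be included in K. *)
Lemma ideal_expD_sub Q m n K : is_ideal K ->
  (forall x y, ideal_exp Q m x -> ideal_exp Q n y -> K (x * y)) ->
  ideal_exp Q (m + n) `<=` K.
Proof.
elim: m K => [|m IH] K hK h.
  by move=> x Qx; rewrite -[x]mul1r; exact: h.
apply: ideal_mul_sub => // u v Qu Qv.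
suff: ideal_exp Q (m + n) `<=` icolon K u by apply.
apply: IH; first exact: is_ideal_icolon.
by move=> x y Qx Qy; rewrite /icolon /= mulrA; apply: h => //; exact: ideal_mul_in.
Qed.

Lemma ideal_exp1 Q : is_ideal Q -> ideal_exp Q 1 = Q.
Proof.
move=> hQ; apply/seteqP; split=> [|x Qx].
  by apply: ideal_mul_sub => // x y Qx _; exact: idlMr.
by rewrite -[x]mulr1; exact: ideal_mul_in.
Qed.

Lemma ideal_exp_anti Q m n : (m <= n)%N -> ideal_exp Q n `<=` ideal_exp Q m.
Proof.
move=> /subnK <-; rewrite addnC; apply: ideal_expD_sub => // x y Qx _; exact: idlMr.
Qed.

Lemma ideal_exp_pow Q n x : is_ideal Q -> Q x -> ideal_exp Q n (x ^+ n).
Proof.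
by move=> hQ Qx; elim: n => [//|n IH]; rewrite exprS; exact: ideal_mul_in.
Qed.

Lemma ideal_expM_sub Q I m n K : is_ideal K -> ideal_exp Q m `<=` I ->
  ideal_exp I n `<=` K -> ideal_exp Q (m * n) `<=` K.
Proof.
move=> hK QI; elim: n K hK => [|n IH] K hK IK; first by rewrite muln0.
rewrite mulnS; apply: ideal_expD_sub => // x y Qx.
suff: ideal_exp Q (m * n) `<=` icolon K x by apply.
apply: IH => [|z Iz]; first exact: is_ideal_icolon.
by apply: IK; apply: ideal_mul_in => //; exact: QI.
Qed.

Definition acc := forall c : nat -> set A, (forall i, is_ideal (c i)) ->
  (forall i, c i `<=` c i.+1) -> exists i0, forall i, (i0 <= i)%N -> c i `<=` c i0.

End IdealTheory.
#[export] Hint Resolve is_ideal_exp : core.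
Arguments is_idealT {A}.

Lemma chain_mono T (c : nat -> set T) : (forall i, c i `<=` c i.+1) ->
  forall i j, (i <= j)%N -> c i `<=` c j.
Proof.
move=> h i j /subnK <-; elim: (j - i)%N => [//|k IH].
by apply: subset_trans IH _; rewrite addSn.
Qed.

(** Dependent choice: if every element of P had a strict successor, iteration would violate the
    chain hypothesis. [le] is an arbitrary relation, so that the lemma serves for ideals and for
    families of ideals compared degree by degree. *)
Lemma acc_maximal T (le : T -> T -> Prop) (P : T -> Prop) :
  (forall c : nat -> T, (forall i, P (c i)) -> (forall i, le (c i) (c i.+1)) ->
    exists i, le (c i.+1) (c i)) ->
  forall x0, P x0 -> exists2 x, P x & forall y, P y -> le x y -> le y x.
Proof.
move=> acc x0 Px0; apply: contrapT => h.
have next (x : {x | P x}) : {y : {y | P y} | le (sval x) (sval y) /\ ~ le (sval y) (sval x)}.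
  apply: cid; apply: contrapT => h'; apply: h; exists (sval x); first exact: svalP.
  move=> y Py xy; apply: contrapT => yx; apply: h'.
  by exists (exist _ y Py).
pose c n := iter n (fun x => sval (next x)) (exist _ x0 Px0).
have [i] := acc (fun n => sval (c n)) (fun n => svalP (c n))
  (fun n => proj1 (svalP (next (c n)))).
exact: (proj2 (svalP (next (c i)))).
Qed.

Lemma noetherian_acc (A : comPzRingType) : noetherian_ring A -> acc A.
Proof.
move=> noeth c cI cS; have cm := chain_mono cS.
have hU : is_ideal (\bigcup_i c i).
  split=> [|x y [i _ ci] [j _ cj]|a x [i _ ci]].
  - by exists 0%N => //; exact: idl0.
  - exists (maxn i j) => //; apply: idlD => //.
      by apply: cm ci; exact: leq_maxl.
    by apply: cm cj; exact: leq_maxr.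
  - by exists i => //; exact: idlM.
have [s sU] := noeth _ hU.
have [i0 si] : exists i0, [set` s] `<=` c i0.
  have : [set` s] `<=` \bigcup_i c i by rewrite sU => x sx K [_]; apply.
  elim: s {sU} => [|x s IH] sU; first by exists 0%N => x.
  have [|i hi] := IH; first by move=> y ys; apply: sU; rewrite /= inE ys orbT.
  have [|j _ cj] := sU x; first by rewrite /= inE eqxx.
  exists (maxn i j) => y /=; rewrite inE => /orP[/eqP ->|ys].
    by apply: cm cj; exact: leq_maxr.
  by apply: (cm i) (hi _ ys); exact: leq_maxl.
exists i0 => i _ x cx.
have : (\bigcup_i c i) x by exists i.
by rewrite sU; apply; split.
Qed.

Lemma ideal_maximal (A : comPzRingType) (P : set (set A)) (I0 : set A) : acc A ->
  (forall I, P I -> is_ideal I) -> P I0 ->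
  exists2 I, P I & forall J, P J -> I `<=` J -> J = I.
Proof.
move=> hacc PI PI0; have [|I HI Imax] := @acc_maximal _ (@subset A) P _ _ PI0.
  move=> c Pc cS; have [i h] := hacc c (fun i => PI _ (Pc i)) cS.
  by exists i; exact: h.
by exists I => // J PJ IJ; apply/seteqP; split=> //; exact: Imax.
Qed.

(** * Hilbert's basis theorem for a subring with one element adjoined *)

Section Hilbert.
Variable S : comPzRingType.

Definition subring_set (B : set S) :=
  [/\ B 1, forall x y, B x -> B y -> B (x + y), forall x y, B x -> B y -> B (x * y)
    & forall x, B x -> B (- x)].

Definition submod_set (B c : set S) :=
  [/\ c `<=` B, c 0, forall x y, c x -> c y -> c (x + y)
    & forall b x, B b -> c x -> c (b * x)].

Definition acc_on (B : set S) := forall c : nat -> set S,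
  (forall i, submod_set B (c i)) -> (forall i, c i `<=` c i.+1) ->
  exists i0, forall i, (i0 <= i)%N -> c i `<=` c i0.

Variables (B : set S) (u : S).
Hypothesis B_sub : subring_set B.

Definition adjoin : set S := [set y | exists n (b : nat -> S),
  (forall i, B (b i)) /\ y = \sum_(i < n) b i * u ^+ i].

Let B1 : B 1. Proof. by case: B_sub. Qed.
Let BD x y : B x -> B y -> B (x + y). Proof. by case: B_sub => _ + _ _; exact. Qed.
Let BM x y : B x -> B y -> B (x * y). Proof. by case: B_sub => _ _ + _; exact. Qed.
Let BN x : B x -> B (- x). Proof. by case: B_sub => _ _ _; exact. Qed.
Let B0 : B 0. Proof. by rewrite -(subrr 1); apply: BD => //; exact: BN. Qed.

Lemma adjoin_term b n : B b -> adjoin (b * u ^+ n).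
Proof.
move=> Bb; exists n.+1, (fun i => if i == n then b else 0); split.
  by move=> i; case: ifP.
rewrite big_ord_recr /= eqxx big1 ?add0r // => i _.
by rewrite (ltn_eqF (ltn_ord i)) mul0r.
Qed.

Lemma adjoin_base b : B b -> adjoin b.
Proof. by move=> Bb; rewrite -[b]mulr1 -(expr0 u); exact: adjoin_term. Qed.

Lemma adjoin_gen : adjoin u.
Proof. by rewrite -[u]mul1r -(expr1 u); exact: adjoin_term. Qed.

Lemma adjoinD x y : adjoin x -> adjoin y -> adjoin (x + y).
Proof.
move=> [n [b [Bb ->]]] [m [b' [Bb' ->]]].
pose t n (b : nat -> S) i := if (i < n)%N then b i else 0.
have widen k k' (c : nat -> S) : (k <= k')%N ->
    \sum_(i < k) c i * u ^+ i = \sum_(i < k') t k c i * u ^+ i.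
  move=> kk; rewrite (big_ord_widen _ (fun i => c i * u ^+ i) kk) big_mkcond /=.
  by apply: eq_bigr => i _; rewrite /t; case: ifP; rewrite ?mul0r.
exists (maxn n m), (fun i => t n b i + t m b' i); split.
  by move=> i; apply: BD; rewrite /t; case: ifP.
rewrite (widen n (maxn n m)) ?leq_maxl // (widen m (maxn n m)) ?leq_maxr //.
by rewrite -big_split; apply: eq_bigr => i _; rewrite mulrDl.
Qed.

Lemma adjoin_sum (I : finType) (F : I -> S) :
  (forall i, adjoin (F i)) -> adjoin (\sum_i F i).
Proof.
by move=> h; elim/big_ind: _ => //; [exact: adjoin_base|exact: adjoinD].
Qed.

Lemma adjoin_subring : subring_set adjoin.
Proof.
split.
- exact: adjoin_base.
- exact: adjoinD.
- move=> _ _ [n [b [Bb ->]]] [m [b' [Bb' ->]]].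
  rewrite mulr_suml; apply: adjoin_sum => i.
  rewrite mulr_sumr; apply: adjoin_sum => j.
  by rewrite mulrACA -exprD; apply: adjoin_term; exact: BM.
- move=> _ [n [b [Bb ->]]]; rewrite -sumrN; apply: adjoin_sum => i.
  by rewrite -mulNr; apply: adjoin_term; exact: BN.
Qed.

(* The coefficients of u^n in the elements of c of degree at most n in u; they
   form a chain both in n and in c. *)
Let lead (n : nat) (c : set S) : set S := [set b | B b /\ exists b' : nat -> S,
  (forall i, B (b' i)) /\ c (\sum_(i < n) b' i * u ^+ i + b * u ^+ n)].

Let lead_sub n c : submod_set adjoin c -> submod_set B (lead n c).
Proof.
case=> _ c0 cD cM; split.
- by move=> x [].
- split=> //; exists (fun=> 0); split=> //.
  by rewrite mul0r addr0 big1 // => i _; rewrite mul0r.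
- move=> x y [Bx [b [Bb h]]] [By [b' [Bb' h']]]; split; first exact: BD.
  exists (fun i => b i + b' i); split; first by move=> i; exact: BD.
  have := cD _ _ h h'; rewrite addrACA -mulrDl -big_split /=.
  by under eq_bigr => i _ do rewrite -mulrDl.
- move=> a x Ba [Bx [b [Bb h]]]; split; first exact: BM.
  exists (fun i => a * b i); split; first by move=> i; exact: BM.
  have := cM _ _ (adjoin_base Ba) h; rewrite mulrDr mulr_sumr mulrA.
  by under eq_bigr => i _ do rewrite mulrA.
Qed.

Let leadS n c : submod_set adjoin c -> lead n c `<=` lead n.+1 c.
Proof.
case=> _ c0 cD cM x [Bx [b [Bb h]]]; split=> //.
exists (fun i => if i is i'.+1 then b i' else 0); split; first by case.
have := cM _ _ adjoin_gen h; rewrite mulrDr mulr_sumr big_ord_recl mul0r add0r.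
by rewrite mulrCA -exprS; under eq_bigr => i _ do rewrite mulrCA -exprS.
Qed.

Let lead_mono n c c' : c `<=` c' -> lead n c `<=` lead n c'.
Proof. by move=> h x [Bx [b [Bb /h k]]]; split=> //; exists b. Qed.

(** The leading coefficient argument, with u in place of a variable. Since u may be algebraic over
    B, [lead] only asks for some expression of degree n with the given leading coefficient. *)
Lemma hilbert_basis : acc_on B -> acc_on adjoin.
Proof.
move=> hacc c cP cS; have cm := chain_mono cS.
have lm n n' i : (n <= n')%N -> lead n (c i) `<=` lead n' (c i).
  by move=> nn; apply: (chain_mono (c := fun n => lead n (c i))) => // k; exact: leadS.
(* The diagonal chain settles all degrees n >= i0 at once; each of the finitely many smaller degrees
   gets an index j n of its own. *)
have [|i|i0 hi0] := hacc (fun i => lead i (c i)).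
- by move=> i; exact: lead_sub.
- by apply: subset_trans (leadS (cP i)) _; exact: lead_mono.
have /choice[j hj] n : exists j, forall i, (j <= i)%N -> lead n (c i) `<=` lead n (c j).
  by apply: (hacc (fun i => lead n (c i))) => i; [exact: lead_sub|exact: lead_mono].
pose J := maxn i0 (\max_(n < i0) j n); exists J => i Ji.
have i0J : (i0 <= J)%N by exact: leq_maxl.
have key n : lead n (c i) `<=` lead n (c J).
  have [nlt|nge] := ltnP n i0.
    apply: (@subset_trans _ (lead n (c (j n)))).
      apply: hj; apply: leq_trans Ji; apply: leq_trans (leq_maxr _ _).
      exact: (leq_bigmax (Ordinal nlt)).
    apply: lead_mono; apply: cm; apply: leq_trans (leq_maxr _ _).
    exact: (leq_bigmax (Ordinal nlt)).
  pose k := maxn n i.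
  apply: (@subset_trans _ (lead k (c k))).
    apply: subset_trans (lm _ k _ (leq_maxl _ _)) _.
    by apply: lead_mono; apply: cm; exact: leq_maxr.
  apply: (@subset_trans _ (lead i0 (c i0))).
    by apply: hi0; apply: leq_trans nge (leq_maxl _ _).
  by apply: subset_trans (lm _ n _ nge) _; apply: lead_mono; exact: cm.
have [cB c0 cD cM] := cP i; have [JB J0 JD JM] := cP J.
have BN1 : adjoin (-1) by apply: adjoin_base; exact: BN.
move=> y cy; have [n [b [Bb yE]]] := cB _ cy.
elim: n => [|n IH] in y cy b Bb yE *; first by rewrite yE big_ord0.
have [|_ [b' [Bb' h]]] := key n (b n).
  by split=> //; exists b; split=> //; move: cy; rewrite yE big_ord_recr.
(* Subtracting an element of c J with the same leading coefficient b n lowers the degree of y and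
   stays in c i. *)
rewrite -(subrK (\sum_(i < n) b' i * u ^+ i + b n * u ^+ n) y).
apply: JD => //; apply: (IH _ _ (fun i => b i - b' i)).
- by apply: cD => //; rewrite -mulN1r; apply: cM => //; exact: cm h.
- by move=> k; apply: BD => //; exact: BN.
- rewrite yE big_ord_recr /= opprD addrACA subrr addr0 -sumrB.
  by apply: eq_bigr => k _; rewrite mulrBl.
Qed.

End Hilbert.

(** * Rees algebras, Artin-Rees and primary decomposition *)

Lemma acc_fg (A : comPzRingType) (I : set A) : acc A -> is_ideal I ->
  exists s : seq A, I = ideal_span [set` s].
Proof.
move=> hacc hI.
have [||J [s [sI ->]] Jmax] := @ideal_maximal A
  [set J | exists s : seq A, [set` s] `<=` I /\ J = ideal_span [set` s]]
  (ideal_span [set` [::]]) hacc.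
- by move=> _ [s [_ ->]]; exact: ideal_span_ideal.
- by exists [::].
exists s; apply/seteqP; split=> [x Ix|x]; last by apply; split.
have -> : ideal_span [set` s] = ideal_span [set` x :: s].
  apply/esym/Jmax.
    by exists (x :: s); split=> // y /=; rewrite inE => /orP[/eqP -> //|]; exact: sI.
  move=> y; apply; split; first exact: ideal_span_ideal.
  by move=> z zs K [_]; apply; rewrite /= inE; apply/orP; right.
by move=> K [_]; apply; rewrite /= inE eqxx.
Qed.

Section Rees.
Variables (A : comPzRingType) (Q : set A).

(** The homogeneous ideal of the Rees algebra (the sum of the Q^n t^n) whose component of degree n
    is N n t^n. *)
Definition rees_ideal (N : nat -> set A) :=
  [/\ forall n, is_ideal (N n), forall n, N n `<=` ideal_exp Q n
    & forall n q x, Q q -> N n x -> N n.+1 (q * x)].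

Lemma rees_idealM N m n x y : rees_ideal N -> ideal_exp Q m x -> N n y ->
  N (m + n)%N (x * y).
Proof.
case=> NI NQ NM; elim: m x => [|m IH] x Qx Ny; first exact: idlM.
suff: ideal_exp Q m.+1 `<=` icolon (N (m.+1 + n)%N) y.
  by move=> /(_ x Qx); rewrite /icolon /= mulrC.
apply: ideal_mul_sub => [|u v Qu Qv]; first exact: is_ideal_icolon.
by rewrite /icolon /= mulrC -mulrA; apply: NM => //; exact: IH.
Qed.

End Rees.

Lemma rees_acc_nz (A : comNzRingType) (Q : set A) : acc A -> is_ideal Q ->
  forall c : nat -> nat -> set A, (forall i, rees_ideal Q (c i)) ->
  (forall i n, c i n `<=` c i.+1 n) ->
  exists i0, forall i n, (i0 <= i)%N -> c i n `<=` c i0 n.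
Proof.
move=> hacc Q_ideal c cR cS.
(* Such families are graded ideals of the Rees algebra, the subring B of A[X]
   obtained by adjoining qX for q in a finite set of generators of Q. *)
have [s Qs] := acc_fg hacc Q_ideal.
pose fix B (s : seq A) : set {poly A} :=
  if s is a :: s' then adjoin (B s') (a%:P * 'X) else range (@polyC A).
have Bsub t : subring_set (B t).
  elim: t => [|a t IH]; last exact: adjoin_subring.
  split=> [|_ _ [x _ <-] [y _ <-]|_ _ [x _ <-] [y _ <-]|_ [x _ <-]] /=.
  - by exists 1.
  - by exists (x + y); rewrite ?polyCD.
  - by exists (x * y); rewrite ?polyCM.
  - by exists (- x); rewrite ?polyCN.
have Bacc t : acc_on (B t).
  elim: t => [|a t IH]; last exact: hilbert_basis.
  move=> d dP dS.
  have [i|i|i0 hi0] := hacc (fun i => [set x : A | d i (polyC x)]).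
  - have [dB d0 dD dM] := dP i; split=> /= [|x y dx dy|x y dx].
    + by rewrite /mkset polyC0.
    + by have := dD _ _ dx dy; rewrite -polyCD.
    + by have /= := dM (polyC x) _ _ dx; rewrite -polyCM; apply; exists x.
  - by move=> x /dS.
  exists i0 => i /hi0 h y dy; have [dB _ _ _] := dP i.
  by have [x _ xy] := dB _ dy; rewrite -xy; apply: h; rewrite /mkset xy.
have BC t a : B t a%:P.
  elim: t => [|b t IH]; first by exists a.
  exact: adjoin_base.
have BX t (q : A) : [set` t] q -> B t ((q : A)%:P * 'X).
  elim: t => [//|b t IH] /=; rewrite inE => /orP[/eqP ->|qt].
    by apply: adjoin_gen; exact: Bsub.
  by apply: adjoin_base; [exact: Bsub|exact: IH].
have [B1 BD BM BN] := Bsub s.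
have BQ n x : ideal_exp Q n x -> B s (x%:P * 'X^n).
  have BI k : is_ideal [set x : A | B s (x%:P * 'X^k)].
    split=> [|x' y' hx hy|a x' hx]; rewrite /mkset.
    - by have := BC s 0; rewrite polyC0 mul0r.
    - by rewrite polyCD mulrDl; exact: BD.
    - by rewrite polyCM -mulrA; apply: BM.
  elim: n x => [|n IH] x.
    by move=> _; rewrite expr0 mulr1; exact: BC.
  move: x; apply: (ideal_mul_sub (BI n.+1)) => q y Qq Qy.
  rewrite /mkset polyCM exprS mulrACA; apply: BM; last exact: IH.
  move: q Qq; rewrite Qs => q Qq.
  have : [set x : A | B s (x%:P * 'X^1)] q.
    by apply: Qq; split => // z zs; apply: BX.
  by [].
have coefB p n : B s p -> ideal_exp Q n p`_n.
  have : [set` s] `<=` Q by move=> z zs; rewrite Qs => K [_]; exact.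
  elim: s {Qs Bsub Bacc BC BX B1 BD BM BN BQ} p n => [|a t IH] p n sQ.
    case=> x _ <-; rewrite coefC; case: n => [//|n].
    exact: (idl0 (is_ideal_exp Q n.+1)).
  have IHt q k : B t q -> ideal_exp Q k q`_k.
    by apply: IH => z zt; apply: sQ; rewrite /= inE; apply/orP; right.
  have Qa : Q a by apply: sQ; rewrite /= inE eqxx.
  case=> k [b [Bb ->]]; rewrite coef_sum.
  have hQ := is_ideal_exp Q n; elim/big_ind: _ => [|x y|i _].
  - exact: (idl0 hQ).
  - exact: (idlD hQ).
  rewrite exprMn -rmorphXn /= mulrA. rewrite coefMXn; case: ltnP => [_|ik].
    exact: (idl0 hQ).
  rewrite coefMC; have Qai : ideal_exp Q i (a ^+ i) by exact: ideal_exp_pow.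
  by have := ideal_expD (IHt _ (n - i)%N (Bb i)) Qai; rewrite subnK.
(* The family c i as an ideal of B s; c i n is recovered from the monomials x X^n that it
   contains. *)
pose d i : set {poly A} := [set p | B s p /\ forall n, c i n p`_n].
have [i|i|i0 hi0] := Bacc s d.
- have [cI cQ cM] := cR i; split=> [p []//||p q [Bp hp] [Bq hq]|p q Bp [Bq hq]].
  + split=> [|n]; first by have := BC s 0; rewrite polyC0.
    by rewrite coef0; exact: idl0.
  + by split=> [|n]; [exact: BD|rewrite coefD; exact: idlD].
  + split=> [|n]; first exact: BM.
    rewrite coefM; have hI := cI n; elim/big_ind: _ => [|x y|j _].
    * exact: idl0.
    * exact: idlD.
    by have := rees_idealM (cR i) (coefB _ j Bp) (hq (n - j)%N);
      rewrite (subnKC (leq_ord j)).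
- by move=> p [Bp hp]; split=> // n; apply: cS.
exists i0 => i n /hi0 h x cx; have [cI cQ cM] := cR i.
have [|_ /(_ n)] := h (x%:P * 'X^n).
  split; first by apply: BQ; exact: cQ.
  move=> k; rewrite coefCM coefXn; case: eqVneq => [->|_].
    by rewrite mulr1.
  by rewrite mulr0; exact: idl0.
by rewrite coefCM coefXn eqxx mulr1.
Qed.

(* [{poly A}] is only available when 1 != 0 in A. *)
Lemma comPzRing_nz (P : comPzRingType -> Prop) :
  (forall A : comNzRingType, P A) -> forall A : comPzRingType, 1 != 0 :> A -> P A.
Proof.
move=> H A A1.
pose A' : comNzRingType := HB.pack (GRing.ComPzRing.sort A)
  (GRing.PzSemiRing_isNonZero.Build A A1).
have -> : A = A' :> comPzRingType by rewrite /A'; case: A A1 {A'} => T [].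
exact: H.
Qed.

Section ReesTheory.
Variables (A : comPzRingType) (Q : set A).
Hypothesis hacc : acc A.
Hypothesis Q_ideal : is_ideal Q.

Lemma rees_acc (c : nat -> nat -> set A) : (forall i, rees_ideal Q (c i)) ->
  (forall i n, c i n `<=` c i.+1 n) ->
  exists i0, forall i n, (i0 <= i)%N -> c i n `<=` c i0 n.
Proof.
have [A0|A1] := eqVneq (1 : A) 0.
  move=> cR cS; exists 0%N => i n _ x _; rewrite -[x]mulr1 A0 mulr0.
  by case: (cR 0%N) => h _ _; exact: idl0.
have h := @comPzRing_nz (fun A => forall Q : set A, acc A -> is_ideal Q ->
  forall c : nat -> nat -> set A, (forall i, rees_ideal Q (c i)) ->
  (forall i n, c i n `<=` c i.+1 n) ->
  exists i0, forall i n, (i0 <= i)%N -> c i n `<=` c i0 n) rees_acc_nz A A1 Q.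
exact: h.
Qed.

Lemma rees_maximal (P : (nat -> set A) -> Prop) N0 : P N0 ->
  (forall N, P N -> rees_ideal Q N) ->
  exists2 N, P N & forall M, P M -> (forall n, N n `<=` M n) ->
    forall n, M n `<=` N n.
Proof.
move=> PN0 PR.
apply: (acc_maximal (le := fun N M => forall n, N n `<=` M n) _ PN0) => c Pc cS.
have [|i0 h] := rees_acc (c := c) _ cS; first by move=> i; exact: PR.
by exists i0 => n; exact: h.
Qed.

(** c i is the ideal of the Rees algebra generated by the components Q^n [&] H with n <= i. These
    ideals increase with i, hence are stationary from some i0 on, and then Q^(n+i0) [&] H = Q^n
    (Q^i0 [&] H). *)
Lemma artin_rees (H : set A) : is_ideal H ->
  exists n0, forall n x, ideal_exp Q (n + n0) x -> H x -> ideal_mul (ideal_exp Q n) H x.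
Proof.
move=> hH.
pose c i n := if (n <= i)%N then ideal_exp Q n `&` H
  else ideal_mul (ideal_exp Q (n - i)) (ideal_exp Q i `&` H).
have cI i n : is_ideal (c i n).
  by rewrite /c; case: ifP => _; [exact: is_idealI|exact: is_ideal_mul].
have csub i n : c i n `<=` ideal_exp Q n `&` H.
  rewrite /c; case: leqP => [_ x //|ni].
  apply: ideal_mul_sub; first exact: is_idealI.
  move=> x y Qx [Qy Hy]; split; last exact: idlM.
  by rewrite -(subnK (ltnW ni)); exact: ideal_expD.
have [i|i n|i0 hi0] := rees_acc (c := c).
- split=> // [n|n q x Qq cx]; first by apply: subset_trans (@csub i n) _ => x [].
  have [Qx Hx] := csub _ _ _ cx.
  rewrite /c; case: (leqP n.+1 i) => [_|ni].
    by split; [exact: ideal_mul_in|exact: idlM].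
  move: cx; rewrite /c; case: (leqP n i) => [ni'|ni' cx].
    have -> : i = n by apply/eqP; rewrite eqn_leq ni' -ltnS ni.
    rewrite subSn // subnn => -[_ _]; apply: ideal_mul_in => //.
    by rewrite ideal_exp1.
  suff: ideal_mul (ideal_exp Q (n - i)) (ideal_exp Q i `&` H) `<=`
    icolon (ideal_mul (ideal_exp Q (n.+1 - i)) (ideal_exp Q i `&` H)) q by apply.
  apply: ideal_mul_sub => [|u v Qu Hv]; first by apply: is_ideal_icolon; exact: is_ideal_mul.
  rewrite /icolon /= mulrA; apply: ideal_mul_in => //.
  by rewrite subSn 1?ltnW //; exact: ideal_mul_in.
- rewrite {2}/c; case: (leqP n i.+1) => [_|ni]; first exact: csub.
  rewrite /c leqNgt (ltn_trans _ ni) //=; apply: ideal_mul_sub; first exact: is_ideal_mul.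
  move=> x y; rewrite -(subnSK (ltnW ni)) -addn1 => + [Qy Hy].
  suff: ideal_exp Q ((n - i.+1) + 1) `<=`
    icolon (ideal_mul (ideal_exp Q (n - i.+1)) (ideal_exp Q i.+1 `&` H)) y.
    by move=> /[apply]; rewrite /icolon /= mulrC.
  apply: ideal_expD_sub; first by apply: is_ideal_icolon; exact: is_ideal_mul.
  move=> u v Qu; rewrite ideal_exp1 // => Qv; rewrite /icolon /= mulrC -mulrA.
  by apply: ideal_mul_in => //; split; [exact: ideal_mul_in|exact: idlM].
exists i0 => n x Qx Hx.
have : c (n + i0)%N (n + i0)%N x by rewrite /c leqnn.
move=> /(hi0 _ _ (leq_addl _ _)); rewrite /c; case: (leqP (n + i0) i0) => [|_].
  rewrite -{2}[i0]add0n leq_add2r leqn0 => /eqP n0 _.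
  by rewrite n0 -[x]mul1r; apply: ideal_mul_in.
rewrite addnK; apply: ideal_mul_sub; first exact: is_ideal_mul.
by move=> u v Qu [_ Hv]; exact: ideal_mul_in.
Qed.

(** Krull's theorem in A/I. Artin-Rees for I + (x), with n = 1, puts x in I + xQ, so (1 - r)x is in
    I for some r in Q, and 1 - r is invertible. *)
Lemma krull_intersection (I : set A) x : is_ideal I ->
  (forall q, Q q -> exists b, (1 - q) * b = 1) ->
  (forall n, iadd I (ideal_exp Q n) x) -> I x.
Proof.
move=> hI Q1 h; have hH := is_ideal_iaddp x hI.
have [n0 n0P] := artin_rees hH.
have [i [q [Ii Qq xE]]] := h (1 + n0)%N.
have Hx : iaddp I x x by exact: iaddpr.
have Hq : iaddp I x q.
  by apply: (idlDl hH (x := i)); [exact: iaddpl|rewrite -xE].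
have : iadd I (iscale x Q) q.
  have hK := is_ideal_iadd hI (is_ideal_iscale x Q_ideal).
  move: (n0P _ _ Qq Hq); apply: ideal_mul_sub => // u v.
  rewrite ideal_exp1 // => Qu /iaddpP[w [j Ij ->]].
  exists (u * j), (x * (u * w)); split; first exact: idlM.
    by exists (u * w) => //; exact: idlMr.
  by ring.
move=> [j [_ [Ij [r Qr ->] qE]]].
have [b bE] := Q1 _ Qr.
have -> : x = b * (i + j).
  have -> : i + j = (1 - r) * x.
    by rewrite {1}mulrBl mul1r {1}xE qE; ring.
  by rewrite mulrA [b * _]mulrC bE mul1r.
by apply: idlM => //; exact: idlD.
Qed.

End ReesTheory.

(** * Primes over an ideal of a noetherian ring *)

Section PrimeLists.
Variable A : comPzRingType.
Hypothesis hacc : acc A.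

Lemma prime_subM (P I J : set A) : prime_ideal P -> ideal_mul I J `<=` P ->
  I `<=` P \/ J `<=` P.
Proof.
case=> hP _ Pp h; have [|/existsNP[x /not_implyP[Ix Px]]] := pselect (I `<=` P); first by left.
right=> y Jy; have [//|//] := Pp x y (h _ (ideal_mul_in Ix Jy)).
Qed.

(** Noetherian induction: a maximal counterexample I is not prime, so it contains some xy with x and
    y outside it. Since (I + (x))(I + (y)) lies in I, the lists for the two larger ideals can be
    concatenated. *)
Lemma prime_decomposition (J : set A) : is_ideal J ->
  exists s : seq (set A), [/\ forall P, List.In P s -> prime_ideal P,
    forall P, List.In P s -> J `<=` P & foldr (@ideal_mul A) setT s `<=` J].
Proof.
move=> hJ; apply: contrapT => hn.
have [||I [hI nI] Imax] := @ideal_maximal A [set J | is_ideal J /\ ~ exists s : seq (set A),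
  [/\ forall P, List.In P s -> prime_ideal P,
    forall P, List.In P s -> J `<=` P & foldr (@ideal_mul A) setT s `<=` J]] J hacc.
- by move=> ? [].
- by split.
have big K : is_ideal K -> I `<=` K -> ~ K `<=` I -> exists s : seq (set A),
  [/\ forall P, List.In P s -> prime_ideal P,
    forall P, List.In P s -> K `<=` P & foldr (@ideal_mul A) setT s `<=` K].
  move=> hK IK KI; apply: contrapT => nK; apply: KI.
  by rewrite (Imax K).
have I1 : ~ I 1.
  move=> I1; apply: nI; exists [::]; split=> //= x _.
  by rewrite -[x]mulr1; exact: idlM.
have [Pp|/existsNP[x /existsNP[y /not_implyP[Ixy /not_orP[Ix Iy]]]]] :=
  pselect (forall x y, I (x * y) -> I x \/ I y).
  apply: nI; exists [:: I]; split=> [P [<-//|[]]|P [<-//|[]]|] /=.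
  by apply: ideal_mul_sub => // u v Iu _; exact: idlMr.
have [||s [s1 s2 s3]] := big (iaddp I x) (is_ideal_iaddp x hI).
- exact: iaddpl.
- by move=> h; apply: Ix; apply: h; exact: iaddpr.
have [||t [t1 t2 t3]] := big (iaddp I y) (is_ideal_iaddp y hI).
- exact: iaddpl.
- by move=> h; apply: Iy; apply: h; exact: iaddpr.
apply: nI; exists (s ++ t); split.
- by move=> P /(@List.in_app_or _ s t)[/s1|/t1].
- move=> P /(@List.in_app_or _ s t)[/s2|/t2] h; apply: subset_trans h; exact: iaddpl.
have hst K : is_ideal K ->
    (forall u v, foldr (@ideal_mul A) setT s u -> foldr (@ideal_mul A) setT t v -> K (u * v)) ->
    foldr (@ideal_mul A) setT (s ++ t) `<=` K.
  elim: s {s1 s2 s3} K => [|P s IH] K hK h /=.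
    by move=> z tz; rewrite -[z]mul1r; exact: h.
  apply: ideal_mul_sub => // u v Pu.
  suff: foldr (@ideal_mul A) setT (s ++ t) `<=` icolon K u by apply.
  apply: IH => [|a b sa tb]; first exact: is_ideal_icolon.
  by rewrite /icolon /= mulrA; apply: h => //; exact: ideal_mul_in.
apply: hst => // _ _ /s3/iaddpP[a [i Ii ->]] /t3/iaddpP[b [j Ij ->]].
have -> : (i + x * a) * (j + y * b) = (j + y * b) * i + (x * a) * j + (a * b) * (x * y) by ring.
by apply: idlD => //; [apply: idlD => //|]; exact: idlM.
Qed.

(** A prime over J contains a product of the listed primes, hence one of them: all minimal primes
    over J are on the list. *)
Lemma prime_list (J : set A) : is_ideal J ->
  exists s : seq (set A), [/\ forall P, List.In P s -> prime_ideal P,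
    forall P, List.In P s -> J `<=` P
    & forall P, prime_ideal P -> J `<=` P -> exists2 P', List.In P' s & P' `<=` P].
Proof.
move=> /prime_decomposition[s [s1 s2 s3]]; exists s; split=> // P hP JP.
have {s3} : foldr (@ideal_mul A) setT s `<=` P by exact: subset_trans s3 JP.
elim: s {s1 s2} => [|P' s IH] /=.
  by case: hP => _ P1 _ /(_ 1 I).
move=> /(prime_subM hP)[h|/IH[P'' sP'' h]]; first by exists P' => //; left.
by exists P'' => //; right.
Qed.

Lemma prime_only_pow (J m : set A) : is_ideal J ->
  (forall P, prime_ideal P -> J `<=` P -> P = m) ->
  exists n, ideal_exp m n `<=` J.
Proof.
move=> hJ Jm; have [s [s1 s2 s3]] := prime_decomposition hJ.
exists (size s); apply: subset_trans s3.
elim: s s1 s2 => [//|P s IH] s1 s2 /=.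
have Pm : P = m by apply: Jm; [apply: s1|apply: s2]; left.
apply: ideal_mul_sub => [|x y mx my]; first exact: is_ideal_mul.
apply: ideal_mul_in; first by rewrite Pm.
by move: y my; apply: IH => P' hP'; [apply: s1|apply: s2]; right.
Qed.

(** An associated prime of A/J: a maximal one among the ideals (J : x) with x outside J is prime,
    since (J : xb) contains (J : x). *)
Lemma maximal_annihilator (J : set A) : is_ideal J -> ~ J 1 ->
  exists x, ~ J x /\ prime_ideal (icolon J x).
Proof.
move=> hJ J1; have [||P [x Jx ->] Pmax] := @ideal_maximal A
  [set P | exists2 x, ~ J x & P = icolon J x] (icolon J 1) hacc.
- by move=> _ [x _ ->]; exact: is_ideal_icolon.
- by exists 1.
exists x; split=> //; split; first exact: is_ideal_icolon.
  by rewrite /icolon /= mulr1.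
move=> a b; rewrite /icolon /= => h.
have [|xb] := pselect (J (x * b)); first by right.
left; have E : icolon J (x * b) = icolon J x.
  by apply: Pmax; [exists (x * b)|move=> c; rewrite /icolon /= mulrAC; exact: idlMr].
have : icolon J (x * b) a by rewrite /icolon /= mulrAC -mulrA.
by rewrite E.
Qed.

End PrimeLists.

(** * Lengths of intervals of ideals *)

Section Chains.
Variables (T : Type).
Implicit Type P : set (set T).

Definition has_chain P n := exists c, strict_chain P n c.
Definition finite_height P := exists b, forall n, has_chain P n -> (n <= b)%N.

Lemma chain_height_max P n : has_chain P n -> (forall m, has_chain P m -> (m <= n)%N) ->
  chain_height P = n.
Proof.
move=> Pn nmax; rewrite /chain_height; case: xgetP => [k -> [Pk kmax]|/(_ n)/= h].
  by apply/eqP; rewrite eqn_leq nmax // kmax.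
by case: h.
Qed.

Lemma chain_height_spec P : finite_height P -> P !=set0 ->
  has_chain P (chain_height P) /\ forall m, has_chain P m -> (m <= chain_height P)%N.
Proof.
move=> [b bP] [X PX].
have ex : exists n, `[< has_chain P n >].
  by exists 0%N; apply/asboolP; exists (fun=> X); split.
have bd n : `[< has_chain P n >] -> (n <= b)%N by move=> /asboolP/bP.
case: (ex_maxnP ex bd) => n /asboolP Pn nmax.
have E : chain_height P = n.
  by apply: chain_height_max => // m Pm; apply: nmax; apply/asboolP.
by rewrite E; split=> // m Pm; apply: nmax; apply/asboolP.
Qed.

(** The default value of [chain_height] is 0, so a positive value is an attained maximum. *)
Lemma chain_height_gt0 P : (0 < chain_height P)%N ->
  has_chain P (chain_height P) /\ forall m, has_chain P m -> (m <= chain_height P)%N.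
Proof. by rewrite /chain_height; case: xgetP => // k -> [? ?] _. Qed.

Lemma has_chain_rcons P n c X : strict_chain P n c -> P X -> c n `<` X ->
  exists2 c', strict_chain P n.+1 c' & c' n.+1 = X.
Proof.
move=> [cP cS] PX cX; exists (fun i => if (i <= n)%N then c i else X); last by rewrite ltnn.
split=> i; first by case: ifP => // h _; exact: cP.
move=> h; have /orP[/eqP ->|lin] : (i == n) || (i < n)%N by rewrite -leq_eqVlt.
  by rewrite leqnn ltnn.
by rewrite (ltnW lin) lin; exact: cS.
Qed.

Lemma has_chain_cat P n c m d : strict_chain P n c -> strict_chain P m d ->
  c n `<=` d 0%N -> has_chain P (n + m).
Proof.
move=> [cP cS] [dP dS] cd; exists (fun i => if (i <= n)%N then c i else d (i - n)%N).
split=> i.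
  by case: (leqP i n) => h k; [exact: cP|apply: dP; rewrite leq_subLR].
case: (ltngtP i n) => [lin _|ni|->].
- exact: cS.
- by move=> h; rewrite subSn ?(ltnW ni) //; apply: dS; rewrite ltn_subLR // ltnW.
- rewrite -{1}[n]addn0 ltn_add2l subSnn => /dS d01; split.
    by apply: subset_trans cd _; exact: properW.
  by case: d01 => _ h k; apply: h; exact: subset_trans k cd.
Qed.

End Chains.

Lemma has_chain_map (T T' : Type) (P : set (set T)) (P' : set (set T')) g n :
  (forall X, P X -> P' (g X)) ->
  (forall X Y, P X -> P Y -> X `<` Y -> g X `<` g Y) ->
  has_chain P n -> has_chain P' n.
Proof.
move=> gP gS [c [cP cS]]; exists (fun i => g (c i)); split=> i ni; first exact/gP/cP.
by apply: gS; [exact/cP/ltnW|exact: cP|exact: cS].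
Qed.

Lemma chain_height_eq (T T' : Type) (P : set (set T)) (P' : set (set T')) :
  (forall n, has_chain P n <-> has_chain P' n) -> chain_height P = chain_height P'.
Proof.
move=> h; rewrite /chain_height; congr xget; apply/seteqP; split=> n [/h Pn nmax].
  by split=> // m /h; exact: nmax.
by split=> // m /h; exact: nmax.
Qed.

Section IntervalLength.
Variable A : comPzRingType.
Implicit Types (I J H K : set A) (f x y : A).

(** Submodules of I/J are the ideals between J and I, so [ilen J I] is the length of I/J. As
    [chain_height] is 0 on an unbounded interval, finiteness [ifin] has to be carried along. *)
Definition interval J I : set (set A) := [set K | [/\ is_ideal K, J `<=` K & K `<=` I]].
Definition ilen J I : nat := chain_height (interval J I).
Definition ifin J I : Prop := finite_height (interval J I).

Lemma ilen_spec J I : is_ideal J -> J `<=` I -> ifin J I ->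
  has_chain (interval J I) (ilen J I) /\
  forall m, has_chain (interval J I) m -> (m <= ilen J I)%N.
Proof. by move=> hJ JI fJ; apply: chain_height_spec => //; exists J; split=> // x. Qed.

Lemma ifin_sub J I J' I' : J `<=` J' -> I' `<=` I -> ifin J I -> ifin J' I'.
Proof.
move=> JJ II [b bP]; exists b => n [c [cP cS]]; apply: bP; exists c; split=> // i ni.
have [h1 h2 h3] := cP i ni; split=> //; first exact: subset_trans h2.
exact: subset_trans II.
Qed.

(** By the modular law, a strict step of the chain remains strict after intersecting with H or after
    adding H. The last terms of the two chains are recorded so that the induction can extend them.
    This is the upper bound in the additivity of length. *)
Lemma chain_split J H I n c : is_ideal H -> is_ideal I -> J `<=` H -> H `<=` I ->
  strict_chain (interval J I) n c -> exists p q, [/\ (n <= p + q)%N,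
    exists2 d, strict_chain (interval J H) p d & d p = c n `&` H
    & exists2 d, strict_chain (interval H I) q d & d q = iadd (c n) H].
Proof.
move=> hH hI JH HI cP.
have cap K : interval J I K -> interval J H (K `&` H).
  move=> [hK JK KI]; split; first exact: is_idealI.
    by move=> x Jx; split; [exact: JK|exact: JH].
  by move=> x [].
have sum K : interval J I K -> interval H I (iadd K H).
  move=> [hK JK KI]; split; first exact: is_ideal_iadd.
    exact: iaddr.
  exact: iadd_sub.
elim: n cP => [|n IH] [cP cS].
  exists 0%N, 0%N; split=> //.
    by exists (fun=> c 0%N `&` H) => //; split=> // i _; apply: cap; exact: cP.
  by exists (fun=> iadd (c 0%N) H) => //; split=> // i _; apply: sum; exact: cP.
have [|p [q [npq [d dP dE] [e eP eE]]]] := IH.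
  by split=> i ni; [apply: cP; exact: leqW|apply: cS; exact: leqW].
have [hc Jc cI] := cP n (leqnSn _); have [hc' Jc' cI'] := cP n.+1 (leqnn _).
have [cc ncc] := cS n (leqnn _).
have [h|h] := pselect (c n.+1 `&` H `<=` c n `&` H).
  have h' : iadd (c n) H `<` iadd (c n.+1) H.
    split; first exact: iadd_mono.
    move=> k; apply: ncc => x cx; have [y [z [cy Hz xE]]] := k x (iaddl hH cx).
    rewrite xE; apply: idlD => //; suff /h[] : (c n.+1 `&` H) z by [].
    by split=> //; rewrite -[z](addKr y) -xE addrC; apply: idlB => //; exact: cc.
  exists p, q.+1; rewrite addnS ltnS; split=> //.
    exists d => //; rewrite dE; apply/seteqP; split=> // x [cx Hx].
    by split=> //; exact: cc.
  by apply: has_chain_rcons eP _ _; [apply: sum; exact: cP|rewrite eE].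
have [d' d'P d'E] : exists2 d', strict_chain (interval J H) p.+1 d' & d' p.+1 = c n.+1 `&` H.
  apply: has_chain_rcons dP _ _; first by apply: cap; exact: cP.
  by rewrite dE; split=> // x [cx Hx]; split=> //; exact: cc.
have [h'|h'] := pselect (iadd (c n.+1) H `<=` iadd (c n) H).
  exists p.+1, q; rewrite addSn ltnS; split=> //; first by exists d'.
  exists e => //; rewrite eE; apply/seteqP; split=> //; exact: iadd_mono.
have [e' e'P e'E] : exists2 e', strict_chain (interval H I) q.+1 e' & e' q.+1 = iadd (c n.+1) H.
  apply: has_chain_rcons eP _ _; first by apply: sum; exact: cP.
  by rewrite eE; split=> //; exact: iadd_mono.
exists p.+1, q.+1; split; [|by exists d'|by exists e'].
by rewrite addSn addnS ltnS; exact: leqW.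
Qed.

Lemma ilen_add J H I : is_ideal J -> is_ideal H -> is_ideal I -> J `<=` H -> H `<=` I ->
  ifin J H -> ifin H I -> ifin J I /\ ilen J I = (ilen J H + ilen H I)%N.
Proof.
move=> hJ hH hI JH HI fJ fH.
have [[c cP] cmax] := ilen_spec hJ JH fJ; have [[d dP] dmax] := ilen_spec hH HI fH.
have bd n : has_chain (interval J I) n -> (n <= ilen J H + ilen H I)%N.
  move=> [e eP]; have [p [q [npq [d' d'P _] [e' e'P _]]]] := chain_split hH hI JH HI eP.
  by apply: leq_trans npq (leq_add _ _); [apply: cmax; exists d'|apply: dmax; exists e'].
split; first by exists (ilen J H + ilen H I)%N.
apply: chain_height_max => //; apply: (has_chain_cat (c := c) (d := d)).
- case: cP => cP cS; split=> // i /cP[? ? h]; split=> //; exact: subset_trans h HI.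
- case: dP => dP dS; split=> // i /dP[? h ?]; split=> //; exact: subset_trans JH h.
- case: cP => /(_ _ (leqnn _))[_ _ h] _; case: dP => /(_ _ (leq0n _))[_ k _] _.
  exact: subset_trans h k.
Qed.

Lemma ilen_eq0 J I : is_ideal J -> is_ideal I -> J `<=` I -> ifin J I ->
  ilen J I = 0%N -> I `<=` J.
Proof.
move=> hJ hI JI fJ l0; apply: contrapT => IJ.
have [_ /(_ 1%N)] := ilen_spec hJ JI fJ; rewrite l0 => h.
suff /h : has_chain (interval J I) 1 by [].
exists (fun i => if i is 0%N then J else I).
by split=> [[|i] _|[|i] //]; split=> // x.
Qed.

Lemma ilen_refl J : is_ideal J -> ifin J J /\ ilen J J = 0%N.
Proof.
move=> hJ; have bd n : has_chain (interval J J) n -> (n <= 0)%N.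
  move=> [c [cP cS]]; case: n cP cS => // n cP cS; have [_ h] := cS 0%N isT.
  have [_ Jc _] := cP 0%N isT; have [_ _ cJ] := cP 1%N isT.
  by case: h; exact: subset_trans cJ Jc.
split; first by exists 0%N.
by apply: chain_height_max => //; exists (fun=> J); split=> // i _; split=> // x.
Qed.

Section MulIso.
Variables (f : A) (J I J1 : set A).
Hypotheses (hJ : is_ideal J) (hI : is_ideal I) (hJ1 : is_ideal J1) (JI : J `<=` I).
Hypothesis fJ : forall y, J y -> J1 (f * y).
Hypothesis fI : forall y, I y -> J1 (f * y) -> J y.

Let has_chain_mul n : has_chain (interval J I) n <->
  has_chain (interval J1 (iadd J1 (iscale f I))) n.
Proof.
have hI1 : is_ideal (iscale f I) by exact: is_ideal_iscale.
split; [apply: (has_chain_map (g := fun K => iadd J1 (iscale f K)))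
       |apply: (has_chain_map (g := fun K => I `&` icolon K f))].
- move=> K [hK JK KI]; split.
  + by apply: is_ideal_iadd => //; exact: is_ideal_iscale.
  + by apply: iaddl; exact: is_ideal_iscale.
  + by apply: iadd_mono => // _ [y /KI Iy ->]; exists y.
- move=> K K' [hK JK KI] [hK' JK' KI'] [KK nKK]; split.
    by apply: iadd_mono => // _ [y /KK ? ->]; exists y.
  move=> h; apply: nKK => y Ky.
  have [j [_ [Jj [k Kk ->] yE]]] : iadd J1 (iscale f K) (f * y).
    by apply: h; apply: iaddr => //; exists y.
  rewrite -(subrK k y); apply: idlD => //; apply: JK; apply: fI.
    by apply: idlB => //; [exact: KI'|exact: KI].
  by rewrite mulrBr yE addrK.
- move=> K [hK JK KI]; split.
  + by apply: is_idealI => //; exact: is_ideal_icolon.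
  + by move=> y Jy; split; [exact: JI|apply: JK; exact: fJ].
  + by move=> y [].
- move=> K K' [hK JK KI] [hK' JK' KI'] [KK nKK]; split.
    by move=> y [Iy /KK].
  move=> h; apply: nKK => x Kx; have [j [_ [Jj [y Iy ->] xE]]] := KI' x Kx.
  have [_ Ky] : (I `&` icolon K f) y.
    apply: h; split=> //; apply: (idlDl hK' (x := j)); first exact: JK'.
    by rewrite -xE.
  by rewrite xE; apply: idlD => //; exact: JK.
Qed.

(** Multiplication by f induces an isomorphism of I/J with (J1 + fI)/J1: [fJ] makes it well defined,
    [fI] makes it injective. *)
Lemma ilen_mul : ilen J I = ilen J1 (iadd J1 (iscale f I)).
Proof. exact: chain_height_eq. Qed.

Lemma ifin_mul : ifin J I <-> ifin J1 (iadd J1 (iscale f I)).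
Proof. by split=> -[b h]; exists b => n /has_chain_mul; exact: h. Qed.

End MulIso.

(** The second isomorphism theorem, as multiplication by 1. *)
Lemma ilen_diamond I H : is_ideal I -> is_ideal H ->
  ilen (I `&` H) I = ilen H (iadd H I) /\ (ifin (I `&` H) I <-> ifin H (iadd H I)).
Proof.
move=> hI hH.
have E : iscale 1 I = I.
  by apply/seteqP; split=> [_ [y Iy ->]|y Iy]; [rewrite mul1r|exists y; rewrite ?mul1r].
have IHI : I `&` H `<=` I by move=> ? [].
have h1 y : (I `&` H) y -> H (1 * y) by rewrite mul1r => -[].
have h2 y : I y -> H (1 * y) -> (I `&` H) y by rewrite mul1r.
have hIH := is_idealI hI hH.
have := ilen_mul hI hH IHI h1 h2; have := ifin_mul hI hH IHI h1 h2.
by rewrite E.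
Qed.

Definition local_at (m : set A) :=
  [/\ is_ideal m, ~ m 1 & forall a, ~ m a -> exists b, a * b = 1].

Lemma local_sub m I : local_at m -> is_ideal I -> ~ I 1 -> I `<=` m.
Proof.
move=> [hm m1 mu] hI I1 x Ix; apply: contrapT => /mu[b xb]; apply: I1.
by rewrite -xb; exact: idlMr.
Qed.

Lemma ifin_residue m : local_at m -> ifin m setT.
Proof.
move=> hm; have [mI m1 mu] := hm; exists 1%N => -[//|[//|n]] [c [cP cS]].
have [h0 mc0 _] := cP 0%N isT; have [h1 _ _] := cP 1%N isT.
have [cc1 ncc1] := cS 1%N isT; have [cc0 ncc0] := cS 0%N isT.
have [c1|c1] := pselect (c 1%N 1).
  by case: ncc1; rewrite (idlT_eq h1 c1).
by case: ncc0; apply: subset_trans (local_sub hm h1 c1) mc0.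
Qed.

(** Take H maximal with H/J of finite length. If H were not I, then, a power of m carrying I into H,
    some x in I outside H would satisfy mx <= H; then (H + (x))/H is A/m, and H + (x) contradicts
    maximality. *)
Lemma ifin_exp m N J I : acc A -> local_at m -> is_ideal J -> is_ideal I -> J `<=` I ->
  (forall a x, ideal_exp m N a -> I x -> J (a * x)) -> ifin J I.
Proof.
move=> hacc hm hJ hI JI mJ; have [mI m1 mu] := hm.
have [||H [hH [JH HI] fH] Hmax] := @ideal_maximal A
  [set H | [/\ is_ideal H, J `<=` H /\ H `<=` I & ifin J H]] J hacc.
- by move=> ? [].
- by split=> //; [split=> // x|exact: (ilen_refl hJ).1].
have [IH|IH] := pselect (I `<=` H); first by apply: ifin_sub fH.
have [x [Ix Hx mx]] : exists x, [/\ I x, ~ H x & forall a, m a -> H (a * x)].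
  have : forall a x, ideal_exp m N a -> I x -> H (a * x).
    by move=> a x ma Ix; apply: JH; exact: mJ.
  elim: N {mJ} => [h|k IHk h].
    by exfalso; apply: IH => x Ix; rewrite -[x]mul1r; exact: h.
  have [h'|/existsNP[a /existsNP[x /not_implyP[ma /not_implyP[Ix Hx]]]]] :=
    pselect (forall a x, ideal_exp m k a -> I x -> H (a * x)); first exact: IHk.
  exists (a * x); split=> // [|b mb]; first exact: idlM.
  by rewrite mulrA; apply: h => //; exact: ideal_mul_in.
exfalso; apply: (Hx); have hHx := is_ideal_iaddp x hH.
rewrite -(Hmax (iaddp H x)); first exact: iaddpr.
  split=> //.
    split; first by apply: subset_trans JH _; exact: iaddpl.
    exact: iaddp_sub.
  have [] // := ilen_add hJ hH hHx JH _ fH; first exact: iaddpl.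
  apply/(ifin_mul (f := x) (J := m) (I := setT)) => //.
  - by move=> y my; rewrite mulrC; exact: mx.
  - move=> y _ xy; apply: contrapT => /mu[b yb]; apply: Hx.
    by rewrite -[x]mulr1 -yb mulrA; exact: idlMr.
  - exact: ifin_residue.
exact: iaddpl.
Qed.

Lemma quot_lengthE (S : set A) : quot_length S = ilen (ideal_span S) setT.
Proof.
apply: chain_height_eq => n; split.
  apply: (has_chain_map (g := fun N : set (quot_mod S) => [set a | N (quot_pi S a)])).
  - move=> N [N0 ND NM]; split=> //.
      split=> [|x y Nx Ny|a x Nx] /=; rewrite /mkset.
      + by rewrite raddf0.
      + by rewrite raddfD; exact: ND.
      + by rewrite rmorphM; exact: NM.
    move=> x Sx /=; suff -> : quot_pi S x = 0 by [].
    by rewrite -(raddf0 (quot_pi S)); apply/quot_piP; rewrite subr0.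
  - move=> N N' _ _ [NN nNN]; split=> [x|h]; first exact: NN.
    apply: nNN => x; rewrite -(of_ringK (S := quot_setoid S) x) => Nx; exact: h Nx.
apply: (has_chain_map (g := fun K => [set quot_pi S a | a in K] : set (quot_mod S))).
- move=> K [hK SK _]; split.
  + by exists 0; [exact: idl0|rewrite raddf0].
  + by move=> _ _ [x Kx <-] [y Ky <-]; exists (x + y); [exact: idlD|rewrite raddfD].
  + by move=> a _ [x Kx <-]; exists (a * x); [exact: idlM|rewrite rmorphM].
- move=> K K' [hK SK _] [hK' _ _] [KK nKK]; split=> [_ [x Kx <-]|h].
    by exists x => //; exact: KK.
  apply: nKK => x Kx; have [|y Ky /quot_piP xy] := h (quot_pi S x); first by exists x.
  by rewrite -(subKr y x); apply: idlB => //; exact: SK.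
Qed.

End IntervalLength.

(** * Superficial elements *)

(** Prime avoidance in the coset a + J, abstract enough for primes and for the components of
    homogeneous primes in a fixed degree. If a + t falls into P, add h: primes below P are then
    avoided together with P, and the other ones contain h, so nothing changes for them. *)
Lemma avoid_coset (V : zmodType) (I : Type) (mem : I -> set V) (le : I -> I -> Prop)
    (s : seq I) (J : set V) (a : V) :
  J 0 -> (forall x y, J x -> J y -> J (x + y)) ->
  (forall P, List.In P s -> forall x y, mem P x -> mem P y -> mem P (x - y)) ->
  (forall P P', List.In P s -> List.In P' s -> le P' P -> mem P' `<=` mem P) ->
  (forall P, List.In P s -> exists h, [/\ J h, ~ mem P h
    & forall P', List.In P' s -> ~ le P' P -> mem P' h]) ->
  exists2 t, J t & forall P, List.In P s -> ~ mem P (a + t).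
Proof.
move=> J0 JD memB memS H.
suff h l : (forall P, List.In P l -> List.In P s) ->
    exists2 t, J t & forall P, List.In P l -> ~ mem P (a + t) by exact: h.
elim: l => [|P l IH] ls; first by exists 0.
have [|t Jt ht] := IH; first by move=> P' lP'; apply: ls; right.
have Ps : List.In P s by apply: ls; left.
have [Pt|Pt] := pselect (mem P (a + t)); last first.
  by exists t => // P' [<- //|/ht].
have [h [Jh Ph hP]] := H _ Ps; exists (t + h); first exact: JD.
have nP : ~ mem P (a + (t + h)).
  by move=> /(memB _ Ps) /(_ Pt); rewrite addrA [_ + h]addrC addrK.
move=> P' [<- //|lP'] P't; have P's : List.In P' s by apply: ls; right.
have [le1|le1] := pselect (le P' P); first exact/nP/(memS _ _ Ps P's le1).
apply: (ht _ lP'); have := memB _ P's _ _ P't (hP _ P's le1).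
by rewrite addrA addrK.
Qed.

Section Superficial.
Variables (A : comPzRingType) (Q : set A).
Hypothesis hacc : acc A.
Hypothesis Q_ideal : is_ideal Q.

(* The homogeneous primes of the Rees algebra of Q that do not contain its part
   of degree 1. *)
Definition graded_prime (P : nat -> set A) :=
  [/\ rees_ideal Q P,
    forall i j x y, ideal_exp Q i x -> ideal_exp Q j y ->
      P (i + j)%N (x * y) -> P i x \/ P j y
    & exists2 q, Q q & ~ P 1%N q].

(** The correcting element for P is a product of homogeneous elements of the P' not below P, each
    outside P, times a power of some q in Q with q t outside P. That power fills up the degree,
    which explains why every large k works. *)
Lemma graded_avoid (s : seq (nat -> set A)) :
  (forall P, List.In P s -> graded_prime P) ->
  exists K, forall k, (K <= k)%N -> exists2 f, ideal_exp Q k f &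
    forall P, List.In P s -> ~ P k f.
Proof.
move=> sP; pose le (P P' : nat -> set A) := forall n, P n `<=` P' n.
have exp_notin P q n : graded_prime P -> Q q -> ~ P 1%N q -> ~ P n (q ^+ n).
  move=> [[PI PQ PM] Pp _] Qq Pq; elim: n => [|n IH].
    rewrite expr0 => P1; apply: Pq; have := PM _ _ _ Qq P1; by rewrite mulr1.
  rewrite exprS -add1n => /Pp[| |//|//]; first by rewrite ideal_exp1.
  exact: ideal_exp_pow.
have one P l : List.In P s -> (forall P', List.In P' l -> List.In P' s) ->
    exists K, forall k, (K <= k)%N -> exists h, [/\ ideal_exp Q k h, ~ P k h
      & forall P', List.In P' l -> ~ le P' P -> P' k h].
  move=> Ps ls; have gP := sP _ Ps; have [[PI PQ PM] Pp [q Qq Pq]] := gP.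
  elim: l ls => [|P' l IH] ls.
    exists 0%N => k _; exists (q ^+ k); split=> //; first exact: ideal_exp_pow.
    exact: exp_notin.
  have [|K hK] := IH; first by move=> P'' lP''; apply: ls; right.
  have [le1|/existsNP[n /existsNP[z /not_implyP[P'z Pz]]]] := pselect (le P' P).
    exists K => k /hK[h [Qh Ph hP]]; exists h; split=> // P'' [<- //|]; exact: hP.
  have [rP' _ _] : graded_prime P' by apply/sP/ls; left.
  exists (n + K)%N => k nk.
  have [|h [Qh Ph hP]] := hK (k - n)%N; first by rewrite leq_subRL // (leq_trans _ nk) ?leq_addr.
  have kE : k = (k - n + n)%N by rewrite subnK // (leq_trans _ nk) ?leq_addr.
  have Qz : ideal_exp Q n z by case: rP' => _ + _; apply.
  exists (h * z); split; first by rewrite kE; exact: ideal_expD.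
    by rewrite kE => /Pp[].
  move=> P'' [<- _|lP'' le2]; first by rewrite kE; exact (rees_idealM rP' Qh P'z).
  have [rP'' _ _] : graded_prime P'' by apply: sP; apply: ls; right.
  by rewrite kE addnC mulrC; exact (rees_idealM rP'' Qz (hP _ lP'' le2)).
have all l : (forall P', List.In P' l -> List.In P' s) ->
    exists K, forall k, (K <= k)%N -> forall P, List.In P l -> exists h,
    [/\ ideal_exp Q k h, ~ P k h & forall P', List.In P' s -> ~ le P' P -> P' k h].
  elim: l => [|P l IH] ls; first by exists 0%N.
  have [|K hK] := IH; first by move=> P'' lP''; apply: ls; right.
  have [|K' hK'] := @one P s _ (fun _ h => h); first by apply: ls; left.
  exists (maxn K K') => k; rewrite geq_max => /andP[kK kK'] P' [<-|lP'].
    exact: hK'.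
  exact: hK.
have [K hK] := all s (fun _ h => h); exists K => k kK.
have [| | |||t Qt ht] := @avoid_coset A _ (fun P : nat -> set A => P k) le s (ideal_exp Q k) 0.
- exact: (idl0 (is_ideal_exp _ _)).
- by move=> x y; exact: (idlD (is_ideal_exp _ _)).
- by move=> P /sP[[PI _ _] _ _] x y; exact: idlB.
- by move=> P P' _ _; apply.
- exact: hK.
by exists t => // P /ht; rewrite add0r.
Qed.

(** The listed primes play the role of the associated primes of R/N, R the Rees algebra, other than
    those containing the part of R of degree 1. The latter affect only finitely many degrees, hence
    the bound c0. The proof is a noetherian induction that passes from M to M + Rz, where Rz modulo
    M is R/P up to a shift. *)
Lemma superficial_primes (N : nat -> set A) : rees_ideal Q N ->
  exists s : seq (nat -> set A), (forall P, List.In P s -> graded_prime P) /\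
    forall k f, ideal_exp Q k f -> (forall P, List.In P s -> ~ P k f) ->
      exists c0, forall n x, (c0 <= n)%N -> ideal_exp Q n x -> N (k + n)%N (f * x) -> N n x.
Proof.
move=> hN; apply: contrapT => bad0.
pose bad N := rees_ideal Q N /\ ~ exists s : seq (nat -> set A),
  (forall P, List.In P s -> graded_prime P) /\
    forall k f, ideal_exp Q k f -> (forall P, List.In P s -> ~ P k f) ->
      exists c0, forall n x, (c0 <= n)%N -> ideal_exp Q n x -> N (k + n)%N (f * x) -> N n x.
have [||M [rM nM] Mmax] := @rees_maximal A Q hacc Q_ideal bad N.
- by split.
- by move=> ? [].
have [MI MQ MM] := rM.
have [a0 [z0 [Qz0 Mz0]]] : exists a z, ideal_exp Q a z /\ ~ M a z.
  apply: contrapT => h; apply: nM; exists [::]; split=> // k f _ _.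
  exists 0%N => n x _ Qx _; apply: contrapT => Mx; apply: h; by exists n, x.
pose ann a z j := ideal_exp Q j `&` [set g | M (a + j)%N (g * z)].
have rann a z : rees_ideal Q (ann a z).
  split=> [n|n x []//|n q x Qq [Qx Mx]].
    apply: is_idealI => //; split=> [|x y|b x]; rewrite /mkset.
    - by rewrite mul0r; exact: idl0.
    - by rewrite mulrDl; exact: idlD.
    - by rewrite -mulrA; exact: idlM.
  split; first exact: ideal_mul_in.
  by rewrite /mkset addnS -mulrA; exact: MM.
(* A maximal annihilator of an element of R/M, R the Rees algebra, is prime. *)
have [||P [a [z [Qz Mz ->]]] Pmax] := @rees_maximal A Q hacc Q_ideal
  (fun P => exists a z, [/\ ideal_exp Q a z, ~ M a z & P = ann a z]) (ann a0 z0).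
- by exists a0, z0.
- by move=> _ [a [z [_ _ ->]]].
have Pp i j x y : ideal_exp Q i x -> ideal_exp Q j y ->
    ann a z (i + j)%N (x * y) -> ann a z i x \/ ann a z j y.
  move=> Qx Qy [_ Mxy]; have [Myz|Myz] := pselect (M (a + j)%N (y * z)).
    by right.
  left; apply: (Pmax (ann (a + j)%N (y * z))).
  - exists (a + j)%N, (y * z); split=> //.
    by rewrite addnC; exact: ideal_expD.
  - move=> n g [Qg Mg]; split=> //; rewrite /mkset mulrCA -addnA [(j + n)%N]addnC addnA addnC.
    exact: rees_idealM.
  - split=> //; rewrite /mkset mulrA -addnA [(j + i)%N]addnC; exact: Mxy.
pose M' n := if (a <= n)%N then iadd (M n) (iscale z (ideal_exp Q (n - a))) else M n.
have rM' : rees_ideal Q M'.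
  split=> [n|n|n q x Qq]; rewrite /M'.
  - by case: ifP => // _; apply: is_ideal_iadd => //; exact: is_ideal_iscale.
  - case: ifP => // an; apply: iadd_sub => // _ [g Qg ->].
    by rewrite -(subnKC an); exact: ideal_expD.
  - case: ifP => an; last first.
      by case: ifP => _ Mx; [apply: iaddl; [exact: is_ideal_iscale|]|]; exact: MM.
    rewrite (leqW an) => -[y [_ [My [g Qg ->] ->]]].
    exists (q * y), (z * (q * g)); split; first exact: MM.
      by exists (q * g) => //; rewrite subSn //; exact: ideal_mul_in.
    by rewrite mulrDr [q * (z * g)]mulrCA.
have MM' n : M n `<=` M' n.
  by rewrite /M'; case: ifP => _; [apply: iaddl; exact: is_ideal_iscale|move=> x].
have M'z : M' a z.
  by rewrite /M' leqnn subnn; apply: iaddr => //; exists 1; rewrite ?mulr1.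
have [s [sP hs]] : exists s : seq (nat -> set A), (forall P, List.In P s -> graded_prime P) /\
    forall k f, ideal_exp Q k f -> (forall P, List.In P s -> ~ P k f) ->
      exists c0, forall n x, (c0 <= n)%N -> ideal_exp Q n x -> M' (k + n)%N (f * x) -> M' n x.
  apply: contrapT => nM'; apply: Mz; apply: (Mmax M') => //.
have [[q Qq Pq]|rel] := pselect (exists2 q, Q q & ~ ann a z 1%N q); apply: nM.
  exists (ann a z :: s); split; first by move=> P' [<-|/sP //]; split=> //; exists q.
  move=> k f Qf hf; have [|c0 hc0] := hs k f Qf; first by move=> P' sP'; apply: hf; right.
  exists c0 => n x c0n Qx Mfx; have := hc0 n x c0n Qx (MM' _ _ Mfx).
  rewrite /M'; case: ifP => // an [y [_ [My [g Qg ->] xE]]].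
  have Mfgz : M (k + n)%N (f * (z * g)).
    apply: (idlDl (MI _) (x := f * y)); first exact: rees_idealM.
    by rewrite -mulrDr -xE.
  have [|[_ Mf]|[_ Mg]] := Pp k (n - a)%N f g Qf Qg.
  - split; first exact: ideal_expD.
    by rewrite /mkset addnCA subnKC // -mulrA [g * z]mulrC.
  - by case: (hf (ann a z)); [left|split].
  - rewrite xE; apply: idlD => //.
    by move: Mg; rewrite /mkset subnKC // mulrC.
(* Here P contains the whole part of degree 1, so M + Rz and M agree in degrees above a, the degree
   of z; P is left off the list and c0 is raised to a + 1. *)
exists s; split=> // k f Qf hf; have [c0 hc0] := hs k f Qf hf.
exists (maxn c0 a.+1) => n x; rewrite geq_max => /andP[c0n an] Qx Mfx.
have := hc0 n x c0n Qx (MM' _ _ Mfx); rewrite /M' (ltnW an) => -[y [_ [My [g Qg ->] ->]]].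
apply: idlD => //.
suff : ideal_exp Q ((n - a.+1) + 1) `<=` icolon (M n) z.
  by rewrite addn1 subnSK // => /(_ g Qg).
apply: ideal_expD_sub => [|u v Qu]; first exact: is_ideal_icolon.
rewrite ideal_exp1 // => Qv.
have [_ Mv] : ann a z 1%N v by apply: contrapT => h; apply: rel; exists v.
rewrite /icolon /= mulrC -mulrA; have := rees_idealM rM Qu Mv.
by rewrite addn1 subnK.
Qed.

(** The family N below is the kernel of the map from the Rees algebra to the associated graded ring
    of A/J, so that avoiding its primes makes multiplication by f injective on that graded ring in
    large degrees. *)
Lemma superficial_element (J : set A) (s : seq (set A)) : is_ideal J ->
  (forall P, List.In P s -> prime_ideal P /\ ~ Q `<=` P) ->
  exists K, forall k, (K <= k)%N -> exists f, [/\ ideal_exp Q k f,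
    forall P, List.In P s -> ~ P f
    & exists c0, forall n x, (c0 <= n)%N -> iadd J (ideal_exp Q n) x ->
        iadd J (ideal_exp Q (k + n).+1) (f * x) -> iadd J (ideal_exp Q n.+1) x].
Proof.
move=> hJ hs.
pose N n := ideal_exp Q n `&` iadd J (ideal_exp Q n.+1).
have rN : rees_ideal Q N.
  split=> [n|n x []//|n q x Qq [Qx [j [y [Jj Qy xE]]]]].
    by apply: is_idealI => //; exact: is_ideal_iadd.
  split; first exact: ideal_mul_in.
  exists (q * j), (q * y); rewrite xE mulrDr; split=> //; first exact: idlM.
  exact: ideal_mul_in.
have [t [tP ht]] := superficial_primes rN.
(* The homogeneous prime attached to P; avoiding it in degree k means that f is outside P. *)
pose gr (P : set A) n := ideal_exp Q n `&` P.
have [|K hK] := @graded_avoid (t ++ map gr s).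
  move=> P /(@List.in_app_or _ t)[/tP //|] /List.in_map_iff[P' [<- /hs[[hP' P'1 P'p] QP']]].
  split.
  - split=> [n|n x []//|n q x Qq [Qx Px]]; first exact: is_idealI.
    by split; [exact: ideal_mul_in|exact: idlM].
  - by move=> i j x y Qx Qy [_ /P'p[]]; [left|right].
  - have /existsNP[q /not_implyP[Qq Pq]] := QP'.
    by exists q => // -[].
exists K => k /hK[f Qf hf]; exists f; split=> //.
  move=> P sP Pf; apply: (hf (gr P)); last by split.
  by apply/List.in_or_app; right; apply/List.in_map_iff; exists P.
have [|c0 hc0] := ht k f Qf; first by move=> P tP'; apply: hf; apply/List.in_or_app; left.
exists c0 => n x c0n [j [y [Jj Qy ->]]] h.
have [|_ [j' [y' [Jj' Qy' yE]]]] := hc0 n y c0n Qy.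
  split; first exact: ideal_expD.
  apply: (idlDl _ (x := f * j)); first exact: is_ideal_iadd.
    by apply: iaddl => //; exact: idlM.
  by rewrite -mulrDr.
by exists (j + j'), y'; rewrite yE addrA; split=> //; exact: idlD.
Qed.

End Superficial.

(** * Multiplicities *)

Section BackwardDifference.
Variables (R : comNzRingType) (c : R).

Let coef_exp i j : (i <= j)%N -> (('X - c%:P) ^+ i)`_j = (j == i)%:R.
Proof.
move=> ij; case: eqVneq => [->|ji].
  have /monicP := monic_exp i (monicXsubC c).
  by rewrite /lead_coef size_exp_XsubC.
by rewrite nth_default // size_exp_XsubC ltn_neqAle eq_sym ji.
Qed.

Let coef_diff i j : (i <= j.+1)%N ->
  ('X^i - ('X - c%:P) ^+ i)`_j = if i == j.+1 then i%:R * c else 0.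
Proof.
elim: i j => [|i IH] j; first by rewrite !expr0 subrr coef0.
rewrite ltnS eqSS => ij.
have -> : 'X^(i.+1) - ('X - c%:P) ^+ i.+1 =
  'X * ('X^i - ('X - c%:P) ^+ i) + c%:P * ('X - c%:P) ^+ i by rewrite !exprS; ring.
rewrite coefD coefXM coefCM coef_exp // [j == i]eq_sym.
case: j ij => [|j] ij.
  by move: ij; rewrite leqn0 => /eqP ->; rewrite eqxx add0r mulr1 mul1r.
rewrite /= IH //; case: eqP => [->|_]; last by rewrite mulr0 addr0.
by rewrite mulr1 -[in RHS]addn1 natrD; ring.
Qed.

(** Applied with c = k to the polynomial of L_J, it gives that of L_(J+f). The factor d + 1 turns d!
    into (d + 1)!, so the normalized leading coefficient is multiplied by k exactly. *)
Lemma backward_difference (p : {poly R}) d : (size p <= d.+2)%N ->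
  (size (p - (p \Po ('X - c%:P)))%R <= d.+1)%N /\
  (p - (p \Po ('X - c%:P)))`_d = d.+1%:R * c * p`_d.+1.
Proof.
move=> sp.
have E : p - (p \Po ('X - c%:P)) = \sum_(i < d.+2) p`_i *: ('X^i - ('X - c%:P) ^+ i).
  have Ep : p = \sum_(i < d.+2) p`_i *: 'X^i.
    rewrite -poly_def; apply/polyP => j; rewrite coef_poly; case: ltnP => // dj.
    by rewrite nth_default // (leq_trans sp).
  have Ec : p \Po ('X - c%:P) = \sum_(i < d.+2) p`_i *: ('X - c%:P) ^+ i.
    rewrite {1}Ep [LHS](linear_sum (comp_poly _)); apply: eq_bigr => i _.
    by rewrite linearZ /= comp_Xn_poly.
  by rewrite Ec {1}Ep -sumrB; apply: eq_bigr => i _; rewrite scalerBr.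
have coefE j : (d <= j)%N -> (p - (p \Po ('X - c%:P)))`_j =
    if j == d then d.+1%:R * c * p`_d.+1 else 0.
  move=> dj; rewrite E coef_sum big_ord_recr /= big1 ?add0r => [|i _].
    rewrite coefZ coef_diff ?ltnS // eqSS [d == j]eq_sym.
    by case: eqP => _; rewrite ?mulr0 // mulrC.
  have ij : (i < j.+1)%N by rewrite ltnS (leq_trans _ dj) // -ltnS.
  by rewrite coefZ coef_diff /= ?(ltn_eqF ij) ?mulr0 // ltnW.
split; last by rewrite coefE ?eqxx.
apply/leq_sizeP => j dj; rewrite coefE ?(ltnW dj) //.
by rewrite (gtn_eqF dj).
Qed.

End BackwardDifference.

Lemma has_chain_cons T (P : set (set T)) n c X : strict_chain P n c -> P X -> X `<` c 0%N ->
  has_chain P n.+1.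
Proof.
move=> [cP cS] PX Xc; exists (fun i => if i is j.+1 then c j else X).
by split=> -[|i] // ni; [exact: cP|exact: cS].
Qed.

(** * Hilbert-Samuel functions in a noetherian local ring *)

Section LocalMultiplicity.
Variables (A : comPzRingType) (m Q : set A) (M : nat).
Hypotheses (hacc : acc A) (hm : local_at m).
Hypotheses (hQ : is_ideal Q) (Qm : Q `<=` m) (mQ : ideal_exp m M `<=` Q).

Local Notation L J n := (ilen (iadd J (ideal_exp Q n)) setT).
Implicit Types (I J P : set A).

Let hJQ J n : is_ideal J -> is_ideal (iadd J (ideal_exp Q n)).
Proof. by move=> hJ; exact: is_ideal_iadd. Qed.

Let mQn n : ideal_exp m (M * n) `<=` ideal_exp Q n.
Proof. by apply: ideal_expM_sub mQ _ => //; exact: is_ideal_exp. Qed.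

Lemma ifin_expQ N J I : is_ideal J -> is_ideal I -> J `<=` I ->
  (forall a x, ideal_exp Q N a -> I x -> J (a * x)) -> ifin J I.
Proof.
move=> hJ hI JI h; apply: (@ifin_exp _ m (M * N)) => // a x /mQn Qa; exact: h.
Qed.

Lemma ifin_iadd_exp J n : is_ideal J -> ifin (iadd J (ideal_exp Q n)) setT.
Proof.
move=> hJ; apply: (@ifin_expQ n) => // [|a x Qa _]; first exact: hJQ.
by apply: iaddr => //; rewrite mulrC; exact: (idlM _ (is_ideal_exp Q n)).
Qed.

Lemma unit_1B q : Q q -> exists b, (1 - q) * b = 1.
Proof.
move=> /Qm mq; case: hm => mI m1 mu; apply: mu => h; apply: m1.
by rewrite -(subrK q 1); exact: idlD.
Qed.

Lemma krullQ J x : is_ideal J -> (forall n, iadd J (ideal_exp Q n) x) -> J x.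
Proof. by move=> hJ; apply: krull_intersection => //; exact: unit_1B. Qed.

Lemma iadd_exp_anti J i j : (i <= j)%N -> iadd J (ideal_exp Q j) `<=` iadd J (ideal_exp Q i).
Proof. by move=> ij; apply: iadd_mono => //; exact: ideal_exp_anti. Qed.

Lemma prime_nonmax P : prime_ideal P -> P <> m -> ~ Q `<=` P.
Proof.
move=> hP Pm QP; apply: Pm; have [PI P1 Pp] := hP.
apply/seteqP; split; first exact: local_sub.
have : ideal_exp m M `<=` P by exact: subset_trans QP.
elim: M => [|k IH]; first by move=> /(_ 1 I).
by move=> /(prime_subM hP)[|/IH].
Qed.

Definition saturated J := forall x, (forall y, Q y -> J (y * x)) -> J x.

Lemma saturated_exp J n x : saturated J ->
  (forall y, ideal_exp Q n y -> J (y * x)) -> J x.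
Proof.
move=> hs; elim: n x => [|n IH] x h; first by rewrite -[x]mul1r; exact: h.
apply: IH => y Qy; apply: hs => z Qz; rewrite mulrA; apply: h.
exact: ideal_mul_in.
Qed.

(** J' is the union of the (J : Q^i), attained at i = N. By Artin-Rees J' [&] (J + Q^n) = J for n
    large, so L_J(n) - L_J'(n) is the constant length of J'/J. If q in Q is outside P, then q^N x in
    J forces x into P. *)
Lemma saturation J : is_ideal J -> exists J', [/\ is_ideal J', J `<=` J', saturated J',
  forall P, prime_ideal P -> P <> m -> J `<=` P -> J' `<=` P
  & exists c n0, forall n, (n0 <= n)%N -> L J n = (c + L J' n)%N].
Proof.
move=> hJ; pose s i := [set x | forall y, ideal_exp Q i y -> J (y * x)].
have sI i : is_ideal (s i).
  split=> [y _|x x' sx sx' y Qy|a x sx y Qy]; rewrite ?mulr0 ?mulrDr ?(mulrCA y).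
  - exact: idl0.
  - by apply: idlD => //; [exact: sx|exact: sx'].
  - by apply: idlM => //; exact: sx.
have sS i : s i `<=` s i.+1.
  by move=> x sx y Qy; apply: sx; apply: ideal_exp_anti Qy.
have [N hN] := hacc sI sS; have hJ' := sI N.
have JJ' : J `<=` s N by move=> x Jx y _; exact: idlM.
have [n1 hn1] := artin_rees hacc hQ hJ'.
exists (s N); split=> //.
- move=> x h; apply: (hN N.+1) => //; rewrite /s /mkset -addn1 => y Qy.
  rewrite mulrC; move: y Qy; apply: (ideal_expD_sub (K := icolon J x)) => [|u v Qu].
    exact: is_ideal_icolon.
  by rewrite ideal_exp1 // => Qv; rewrite /icolon /= mulrC -mulrA; apply: h.
- move=> P hP Pm JP x sx.
  have /existsNP[q /not_implyP[Qq Pq]] := prime_nonmax hP Pm.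
  have [_ P1 Pp] := hP.
  have [Pqn|//] := Pp _ _ (JP _ (sx _ (ideal_exp_pow N hQ Qq))).
  elim: N Pqn {hN hJ' JJ' sx hn1} => [//|n IH]; rewrite exprS => /Pp[//|]; exact: IH.
exists (ilen J (s N)), (N + n1)%N => n nN.
have n1n : (n1 <= n)%N by rewrite (leq_trans _ nN) // leq_addl.
have hH := hJQ n hJ; have JH : J `<=` iadd J (ideal_exp Q n) by exact: iaddl.
have cap : s N `&` iadd J (ideal_exp Q n) = J.
  apply/seteqP; split=> [x [sx [j [q [Jj Qq xE]]]]|x Jx]; last by split; [exact: JJ'|exact: JH].
  rewrite xE; apply: idlD => //.
  have sq : s N q by apply: (idlDl hJ' (x := j)); [exact: JJ'|rewrite -xE].
  have := hn1 (n - n1)%N q; rewrite subnK // => /(_ Qq sq).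
  apply: (ideal_mul_sub hJ) => y z Qy sz; apply: sz; apply: ideal_exp_anti Qy.
  by rewrite leq_subRL // addnC.
have sum : iadd (iadd J (ideal_exp Q n)) (s N) = iadd (s N) (ideal_exp Q n).
  have hsQ := hJQ n hJ'; apply/seteqP; split.
    apply: iadd_sub => //; last exact: iaddl.
    exact: iadd_mono.
  apply: iadd_sub; first exact: is_ideal_iadd.
    exact: iaddr.
  by apply: subset_trans (iaddl hJ'); exact: iaddr.
have [] := ilen_diamond hJ' hH; rewrite cap sum => -> ffin.
have sub : iadd J (ideal_exp Q n) `<=` iadd (s N) (ideal_exp Q n) by exact: iadd_mono.
have [] // := ilen_add hH (hJQ n hJ') is_idealT sub _ _ (ifin_iadd_exp _ hJ').
by apply: ifin_sub (ifin_iadd_exp n hJ).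
Qed.

(** For n large, multiplication by f embeds A/(J + Q^n) into A/(J + Q^(k+n)), with cokernel A/(J +
    (f) + Q^(k+n)). That f is a nonzerodivisor modulo J follows from superficiality and Krull's
    theorem for multiples by Q^c0, and then from saturation. *)
Lemma saturated_superficial J (s : seq (set A)) : is_ideal J -> saturated J ->
  (forall P, List.In P s -> prime_ideal P /\ P <> m) ->
  exists K, forall k, (K <= k)%N -> exists f, [/\ ideal_exp Q k f,
    forall P, List.In P s -> ~ P f, forall x, J (f * x) -> J x
    & exists n0, forall n, (n0 <= n)%N ->
        (L (iaddp J f) (k + n) + L J n = L J (k + n))%N].
Proof.
move=> hJ Js hs; have [|K hK] := @superficial_element A Q hacc hQ J s hJ.
  by move=> P /hs[hP Pm]; split=> //; exact: prime_nonmax.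
exists K => k /hK[f [Qf fs [c0 hc0]]].
have up n x : (c0 <= n)%N -> iadd J (ideal_exp Q c0) x ->
    (forall i, (i < n)%N -> iadd J (ideal_exp Q (k + i).+1) (f * x)) ->
    iadd J (ideal_exp Q n) x.
  elim: n => [|n IH]; first by rewrite leqn0 => /eqP ->.
  rewrite leq_eqVlt => /orP[/eqP -> //|]; rewrite ltnS => c0n Jx h.
  apply: hc0 => //; last exact: h.
  by apply: IH => // i ni; apply: h; exact: leqW.
have fJ x : J (f * x) -> J x.
  move=> Jfx; apply: (saturated_exp (n := c0)) => // y Qy; apply: krullQ => // n.
  apply: (iadd_exp_anti (leq_maxl n c0)); apply: up; first exact: leq_maxr.
    apply: iaddr => //; rewrite mulrC; exact: (idlM _ (is_ideal_exp Q c0)).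
  move=> i _; apply: iaddl; first exact: is_ideal_exp.
  by rewrite mulrCA; exact: idlM.
exists f; split=> //.
have hH := is_ideal_iaddp f hJ; have [n1 hn1] := artin_rees hacc hQ hH.
exists (c0 + n1)%N => n nn.
have hI := hJQ n hJ; have hI1 := hJQ (k + n) hJ.
(* Superficiality says something about x only once x is in J + Q^c0. Artin-Rees for J + (f) ensures
   this: fx is in J + f Q^c0, and f cancels modulo J. *)
have colon x : iadd J (ideal_exp Q (k + n)) (f * x) -> iadd J (ideal_exp Q n) x.
  move=> Jfx; apply: up => //; first by apply: leq_trans nn; exact: leq_addr.
    move: (Jfx) => [j [w [Jj Qw fxE]]].
    have Hw : iaddp J f w.
      apply: (idlDl hH (x := j)); first exact: iaddpl.
      by rewrite -fxE; apply: idlMr => //; exact: iaddpr.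
    have n1n : (n1 <= k + n)%N.
      by apply: leq_trans (leq_addl _ _); apply: leq_trans nn; exact: leq_addl.
    have := hn1 (k + n - n1)%N w; rewrite subnK // => /(_ Qw Hw) Ww.
    have : iadd J (iscale f (ideal_exp Q c0)) w.
      move: Ww; have hfQ := is_ideal_iscale f (is_ideal_exp Q c0).
      apply: ideal_mul_sub => [|u v Qu /iaddpP[y [j' Jj' ->]]]; first exact: is_ideal_iadd.
      exists (u * j'), (f * (u * y)); split; first exact: idlM.
        exists (u * y) => //; apply: idlMr; first exact: is_ideal_exp.
        apply: ideal_exp_anti Qu; rewrite leq_subRL // addnC.
        by apply: leq_trans nn _; exact: leq_addl.
      by rewrite mulrDr [u * (f * y)]mulrCA.
    move=> [j' [_ [Jj' [y Qy ->] wE]]].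
    rewrite -(subrK y x); apply: idlD; first exact: hJQ.
      apply: iaddl; first exact: is_ideal_exp.
      apply: fJ; rewrite mulrBr fxE wE addrA addrK; exact: idlD.
    exact: iaddr.
  by move=> i ni; apply: iadd_exp_anti Jfx; rewrite -addnS leq_add2l.
have E : iadd (iaddp J f) (ideal_exp Q (k + n)) =
    iadd (iadd J (ideal_exp Q (k + n))) (iscale f setT).
  apply/seteqP; split=> x.
    by move=> [_ [w [[a [b [Ja fb ->]] Qw ->]]]]; exists (a + w), b; rewrite addrAC; split=> //;
      exists a, w.
  by move=> [_ [b [[a [w [Ja Qw ->]] fb ->]]]]; exists (a + b), w; rewrite addrAC; split=> //;
    exists a, b.
rewrite E addnC.
have fI y : iadd J (ideal_exp Q n) y -> iadd J (ideal_exp Q (k + n)) (f * y).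
  move=> [j [q [Jj Qq ->]]]; rewrite mulrDr; exists (f * j), (f * q); split=> //.
    exact: idlM.
  exact: ideal_expD.
have h1 := ifin_mul is_idealT hI1 (@subsetT _ _) fI (fun y _ => @colon y).
rewrite (ilen_mul is_idealT hI1 (@subsetT _ _) fI (fun y _ => @colon y)).
have hf := is_ideal_iscale f (@is_idealT A).
have [] // := ilen_add hI1 (is_ideal_iadd hI1 hf) is_idealT (iaddl hf) (@subsetT _ _).
  exact/h1/ifin_iadd_exp.
by apply: ifin_sub (ifin_iadd_exp (k + n) hJ) => //; exact: iaddl.
Qed.

(** Equal lengths force J + Q^n = J + Q^(n+1) for n >= N, and Krull's theorem concludes. This
    exploits a constant Hilbert-Samuel polynomial. *)
Lemma stable_exp_sub J N : is_ideal J -> (forall n, (N <= n)%N -> L J n = L J N) ->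
  ideal_exp Q N `<=` J.
Proof.
move=> hJ LE; have stab n : (N <= n)%N ->
    iadd J (ideal_exp Q n) `<=` iadd J (ideal_exp Q n.+1).
  move=> Nn; have hS := hJQ n.+1 hJ; have h := hJQ n hJ.
  have sub := @iadd_exp_anti J _ _ (leqnSn n).
  have fin := ifin_iadd_exp n.+1 hJ.
  have [||_ E] := ilen_add hS h is_idealT sub (@subsetT _ _).
  - exact: ifin_sub fin.
  - exact: ifin_iadd_exp.
  apply: ilen_eq0 => //; first exact: ifin_sub fin.
  have : L J n.+1 = L J n by rewrite (LE _ (leqW Nn)) (LE _ Nn).
  by rewrite E -{2}[L J n]add0n => /addIn ->.
move=> x Qx; apply: krullQ => // n; apply: (iadd_exp_anti (leq_maxr N n)).
rewrite /maxn; case: ltnP => [|_]; last by apply: iaddr.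
move=> /ltnW /subnK <-; elim: (n - N)%N => [|i IHi]; first exact: iaddr.
by rewrite addSn; apply: stab => //; exact: leq_addl.
Qed.

Lemma superficial_descent d J (p : {poly rat}) (s : seq (set A)) : is_ideal J ->
  (size p <= d.+2)%N -> (exists N, forall n, (N <= n)%N -> (L J n)%:R = p.[n%:R]) ->
  (forall P, List.In P s -> prime_ideal P /\ P <> m) ->
  exists J' K, [/\ is_ideal J', J `<=` J',
    forall P, prime_ideal P -> P <> m -> J `<=` P -> J' `<=` P
    & forall k, (K <= k)%N -> exists f (q : {poly rat}), [/\ m f,
      forall x, J' (f * x) -> J' x, forall P, List.In P s -> ~ P f,
      (size q <= d.+1)%N /\ q`_d = d.+1%:R * k%:R * p`_d.+1
      & exists N, forall n, (N <= n)%N -> (L (iaddp J' f) n)%:R = q.[n%:R]]].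
Proof.
move=> hJ sp [N hN] hs; have [J' [hJ' JJ' satJ' J'P [c [n0 hn0]]]] := saturation hJ.
(* Saturation subtracts a constant, which does not touch the coefficient of index d + 1. *)
pose p' := p - c%:R%:P.
have sp' : (size p' <= d.+2)%N.
  rewrite (leq_trans (size_polyD _ _)) // size_polyN geq_max sp /=.
  by rewrite (leq_trans (size_polyC_leq1 _)).
have hN' n : (maxn N n0 <= n)%N -> (L J' n)%:R = p'.[n%:R].
  rewrite geq_max => /andP[Nn n0n].
  by rewrite hornerD hornerN hornerC -hN // hn0 // natrD addrC addKr.
have [K hK] := saturated_superficial hJ' satJ' hs.
(* k >= 1 puts f in Q, hence in m. *)
exists J', (maxn K 1); split=> // k; rewrite geq_max => /andP[Kk k1].
have [f [Qf fs fJ [n1 hn1]]] := hK k Kk.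
have [sq cq] := backward_difference (k%:R : rat) sp'.
exists f, (p' - (p' \Po ('X - k%:R%:P))); split=> //.
- by apply: Qm; have := ideal_exp_anti k1 Qf; rewrite ideal_exp1.
- by split=> //; rewrite cq coefB coefC subr0.
exists (k + maxn n1 (maxn N n0))%N => n kn.
have kn' : (k <= n)%N by rewrite (leq_trans _ kn) // leq_addr.
have : (maxn n1 (maxn N n0) <= n - k)%N by rewrite leq_subRL.
rewrite geq_max => /andP[n1n Nn].
have := hn1 _ n1n; rewrite subnKC // => /(congr1 (fun n => n%:R : rat)).
rewrite natrD hN' // hN'; last by rewrite (leq_trans Nn) // leq_subr.
move=> /(canRL (addrK _)) ->; rewrite hornerD hornerN horner_comp.
by rewrite !hornerE natrB.
Qed.

Section Subgroup.
Variables (G : int -> Prop) (IF : set A).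
Hypotheses (G0 : G 0) (GD : forall x y, G x -> G y -> G (x + y)).
Hypothesis GN : forall x, G x -> G (- x).
Hypothesis hIF : is_ideal IF.
Hypothesis Ggen : forall P f, prime_ideal P -> P <> m -> ~ IF `<=` P ->
  (forall P', prime_ideal P' -> P' <> m -> P `<=` P' -> P' = P) ->
  m f -> ~ P f -> G (ilen (iaddp P f) setT)%:Z.

(** Noetherian induction on J, with P = (J : x), K = J + (x), and J' the elements sent into K by a
    power of f. The length of A/(J + f) is that of A/(J' + f) plus that of J'/(J + fJ').
    Multiplication by f gives J'/K the same length as (J + fJ')/(J + fK), so computing J'/(J + fK)
    through K and through J + fJ' shows that J'/(J + fJ') has the length of K/(J + fK), which is
    A/(P + f). *)
Lemma one_dim_length J f n : is_ideal J -> (forall x, J (f * x) -> J x) -> m f ->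
  ideal_exp Q n `<=` iaddp J f ->
  (forall P, prime_ideal P -> P <> m -> J `<=` P -> ~ IF `<=` P /\
    forall P', prime_ideal P' -> P' <> m -> P `<=` P' -> P' = P) ->
  G (ilen (iaddp J f) setT)%:Z.
Proof.
move=> hJ fJ mf Qn hP; apply: contrapT => nG.
pose bad J := [/\ is_ideal J, forall x, J (f * x) -> J x, ideal_exp Q n `<=` iaddp J f,
  forall P, prime_ideal P -> P <> m -> J `<=` P -> ~ IF `<=` P /\
    forall P', prime_ideal P' -> P' <> m -> P `<=` P' -> P' = P
  & ~ G (ilen (iaddp J f) setT)%:Z].
have [||{}J [{}hJ {}fJ {}Qn {}hP {}nG] Jmax] := @ideal_maximal A bad J hacc.
- by move=> ? [].
- by [].
have hJf := is_ideal_iaddp f hJ.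
have J1 : ~ J 1.
  move=> J1; apply: nG; rewrite (idlT_eq hJf); last exact: iaddpl.
  by rewrite (ilen_refl is_idealT).2.
(* A/J is filtered by K/J, isomorphic to A/P, J'/K of finite length, and A/J';
   f is not a zero divisor on A/J and A/J'. *)
have [x [Jx Px]] := maximal_annihilator hacc hJ J1.
set P := icolon J x in Px.
have JP : J `<=` P by move=> y Jy; exact: idlM.
have Pf : ~ P f by rewrite /P /icolon /= mulrC => /fJ.
have Pm : P <> m by move=> Pm; apply: Pf; rewrite Pm.
have [IFP Pmax] := hP _ Px Pm JP.
have GP := Ggen Px Pm IFP Pmax mf Pf.
pose K := iaddp J x; have hK : is_ideal K by exact: is_ideal_iaddp.
have JK : J `<=` K by exact: iaddpl.
have Kx : K x by exact: iaddpr.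
pose s i := [set y | K (f ^+ i * y)].
have sI i : is_ideal (s i) by exact: is_ideal_icolon.
have sS i : s i `<=` s i.+1 by move=> y sy; rewrite /s /mkset exprS -mulrA; exact: idlM.
have [N hN] := hacc sI sS; pose J' := s N; have hJ' : is_ideal J' by exact: sI.
have KJ' : K `<=` J' by move=> y Ky; exact: idlM.
have JJ' := subset_trans JK KJ'.
have fJ' y : J' (f * y) -> J' y.
  by rewrite /J' /s /mkset mulrA -exprSr => h; apply: (hN N.+1).
have hJf' := is_ideal_iaddp f hJ'.
have JfJf' : iaddp J f `<=` iaddp J' f by exact: iadd_mono.
have GJ' : G (ilen (iaddp J' f) setT)%:Z.
  apply: contrapT => nG'; apply: Jx; rewrite -(Jmax J') //.
    exact: KJ'.
  split=> // [|P' hP' P'm JP']; first exact: subset_trans JfJf'.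
  by apply: hP => //; exact: subset_trans JP'.
have fin1 : ifin (iaddp J f) setT.
  apply: (@ifin_expQ n) => // a y Qa _; rewrite mulrC; apply: idlM => //; exact: Qn.
have QP : ideal_exp Q n `<=` iaddp P f by apply: subset_trans Qn _; exact: iadd_mono.
have finP : ifin (iaddp P f) setT.
  apply: (@ifin_expQ n) => // [|a y Qa _].
    by apply: is_ideal_iaddp; case: Px.
  by rewrite mulrC; apply: idlM; [apply: is_ideal_iaddp; case: Px|exact: QP].
have hs I : is_ideal I -> is_ideal (iadd J (iscale f I)).
  by move=> hI; apply: is_ideal_iadd => //; exact: is_ideal_iscale.
pose fK := iadd J (iscale f K); pose fJ'' := iadd J (iscale f J').
have hfK : is_ideal fK by exact: hs.
have hfJ' : is_ideal fJ'' by exact: hs.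
have fKK : fK `<=` K by apply: iadd_sub => // _ [y Ky ->]; exact: idlM.
have fJJ : fJ'' `<=` J' by apply: iadd_sub => // _ [y Ky ->]; exact: idlM.
have fKJ : fK `<=` fJ'' by apply: iadd_mono => // _ [y Ky ->]; exists y => //; exact: KJ'.
(* f^N carries J' into K, and Q^n lies in J + (f), so Q^(nN) kills J'/K. *)
have finKJ : ifin K J'.
  apply: (@ifin_expQ (n * N)) => // a y Qa J'y.
  suff : ideal_exp Q (n * N) `<=` icolon K y by move=> /(_ a Qa); rewrite /icolon /= mulrC.
  have hKy := is_ideal_icolon y hK.
  apply: (ideal_expM_sub hKy Qn).
  have pow i w : K (f ^+ i * w) -> ideal_exp (iaddp J f) i `<=` icolon K w.
    elim: i w => [|i IH] w; first by rewrite expr0 mul1r => Kw z _; exact: idlMr.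
    rewrite exprSr -mulrA => Kw; apply: (ideal_mul_sub (is_ideal_icolon w hK)).
    move=> _ v /iaddpP[b [j Jj ->]] hv; rewrite /icolon /mkset.
    have -> : w * ((j + f * b) * v) = w * v * j + b * (f * w * v) by ring.
    apply: idlD => //; apply: idlM => //; first exact: JK.
    exact: IH Kw _ hv.
  exact: pow.
have cap : J' `&` iaddp J f = fJ''.
  apply/seteqP; split=> [y [J'y /iaddpP[w [j Jj yE]]]|y fy].
    rewrite yE; exists j, (f * w); split=> //; exists w => //; apply: fJ'.
    by apply: (idlDl hJ' (x := j)); [exact: JJ'|rewrite -yE].
  split; first exact: fJJ.
  by move: y fy; apply: iadd_mono => // _ [z _ ->]; exists z.
have sum : iadd (iaddp J f) J' = iaddp J' f.
  apply/seteqP; split; first by apply: iadd_sub => //; exact: iaddpl.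
  apply: iaddp_sub; [exact: is_ideal_iadd|exact: iaddr|].
  by apply: iaddl => //; exact: iaddpr.
have [e2 f2] := ilen_diamond hJ' hJf; rewrite cap sum in e2 f2.
have fin2 : ifin (iaddp J f) (iaddp J' f) by apply: ifin_sub fin1.
have fin3 : ifin (iaddp J' f) setT by apply: ifin_sub fin1.
have [_ e1] := ilen_add hJf hJf' is_idealT JfJf' (@subsetT _ _) fin2 fin3.
have fKE : iadd fK (iscale f J') = fJ''.
  apply/seteqP; split; first by apply: iadd_sub => //; exact: iaddr.
  by apply: iadd_mono => //; exact: iaddl (is_ideal_iscale f hK).
have kf y : K y -> fK (f * y) by move=> Ky; apply: iaddr => //; exists y.
have kf' y : J' y -> fK (f * y) -> K y.
  move=> _ [j [_ [Jj [k Kk ->] yE]]]; rewrite -(subrK k y); apply: idlD => //.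
  by apply: JK; apply: fJ; rewrite mulrBr yE addrK.
have e4 := ilen_mul hJ' hfK KJ' kf kf'; have f4 := ifin_mul hJ' hfK KJ' kf kf'.
rewrite fKE in e4 f4.
have hPf : is_ideal (iaddp P f) by apply: is_ideal_iaddp; case: Px.
have fKx : iadd fK (iscale x setT) = K.
  apply/seteqP; split.
    by apply: iadd_sub => // _ [y _ ->]; exact: idlMr.
  by apply: iadd_mono => //; exact: iaddl (is_ideal_iscale f hK).
have xk y : iaddp P f y -> fK (x * y).
  move=> /iaddpP[w [p Pp ->]]; exists (x * p), (f * (x * w)); split=> //.
    by exists (x * w) => //; exact: idlMr.
  by ring.
have xk' y : [set: A] y -> fK (x * y) -> iaddp P f y.
  move=> _ [j [_ [Jj [k /iaddpP[w [j' Jj' ->]] ->] yE]]].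
  apply/iaddpP; exists w, (y - f * w); last by rewrite subrK.
  rewrite /P /icolon /mkset mulrBr yE.
  have -> : j + f * (j' + x * w) - x * (f * w) = j + f * j' by ring.
  by apply: idlD => //; exact: idlM.
have e5 := ilen_mul is_idealT hfK (@subsetT _ _) xk xk'.
have f5 := ifin_mul is_idealT hfK (@subsetT _ _) xk xk'.
rewrite fKx in e5 f5.
have fin4 := f4.1 finKJ; have fin5 := f5.1 finP.
have [fin6 e6] := ilen_add hfK hK hJ' fKK KJ' fin5 finKJ.
have fin7 : ifin fJ'' J' by apply: ifin_sub fin6.
have [_ e7] := ilen_add hfK hfJ' hJ' fKJ fJJ fin4 fin7.
apply: nG; rewrite e1 -e2.
have -> : ilen fJ'' J' = ilen (iaddp P f) setT.
  by apply/eqP; rewrite -(eqn_add2l (ilen fK fJ'')) -e7 e6 e4 e5 addnC.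
by rewrite PoszD; exact: GD.
Qed.

Definition nonmax_primes J : set (set A) :=
  [set P | [/\ prime_ideal P, P <> m & J `<=` P]].

(* The last two hypotheses bound the dimension of A/J by d + 1, and that of its
   quotient by IF by d. *)
Lemma local_multiplicity d J (p : {poly rat}) (e : int) : is_ideal J ->
  (size p <= d.+2)%N -> e%:~R = (d.+1)`!%:R * p`_d.+1 ->
  (exists N, forall n, (N <= n)%N -> (L J n)%:R = p.[n%:R]) ->
  ~ has_chain (nonmax_primes J) d.+1 -> ~ has_chain (nonmax_primes (iadd J IF)) d ->
  G e.
Proof.
have Gmul (x : int) (k : nat) : G x -> G (x * k%:Z).
  move=> Gx; elim: k => [|k IH]; first by rewrite mulr0.
  by rewrite -addn1 PoszD mulrDr mulr1; exact: GD.
have Gdiff (x : int) K : (forall k : nat, (K <= k)%N -> G (x * k%:Z)) -> G x.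
  move=> h; have := GD (h K.+1 (leqnSn K)) (GN (h K (leqnn K))).
  by rewrite -mulrBr -addn1 PoszD addrAC subrr add0r mulr1.
have sub_m P : prime_ideal P -> P `<=` m by case=> ? ? _; exact: local_sub.
elim: d J p e => [|d IH] J p e hJ sp eE hN H1 H2.
  (* In this case the new polynomial is the constant ek. Hence J' + (f) contains a power of Q, and
     ek is the length of A/(J' + f) itself. *)
  have [|J' [K [hJ' JJ' J'P hK]]] := @superficial_descent 0 J p [::] hJ sp hN; first by [].
  apply: (@Gdiff e K) => k /hK[f [q [mf fJ _ [sq cq] [N' hN']]]].
  have hJf := is_ideal_iaddp f hJ'.
  have qE (n : rat) : q.[n] = (e * k%:Z)%:~R.
    rewrite (size1_polyC sq) hornerC cq rmorphM /= eE factS fact0 !mul1r mulrC.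
    by rewrite -pmulrn.
  have LE n : (N' <= n)%N -> (L (iaddp J' f) n)%:Z = e * k%:Z.
    by move=> /hN'; rewrite qE => h; apply: (@intr_inj rat); rewrite -h -pmulrn.
  have QJ : ideal_exp Q N' `<=` iaddp J' f.
    apply: stable_exp_sub => // n Nn.
    by have := LE _ Nn; rewrite -(LE _ (leqnn N')) => -[].
  have <- : (ilen (iaddp J' f) setT)%:Z = e * k%:Z.
    rewrite -(LE N') //; congr (ilen _ _)%:Z; apply/seteqP; split; first exact: iaddl.
    exact: iadd_sub.
  (* A nonmaximal prime over J containing IF would be a chain of length 0 against H2, and two nested
     ones would be a chain of length 1 against H1. *)
  apply: (one_dim_length hJ' fJ mf QJ) => P hP Pm J'P'.
  have JP := subset_trans JJ' J'P'; have [PI P1 Pp] := hP.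
  split=> [IFP|P' hP' P'm PP'].
    apply: H2; exists (fun=> P); split=> // i _; split=> //; exact: iadd_sub.
  apply: contrapT => nPP'; apply: H1; exists (fun i => if i is 0%N then P else P').
  split=> [[|i] _|[|i] //]; first by [].
    by split=> //; exact: subset_trans PP'.
  by move=> _; split=> // P'P; apply: nPP'; apply/seteqP.
have hJF := is_ideal_iadd hJ hIF.
have [s1 [s1P s1J s1min]] := prime_list hacc hJ.
have [s2 [s2P s2J s2min]] := prime_list hacc hJF.
(* The lists contain the minimal primes over J and over J + IF. As f avoids the nonmaximal ones, a
   chain over J' + (f), or over it plus IF, can be prolonged downwards by one of them, so both
   bounds drop by one. *)
pose s := List.filter (fun P => `[< P <> m >]) (s1 ++ s2).
have sP P : List.In P s -> prime_ideal P /\ P <> m.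
  move=> /List.filter_In[/(@List.in_app_or _ s1 s2) h /asboolP Pm]; split=> //.
  by case: h => [/s1P|/s2P].
have [J' [K [hJ' JJ' J'P hK]]] := superficial_descent hJ sp hN sP.
apply: (@Gdiff e K) => k /hK[f [q [mf fJ fs [sq cq] hN']]].
have hJf := is_ideal_iaddp f hJ'.
have low c (I I' : set A) n (s' : seq (set A)) :
    strict_chain (nonmax_primes I') n c -> I' f -> I `<=` I' ->
    (forall P, List.In P s' -> List.In P (s1 ++ s2)) ->
    (forall P, List.In P s' -> prime_ideal P) -> (forall P, List.In P s' -> I `<=` P) ->
    (forall P, prime_ideal P -> I `<=` P -> exists2 P', List.In P' s' & P' `<=` P) ->
    has_chain (nonmax_primes I) n.+1.
  move=> cP If II ss sPr sI smin; have [hc0 c0m Ic0] := cP.1 0%N (leq0n n).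
  have [P' sP' P'c] := smin _ hc0 (subset_trans II Ic0).
  have P'm : P' <> m.
    move=> P'm; apply: c0m; apply/seteqP; split; first exact: sub_m.
    by rewrite -P'm.
  apply: (has_chain_cons (c := c) (X := P')).
  - case: cP => cP cS; split=> // i /cP[? ? h]; split=> //; exact: subset_trans h.
  - by split=> //; [exact: sPr|exact: sI].
  - split=> // c0P'; apply: (fs P'); last exact/c0P'/Ic0.
    by apply/List.filter_In; split; [exact: ss|exact/asboolP].
apply: (IH (iaddp J' f) q) => //.
- rewrite cq rmorphM /= eE !factS !natrM -pmulrn; ring.
- move=> [c cP]; apply: H1; apply: (low c J _ _ s1 cP) => //.
  + exact: iaddpr.
  + by apply: subset_trans JJ' _; exact: iaddpl.
  + by move=> P h; apply/List.in_or_app; left.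
- move=> [c cP]; apply: H2; apply: (low c _ _ _ s2 cP) => //.
  + by apply: iaddl => //; exact: iaddpr.
  + by apply: iadd_mono => //; apply: subset_trans JJ' _; exact: iaddpl.
  + by move=> P h; apply/List.in_or_app; right.
Qed.

End Subgroup.
End LocalMultiplicity.

(** * Quotients and localizations *)

Lemma local_max_ideal (A : comPzRingType) (m : set A) : local_at m -> max_ideal A = m.
Proof.
move=> hm; have [mI m1 mu] := hm.
have mmax : maximal_ideal m.
  split=> // I hI mI' I1; apply/seteqP; split=> //; exact: local_sub.
rewrite /max_ideal; case: xgetP => [I _ [hI I1 Imax]|/(_ m)//].
by apply/esym/Imax => //; exact: local_sub.
Qed.

Lemma local_prime (A : comPzRingType) (m : set A) : local_at m -> prime_ideal m.
Proof.
move=> [mI m1 mu]; split=> // x y mxy; apply: contrapT => /not_orP[/mu[a xa] /mu[b yb]].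
apply: m1; have -> : 1 = (a * b) * (x * y).
  by rewrite mulrACA [a * x]mulrC [b * y]mulrC xa yb mulr1.
exact: idlM.
Qed.

Section Surjection.
Variables (A B : comPzRingType) (phi : {rmorphism A -> B}).
Hypothesis phi_surj : forall b, exists a, phi a = b.
Let ker : set A := [set a | phi a = 0].

Let pre_ideal K : is_ideal K -> is_ideal [set a | K (phi a)].
Proof.
move=> hK; split=> [|x y Kx Ky|a x Kx]; rewrite /mkset.
- by rewrite rmorph0; exact: idl0.
- by rewrite rmorphD; exact: idlD.
- by rewrite rmorphM; exact: idlM.
Qed.

Let im_ideal K : is_ideal K -> is_ideal [set phi a | a in K].
Proof.
move=> hK; split=> [|_ _ [x Kx <-] [y Ky <-]|b _ [x Kx <-]].
- by exists 0; rewrite ?rmorph0 //; exact: idl0.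
- by exists (x + y); rewrite ?rmorphD //; exact: idlD.
- by have [a <-] := phi_surj b; exists (a * x); rewrite ?rmorphM //; exact: idlM.
Qed.

Let im_mem K x : is_ideal K -> ker `<=` K -> [set phi a | a in K] (phi x) -> K x.
Proof.
move=> hK kK [y Ky xy]; rewrite -(subrK y x); apply: idlD => //.
by apply: kK; rewrite /ker /mkset rmorphB xy subrr.
Qed.

Lemma has_chain_surj (P : set (set A)) (P' : set (set B)) n :
  (forall K, P K -> [/\ is_ideal K, ker `<=` K & P' [set phi a | a in K]]) ->
  (forall K, P' K -> P [set a | K (phi a)]) ->
  has_chain P n <-> has_chain P' n.
Proof.
move=> hP hP'; split; [apply: (has_chain_map (g := fun K => [set phi a | a in K]))
  |apply: (has_chain_map (g := fun K => [set a | K (phi a)]))].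
- by move=> K /hP[].
- move=> K K' /hP[hK kK _] /hP[hK' kK' _] [KK nKK]; split.
    by move=> _ [x Kx <-]; exists x => //; exact: KK.
  move=> h; apply: nKK => x Kx; apply: im_mem => //; apply: h; by exists x.
- by move=> K /hP'.
- move=> K K' _ _ [KK nKK]; split; first by move=> x /KK.
  by move=> h; apply: nKK => b; have [a <-] := phi_surj b; exact: h.
Qed.

(** Local rings of Y are quotients of stalks of X; this lemma and the next one translate their
    lengths and prime chains into statements on ideals of the stalks of X. *)
Lemma quot_length_surj a : quot_length [set phi a] = ilen (iaddp ker a) setT.
Proof.
have hk : is_ideal ker by exact: (pre_ideal (is_ideal1 B)).
rewrite quot_lengthE; apply: chain_height_eq => n; apply: iff_sym; apply: has_chain_surj.
- move=> K [hK kK _]; split=> //; first by apply: subset_trans kK; exact: iaddpl.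
  split=> //; first exact: im_ideal.
  move=> x; apply; split; first exact: im_ideal.
  by move=> _ ->; exists a => //; apply: kK; exact: iaddpr.
- move=> K [hK kK _]; split=> //; first exact: pre_ideal.
  apply: iaddp_sub; first exact: pre_ideal.
    by move=> x kx; rewrite /mkset kx; exact: idl0.
  by apply: kK => I [_]; exact.
Qed.

Lemma has_prime_chain_surj n : has_chain [set P | prime_ideal P /\ ker `<=` P] n <->
  has_chain (@prime_ideal B) n.
Proof.
apply: has_chain_surj => K.
- move=> [[hK K1 Kp] kK]; split=> //; split; first exact: im_ideal.
    by rewrite -(rmorph1 phi) => /im_mem h; apply/K1/h.
  move=> x y; have [a <-] := phi_surj x; have [b <-] := phi_surj y.
  by rewrite -rmorphM => /im_mem -/(_ hK kK) /Kp[h|h]; [left; exists a|right; exists b].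
- move=> [hK K1 Kp]; split.
    split; first exact: pre_ideal.
      by rewrite /mkset rmorph1.
    by move=> x y; rewrite /mkset rmorphM => /Kp.
  by move=> x kx; rewrite /mkset kx; exact: idl0.
Qed.

End Surjection.

Section IsLocalization.
Variables (A : comPzRingType) (P : set A) (S : comPzRingType) (theta : {rmorphism A -> S}).

(** The property that characterizes A -> A_P up to isomorphism. It is meant for the stalks of X,
    which are only isomorphic to localizations. *)
Definition is_localization :=
  [/\ forall s, ~ P s -> exists b, theta s * b = 1,
    forall g, exists a s, ~ P s /\ g * theta s = theta a
    & forall a, theta a = 0 -> exists2 u, ~ P u & u * a = 0].

Hypothesis hP : prime_ideal P.
Hypothesis hL : is_localization.

Let m : set S := [set g | exists a s, [/\ P a, ~ P s & g * theta s = theta a]].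

Let PI : is_ideal P. Proof. by case: hP. Qed.
Let PM s t : ~ P s -> ~ P t -> ~ P (s * t).
Proof. by case: hP => _ _ Pp Ps Pt /Pp[]. Qed.

Lemma localization_unit a b : theta a * b = 1 -> ~ P a.
Proof.
case: hL => _ L2 L3 ab Pa; have [c [s [Ps bs]]] := L2 b.
have [|u Pu] := L3 (a * c - s).
  by rewrite rmorphB rmorphM -bs mulrA ab mul1r subrr.
rewrite mulrBr => /eqP; rewrite subr_eq0 => /eqP us.
by apply: (PM Pu Ps); rewrite -us mulrCA; exact: idlMr.
Qed.

Lemma localization_local : local_at m.
Proof.
have [L1 L2 L3] := hL; split.
- split.
  + by exists 0, 1; split; [exact: idl0|case: hP|rewrite mul0r rmorph0].
  + move=> x y [a [s [Pa Ps xs]]] [b [t [Pb Pt yt]]].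
    exists (a * t + b * s), (s * t); split; [|exact: PM|].
      by apply: idlD => //; exact: idlMr.
    by rewrite rmorphD !rmorphM mulrDl mulrA xs [theta s * _]mulrC mulrA yt.
  + move=> z x [a [s [Pa Ps xs]]]; have [b [t [Pt zt]]] := L2 z.
    exists (b * a), (t * s); split; [exact: idlM|exact: PM|].
    by rewrite !rmorphM mulrACA zt xs.
- move=> [a [s [Pa Ps]]]; rewrite mul1r => sa.
  by have [b sb] := L1 s Ps; apply: (localization_unit (a := a) (b := b)) => //; rewrite -sa.
- move=> g mg; have [a [s [Ps gs]]] := L2 g.
  have [b ab] : exists b, theta a * b = 1.
    by apply: L1 => Pa; apply: mg; exists a, s.
  by exists (theta s * b); rewrite mulrA gs.
Qed.

Lemma localization_max_ideal : local_at (max_ideal S).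
Proof. by rewrite (local_max_ideal localization_local); exact: localization_local. Qed.

Lemma max_ideal_localization a : max_ideal S (theta a) <-> P a.
Proof.
rewrite (local_max_ideal localization_local); split=> [ma|Pa]; last first.
  by exists a, 1; split=> //; [case: hP|rewrite rmorph1 mulr1].
apply: contrapT => Pa; have [L1 _ _] := hL; have [b ab] := L1 a Pa.
by have [mI m1 _] := localization_local; apply: m1; rewrite -ab; exact: idlMr.
Qed.

Lemma localization_mem (I : set S) g a s : is_ideal I -> ~ P s -> g * theta s = theta a ->
  I (theta a) -> I g.
Proof.
case: hL => L1 _ _ hI Ps gs Ia; have [b sb] := L1 s Ps.
by rewrite -[g]mulr1 -sb mulrA gs; exact: idlMr.
Qed.

Lemma localization_acc : acc A -> acc S.
Proof.
move=> hacc c cI cS; have [i|i x|i0 hi0] := hacc (fun i => [set a | c i (theta a)]).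
- have hI := cI i; split=> [|x y Kx Ky|a x Kx]; rewrite /mkset.
  + by rewrite rmorph0; exact: idl0.
  + by rewrite rmorphD; exact: idlD.
  + by rewrite rmorphM; exact: idlM.
- exact: cS.
exists i0 => i /hi0 h g cg; have [_ L2 _] := hL; have [a [s [Ps gs]]] := L2 g.
apply: (localization_mem (cI i0) Ps gs); apply: h.
by rewrite /mkset -gs; exact: idlMr.
Qed.

Lemma contract_prime (I : set S) : prime_ideal I ->
  prime_ideal [set a | I (theta a)] /\ [set a | I (theta a)] `<=` P.
Proof.
move=> [II I1 Ip]; split.
  split=> [|h|x y].
  - split=> [|x y Kx Ky|a x Kx]; rewrite /mkset.
    + by rewrite rmorph0; exact: idl0.
    + by rewrite rmorphD; exact: idlD.
    + by rewrite rmorphM; exact: idlM.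
  - by apply: I1; move: h; rewrite /mkset rmorph1.
  - by rewrite /mkset rmorphM => /Ip.
move=> a Ia; apply: contrapT => Pa; have [L1 _ _] := hL; have [b ab] := L1 a Pa.
by apply: I1; rewrite -ab; exact: idlMr.
Qed.

End IsLocalization.

(** * Stalks of the reduced structure *)

Section StalkMorphisms.
Variable X : ringed_space.

Lemma germ_irr (x : X) (U : opens X) (h k : open_set U x) (s : sections U) :
  germ h s = germ k s.
Proof. by rewrite (Prop_irrelevance h k). Qed.

Lemma germ_eqP (x : X) (U V : opens X) (h : open_set U x) (k : open_set V x)
    (s : sections U) (t : sections V) : germ h s = germ k t <->
  exists (W : opens X) (WU : W `<=` U) (WV : W `<=` V),
    open_set W x /\ restr WU s = restr WV t.
Proof. exact: (@to_ring_eq (stalk_setoid x)). Qed.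

Lemma germ_surj2 (x : X) (a b : stalk x) :
  exists (U : opens X) (Ux : open_set U x) (s t : sections U), a = germ Ux s /\ b = germ Ux t.
Proof.
have [U [Ux [s ->]]] := germ_surj a; have [V [Vx [t ->]]] := germ_surj b.
exists (opensI U V), (conj Ux Vx), (restr (@opensIl _ U V) s), (restr (@opensIr _ U V) t).
by split; apply/esym/germ_restr.
Qed.

Lemma germ_one (x : X) (U : opens X) (Ux : open_set U x) : germ Ux 1 = 1.
Proof.
have h : U `<=` opensT X by [].
by rewrite -[RHS]germ1 -(germ_restr h I Ux) rmorph1.
Qed.

Lemma germ_zero (x : X) (U : opens X) (Ux : open_set U x) : germ Ux 0 = 0.
Proof.
have h : U `<=` opensT X by [].
by rewrite -[RHS]germ0 -(germ_restr h I Ux) rmorph0.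
Qed.

Section Spec.
Variables (x y : X) (xy : closure [set y] x).

Lemma specialization_zmod : zmod_morphism (specialization xy).
Proof.
move=> a b; have [U [Ux [s [t [-> ->]]]]] := germ_surj2 a b.
have Uy := open_specialization xy Ux.
by rewrite -germN -germD !(specialization_germ _ _ Uy) -germN -germD.
Qed.

Lemma specialization_monoid : monoid_morphism (specialization xy).
Proof.
split=> [|a b]; first by rewrite -{1}germ1 (specialization_germ xy (U := opensT X) I I) germ1.
have [U [Ux [s [t [-> ->]]]]] := germ_surj2 a b.
have Uy := open_specialization xy Ux.
by rewrite -germM !(specialization_germ _ _ Uy) -germM.
Qed.

End Spec.

HB.instance Definition _ (x y : X) (xy : closure [set y] x) :=
  GRing.isZmodMorphism.Build (stalk x) (stalk y) (specialization xy)
    (specialization_zmod xy).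
HB.instance Definition _ (x y : X) (xy : closure [set y] x) :=
  GRing.isMonoidMorphism.Build (stalk x) (stalk y) (specialization xy)
    (specialization_monoid xy).

End StalkMorphisms.

Section ReducedStalk.
Variables (X : scheme) (Y : set X).
Local Notation R := (reduced_space Y).

Definition red_section (U : opens X) (s : sections U) :
  sections (preim_opens (@set_val_continuous X Y) U : opens R).
Proof.
refine (@LocalSection _ _ (reduced_local_data Y) (preim_opens (@set_val_continuous X Y) U)
  (fun y h => @residue_val X Y (existT _ U s) y h) _).
move=> y Uy; exists (existT _ U s), (preim_opens (@set_val_continuous X Y) U); split=> //.
by move=> y' h h' _; rewrite (Prop_irrelevance h h').
Defined.

(* The canonical map from O_{X,y} to O_{Y,y}. *)
Definition red (y : R) (a : stalk (set_val y : X)) : stalk y :=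
  let g := of_ring (S := stalk_setoid (set_val y : X)) a in
  @germ R y (preim_opens (@set_val_continuous X Y) (germ_dom g)) (germ_domP g)
    (red_section (germ_sec g)).

Lemma red_section_restr (U V : opens X) (h : V `<=` U) (s : sections U) :
  red_section (restr h s) =
  restr (r := R) (preim_opensS (fc := @set_val_continuous X Y) h) (red_section s).
Proof.
apply: lsecP => y Vy /=; rewrite /residue_val /=; congr quot_pi.
exact: germ_restr.
Qed.

Lemma red_germ (y : R) (U : opens X) (Uy : open_set U (set_val y)) (s : sections U) :
  red (germ Uy s) = @germ R y (preim_opens (@set_val_continuous X Y) U) Uy (red_section s).
Proof.
rewrite /red; set g := of_ring _.
have [W [gW [UW [Wx e]]]] : germ_eq g (GermRep Uy s).
  exact: (to_ringK (S := stalk_setoid (set_val y : X))).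
apply/germ_eqP; exists (preim_opens (@set_val_continuous X Y) W).
exists (preim_opensS (fc := @set_val_continuous X Y) gW).
exists (preim_opensS (fc := @set_val_continuous X Y) UW); split=> //.
by rewrite -!red_section_restr e.
Qed.

Lemma red_sectionD (U : opens X) (s t : sections U) :
  red_section (s + t) = red_section s + red_section t.
Proof.
by apply: lsecP => y Uy /=; rewrite /residue_val /= germD rmorphD.
Qed.
Lemma red_sectionM (U : opens X) (s t : sections U) :
  red_section (s * t) = red_section s * red_section t.
Proof.
by apply: lsecP => y Uy /=; rewrite /residue_val /= germM rmorphM.
Qed.
Lemma red_sectionN (U : opens X) (s : sections U) :
  red_section (- s) = - red_section s.
Proof.
by apply: lsecP => y Uy /=; rewrite /residue_val /= germN rmorphN.
Qed.

Lemma red_zmod (y : R) : zmod_morphism (@red y).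
Proof.
move=> a b; have [U [Ux [s [t [-> ->]]]]] := germ_surj2 a b.
by rewrite -germN -germD !red_germ red_sectionD red_sectionN germD germN.
Qed.

Lemma red_monoid (y : R) : monoid_morphism (@red y).
Proof.
split=> [|a b].
  rewrite -{1}germ1 red_germ -[RHS](germ_one (X := R) (x := y) (U := opensT R) I).
  have h : (opensT R) `<=` (preim_opens (@set_val_continuous X Y) (opensT X)) by [].
  rewrite -(germ_restr (X := R) h I I); congr germ.
  by apply: lsecP => z Uz /=; rewrite /residue_val /= germ_one rmorph1.
have [U [Ux [s [t [-> ->]]]]] := germ_surj2 a b.
by rewrite -germM !red_germ red_sectionM germM.
Qed.

HB.instance Definition _ (y : R) :=
  GRing.isZmodMorphism.Build (stalk (set_val y : X)) (stalk y) (@red y) (@red_zmod y).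
HB.instance Definition _ (y : R) :=
  GRing.isMonoidMorphism.Build (stalk (set_val y : X)) (stalk y) (@red y) (@red_monoid y).

Lemma red_surj (y : R) (b : stalk y) : exists a, red a = b.
Proof.
have [V [Vy [t ->]]] := germ_surj b.
have [[U s] [W [Wy WU e]]] := lsec_valP t Vy.
exists (germ (WU _ Wy) s); rewrite red_germ; apply/germ_eqP.
pose W' : opens R := opensI W V.
have h1 : W' `<=` preim_opens (@set_val_continuous X Y) U by move=> z [/WU].
have h2 : W' `<=` V by move=> z [].
exists W', h1, h2; split; first by split.
apply: lsecP => z [Wz Vz] /=; rewrite (e z _ (WU _ Wz) Wz).
by congr residue_val; exact: Prop_irrelevance.
Qed.

Lemma red_specialization (y eta : R) (h : closure [set eta] y)
    (h' : closure [set (set_val eta : X)] (set_val y)) (a : stalk (set_val y : X)) :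
  specialization h (red a) = red (specialization h' a).
Proof.
have [U [Uy [s ->]]] := germ_surj a; have Ue := open_specialization h' Uy.
rewrite red_germ (specialization_germ h' Uy Ue) red_germ.
exact: (specialization_germ (X := R) h
  (U := preim_opens (@set_val_continuous X Y) U) Uy Ue).
Qed.

Lemma closure_set_val (y eta : R) : closure [set eta] y ->
  closure [set (set_val eta : X)] (set_val y).
Proof.
move=> h U /(@set_val_continuous X Y y) /h[_ [-> Ue]].
by exists (set_val eta).
Qed.

End ReducedStalk.

(** * Affine charts *)

Section FracLoc.
Variables (A : comPzRingType) (P : set A) (hP : prime_ideal P).

Lemma prime_notin1 : ~ P 1. Proof. by case: hP. Qed.
Definition loc_of (a : A) : localization hP := frac_loc hP a prime_notin1.

Lemma loc_of_zmod : zmod_morphism loc_of.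
Proof.
move=> a b; have h : ~ P (1 * 1) by rewrite mulr1; exact: prime_notin1.
rewrite /loc_of -frac_locN -(frac_locD hP a prime_notin1 (- b) prime_notin1 h).
by apply/frac_loc_eq; exists 1; [exact: prime_notin1|rewrite !mulr1].
Qed.

Lemma loc_of_monoid : monoid_morphism loc_of.
Proof.
split=> [|a b]; first exact: frac_loc1.
have h : ~ P (1 * 1) by rewrite mulr1; exact: prime_notin1.
rewrite /loc_of -(frac_locM hP a prime_notin1 b prime_notin1 h).
by apply/frac_loc_eq; exists 1; [exact: prime_notin1|rewrite !mulr1].
Qed.

Lemma frac_locK a s (h : ~ P s) : frac_loc hP a h * loc_of s = loc_of a.
Proof.
have h' : ~ P (s * 1) by rewrite mulr1.
rewrite /loc_of -(frac_locM hP a h s prime_notin1 h').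
by apply/frac_loc_eq; exists 1; [exact: prime_notin1|rewrite !mulr1].
Qed.

Lemma loc_of_eq0 a : loc_of a = 0 -> exists2 u, ~ P u & u * a = 0.
Proof.
rewrite -(frac_loc0 hP prime_notin1) => /frac_loc_eq[u Pu].
by rewrite !mulr1 mulr0 => ua; exists u.
Qed.

End FracLoc.

Section Chart.
Variables (X : ringed_space) (A : comPzRingType) (f : rs_morphism (Spec_space A) X).
Hypothesis hf : open_immersion f.

Let f_inj : injective f. Proof. by case: hf. Qed.
Let f_open (U : set (spec A)) : open U -> open (f @` U).
Proof. by case: hf => _ + _; exact. Qed.

Definition chart_image (U : opens (spec A)) : opens X := Opens (f_open (open_setP U)).
Let img := chart_image.
Let img_mem (U : opens (spec A)) (P : spec A) : open_set U P -> open_set (img U) (f P).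
Proof. by move=> UP; exists P. Qed.
Let img_inv (U : opens (spec A)) (P : spec A) : open_set (img U) (f P) -> open_set U P.
Proof. by move=> [P' UP' /f_inj <-]. Qed.

Let comorph_inj (U : opens (spec A)) (s t : sections (img U)) :
  rsm_comorphism f (img U) s = rsm_comorphism f (img U) t -> s = t.
Proof.
have /bij_inj inj : bijective (rsm_comorphism f (img U)).
  by case: hf => _ _; apply=> _ [P _ <-]; exists P.
exact: inj.
Qed.

Let comorph_surj (U : opens (spec A)) (t : sections (preim_opens (@rsm_cont _ _ f) (img U))) :
  {s | rsm_comorphism f (img U) s = t}.
Proof.
apply: cid; have [g _ gK] : bijective (rsm_comorphism f (img U)).
  by case: hf => _ _; apply=> _ [P _ <-]; exists P.
by exists (g t).
Qed.

Definition const_section (U : opens (spec A)) (a : A) : local_section (spec_local_data A) U.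
Proof.
refine (@LocalSection _ _ (spec_local_data A) U (fun P _ => loc_of (spec_prime P) a) _).
move=> P UP; exists (a, 1), (basic_open 1).
split=> [||P' UP' h _]; [exact: (prime_notin1 (spec_prime P))|by []|].
by apply/frac_loc_eq; exists 1; first exact: (prime_notin1 (spec_prime P')).
Defined.

(** The fraction a/s, placed on the preimage of the image of D(s): this is D(s) as a set, in the
    form that the target of the comorphism has. *)
Definition frac_section (a s : A) :
  local_section (spec_local_data A) (preim_opens (@rsm_cont _ _ f) (img (basic_open s))).
Proof.
refine (@LocalSection _ _ (spec_local_data A)
  (preim_opens (@rsm_cont _ _ f) (img (basic_open s)))
  (fun P h => frac_loc (spec_prime P) a (@img_inv (basic_open s) P h)) _).
move=> P h; exists (a, s), (basic_open s).
split=> [||P' UP' h' _]; [exact: (@img_inv (basic_open s) P h)|by []|].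
by apply/frac_loc_eq; exists 1; first exact: (prime_notin1 (spec_prime P')).
Defined.

Definition chart_section (a : A) : sections (img (opensT (spec A))) :=
  sval (comorph_surj (U := opensT (spec A)) (const_section _ a)).

Let chart_sectionP a : rsm_comorphism f (img (opensT (spec A))) (chart_section a) =
  const_section _ a.
Proof. exact: (svalP (comorph_surj (U := opensT (spec A)) (const_section _ a))). Qed.

(* The localization map from A to O_{X,f(P)} = A_P. *)
Definition theta (P : spec A) (a : A) : stalk (f P) :=
  germ (img_mem (U := opensT (spec A)) I : open_set _ (f P)) (chart_section a).

Lemma theta_zmod (P : spec A) : zmod_morphism (theta P).
Proof.
move=> a b; rewrite /theta -germN -germD; congr germ; apply: comorph_inj.
rewrite rmorphB /= !chart_sectionP; apply: lsecP => P' h /=; exact: loc_of_zmod.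
Qed.

Lemma theta_monoid (P : spec A) : monoid_morphism (theta P).
Proof.
split=> [|a b].
  rewrite /theta -(germ_one (img_mem (U := opensT (spec A)) I : open_set _ (f P))).
  congr germ; apply: comorph_inj; rewrite rmorph1 chart_sectionP.
  by apply: lsecP => P' h; exact: (loc_of_monoid _).1.
rewrite /theta -germM; congr germ; apply: comorph_inj.
rewrite rmorphM /= !chart_sectionP; apply: lsecP => P' h /=; exact: (loc_of_monoid _).2.
Qed.

HB.instance Definition _ (P : spec A) :=
  GRing.isZmodMorphism.Build A (stalk (f P)) (theta P) (theta_zmod P).
HB.instance Definition _ (P : spec A) :=
  GRing.isMonoidMorphism.Build A (stalk (f P)) (theta P) (theta_monoid P).

Lemma theta_specialization (P P' : spec A) (h : closure [set f P'] (f P)) a :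
  specialization h (theta P a) = theta P' a.
Proof. exact: specialization_germ. Qed.

(** The inverse of s comes from the section 1/s on D(s), the fraction from the local form of
    sections of Spec A, and the kernel from evaluation in A_P. The comorphism, bijective on opens
    inside the image, transports all three to X. *)
Lemma theta_localization (P : spec A) : is_localization (spec_set P) (theta P).
Proof.
split.
- move=> s Ps; have [u uP] := comorph_surj (frac_section 1 s).
  have h : img (basic_open s) `<=` img (opensT (spec A)) by move=> _ [P' _ <-]; exists P'.
  have fP : open_set (img (basic_open s)) (f P) by exact: img_mem.
  have th b : theta P b = germ fP (restr h (chart_section b)) by apply/esym/germ_restr.
  exists (germ fP u).
  rewrite -[LHS]/(theta P s * germ fP u) th -germM -(germ_one fP); congr germ.
  apply: comorph_inj; rewrite rmorphM rmorph1 rsm_natural uP chart_sectionP.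
  by apply: lsecP => P' h' /=; rewrite mulrC frac_locK; exact: (loc_of_monoid _).1.
- move=> g; have [W [Wx [t ->]]] := germ_surj g.
  have [[a s] [D [DP Ds e]]] := lsec_valP (rsm_comorphism f W t)
    (Wx : open_set (preim_opens (@rsm_cont _ _ f) W) P).
  exists a, s; split; first exact: Ds DP.
  pose D' : opens (spec A) := opensI D (preim_opens (@rsm_cont _ _ f) W).
  have h : img D' `<=` img (opensT (spec A)) by move=> _ [P' _ <-]; exists P'.
  have h' : img D' `<=` W by move=> _ [P' [_ WP] <-].
  have fP : open_set (img D') (f P) by apply: img_mem; split.
  have th b : theta P b = germ fP (restr h (chart_section b)) by apply/esym/germ_restr.
  rewrite -[LHS]/(germ Wx t * theta P s) -[RHS]/(theta P a) !th -(germ_restr h' Wx fP) -germM.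
  congr germ; apply: comorph_inj; rewrite rmorphM !rsm_natural !chart_sectionP.
  apply: lsecP => P' k /=; have [DP' WP'] := img_inv k.
  by rewrite (e P' _ (Ds _ DP')) //; exact: frac_locK.
- move=> a; rewrite /theta -(germ_zero (img_mem (U := opensT (spec A)) I : open_set _ (f P))).
  move=> /germ_eqP[W [WU [WV [WP e]]]].
  have := congr1 (rsm_comorphism f W) e; rewrite !rsm_natural chart_sectionP !rmorph0.
  move=> /(congr1 (fun s => lsec_val s (WP : open_set (preim_opens (@rsm_cont _ _ f) W) P))) /=.
  exact: loc_of_eq0.
Qed.

Lemma chart_closure (P P' : spec A) : closure [set f P'] (f P) <-> spec_set P' `<=` spec_set P.
Proof.
split=> [h a P'a|PP U].
  apply: contrapT => Pa.
  have := h (f @` (basic_open a)) (open_nbhs_nbhs (conj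
    (f_open (open_setP (basic_open a))) (img_mem (U := basic_open a) Pa))).
  by move=> [_ [-> [P'' P''a /f_inj E]]]; apply: P''a; rewrite E.
rewrite nbhsE => -[V [Vo VP] VU]; exists (f P'); split=> //; apply: VU.
have [E EV] : zariski_open (f @^-1` V).
  exact: (open_setP (preim_opens (@rsm_cont _ _ f) (Opens Vo))).
have : (f @^-1` V) P by [].
rewrite EV /= => EP; suff : (f @^-1` V) P' by [].
by rewrite EV /= => EP'; apply: EP; exact: subset_trans PP.
Qed.

Lemma chart_generization (P : spec A) (y : X) : closure [set y] (f P) -> exists P', f P' = y.
Proof.
move=> h; have [_ [-> [P' _ <-]]] := h _ (open_nbhs_nbhs (conj (f_open openT)
  (ex_intro2 _ _ P I erefl))).
by exists P'.
Qed.

Lemma chart_closed (F : set X) : closed F -> exists E : set A,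
  forall P : spec A, F (f P) <-> E `<=` spec_set P.
Proof.
move=> Fc; have [E EV] : zariski_open (f @^-1` ~` F).
  exact: (open_setP (preim_opens (@rsm_cont _ _ f) (Opens (closed_openC Fc)))).
exists E => P; have := congr1 (fun U => U P) EV; rewrite /preimage /setC /mkset => h.
split=> [FP|EP]; apply: contrapT => n.
  by have : ~ F (f P) by rewrite h.
by have : ~ E `<=` spec_set P by rewrite -h.
Qed.

End Chart.

(** * Points of codimension 1 *)

Lemma spec_eq (A : comPzRingType) (P P' : spec A) : spec_set P = spec_set P' -> P = P'.
Proof.
case: P P' => [P hP] [P' hP'] /= E; case: _ / E in hP' *.
by rewrite (Prop_irrelevance hP hP').
Qed.

Section GenPrime.
Variables (X : ringed_space) (x y : X) (h : closure [set y] x).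
(* The prime ideal of O_{X,x} corresponding to the generization y of x. *)
Definition gen_prime : set (stalk x) :=
  [set g | max_ideal (stalk y) (specialization h g)].
End GenPrime.

Section InChart.
Variables (X : ringed_space) (A : comPzRingType) (f : rs_morphism (Spec_space A) X).
Hypothesis hf : open_immersion f.
Implicit Types P p : spec A.

Let hL P : is_localization P (theta hf P) := theta_localization hf P.

Lemma chart_stalk_local P : local_at (max_ideal (stalk (f P))).
Proof. exact: localization_max_ideal (spec_prime P) (hL P). Qed.

Lemma gen_prime_theta p P (h : closure [set f p] (f P)) a :
  gen_prime h (theta hf P a) <-> spec_set p a.
Proof.
rewrite /gen_prime /mkset theta_specialization.
exact: (max_ideal_localization (spec_prime p) (hL p)).
Qed.

Lemma max_ideal_theta P a : max_ideal (stalk (f P)) (theta hf P a) <-> spec_set P a.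
Proof. exact: (max_ideal_localization (spec_prime P) (hL P)). Qed.

Lemma gen_prime_prime p P (h : closure [set f p] (f P)) : prime_ideal (gen_prime h).
Proof.
have [[MI MD MM] m1 mp] := local_prime (chart_stalk_local p).
split; [split=> [|u v hu hv|u v hv]|move=> h1|move=> u v]; rewrite /gen_prime /mkset.
- by rewrite rmorph0.
- by rewrite rmorphD; exact: MD.
- by rewrite rmorphM; exact: MM.
- by apply: m1; move: h1; rewrite /gen_prime /mkset rmorph1.
- by rewrite rmorphM => /mp.
Qed.

(** An ideal of a localization is determined by its contraction. *)
Lemma theta_sub P (I I' : set (stalk (f P))) : is_ideal I -> is_ideal I' ->
  (forall a, I (theta hf P a) -> I' (theta hf P a)) -> I `<=` I'.
Proof.
move=> hI hI' II g Ig; have [_ L2 _] := hL P; have [a [s [Ps gs]]] := L2 g.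
apply: (localization_mem (hL P) hI' Ps gs); apply: II.
by rewrite -[theta hf P a]gs; exact: idlMr.
Qed.

Lemma gen_prime_surj P (I : set (stalk (f P))) : prime_ideal I ->
  exists p (h : closure [set f p] (f P)), I = gen_prime h.
Proof.
move=> hI; have [hp pP] := contract_prime (hL P) hI.
pose p := Spec hp; have h : closure [set f p] (f P) by apply/(chart_closure hf).
exists p, h; have [gI _ _] := gen_prime_prime h; have [II _ _] := hI.
apply/seteqP; split; apply: theta_sub => // a ha; first exact/(gen_prime_theta h).
exact: (gen_prime_theta h a).1 ha.
Qed.

Lemma gen_prime_sub p p' P (h : closure [set f p] (f P)) (h' : closure [set f p'] (f P)) :
  spec_set p `<=` spec_set p' <-> gen_prime h `<=` gen_prime h'.
Proof.
split=> [pp|hh a pa]; last first.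
  by apply/(gen_prime_theta h'); apply: hh; apply/(gen_prime_theta h).
have [gI _ _] := gen_prime_prime h; have [gI' _ _] := gen_prime_prime h'.
by apply: theta_sub => // a /(gen_prime_theta h)/pp pa; apply/(gen_prime_theta h').
Qed.

Lemma gen_prime_max p P (h : closure [set f p] (f P)) :
  gen_prime h = max_ideal (stalk (f P)) <-> p = P.
Proof.
have [gI _ _] := gen_prime_prime h; have [mI _ _] := chart_stalk_local P.
split=> [E|pP].
  apply: spec_eq; apply/seteqP; split=> a.
    by move=> pa; apply/max_ideal_theta; rewrite -E; apply/(gen_prime_theta h).
  by move=> Pa; apply/(gen_prime_theta h); rewrite E; apply/max_ideal_theta.
subst p.
apply/seteqP; split; apply: theta_sub => // a ha; last first.
  by apply/(gen_prime_theta h); apply/max_ideal_theta.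
by apply/max_ideal_theta; exact: (gen_prime_theta h a).1 ha.
Qed.

End InChart.

(* The closure of eta has a local ring of dimension 1 at z. *)
Definition codim1 (X : ringed_space) (eta z : X) := exists h : closure [set eta] z,
  gen_prime h <> max_ideal (stalk z) /\
  forall I, prime_ideal I -> gen_prime h `<=` I -> I <> max_ideal (stalk z) -> I = gen_prime h.

Section Codim1.
Variables (X : ringed_space) (A : comPzRingType) (f : rs_morphism (Spec_space A) X).
Hypothesis hf : open_immersion f.
Implicit Types P p : spec A.

Lemma codim1_sandwich p p' P : codim1 (f p) (f P) -> spec_set p `<=` spec_set p' ->
  spec_set p' `<=` spec_set P -> p' = p \/ p' = P.
Proof.
move=> [h [hm hmax]] pp' p'P.
have h' : closure [set f p'] (f P) by apply/(chart_closure hf).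
have [->|p'P'] := pselect (p' = P); [by right|left].
have E : gen_prime h' = gen_prime h.
  apply: hmax; [exact: gen_prime_prime|exact/(gen_prime_sub hf)|].
  by move=> /(gen_prime_max hf).
apply: spec_eq; apply/seteqP; split=> //.
by apply/(gen_prime_sub hf h' h); rewrite E.
Qed.

(** Such a P contains a listed prime P' over p + (E). No prime lies strictly between p and P, and P'
    = p is excluded because E is not contained in p; so P is itself on the finite list. *)
Lemma codim1_finite_chart p (E : set A) : acc A -> ~ E `<=` spec_set p ->
  finite_set [set z | codim1 (f p) z /\ exists2 P, f P = z & E `<=` spec_set P].
Proof.
move=> hacc Ep; have [pI _ _] := spec_prime p.
pose J := iadd (spec_set p) (ideal_span E).
have hJ : is_ideal J by apply: is_ideal_iadd => //; exact: ideal_span_ideal.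
have [s [s1 s2 s3]] := prime_list hacc hJ.
have : finite_set [set z | exists2 P, List.In (spec_set P) s & f P = z].
  elim: s {s1 s2 s3} => [|P s IH]; first by rewrite (_ : mkset _ = set0) // -subset0 => z [].
  apply: (sub_finite_set (B := [set z | exists2 P', spec_set P' = P & f P' = z] `|`
    [set z | exists2 P, List.In (spec_set P) s & f P = z])).
    by move=> z [P' /= [E'|sP'] fP']; [left; exists P'|right; exists P'].
  rewrite finite_setU; split=> //.
  have [[P' P'E]|h] := pselect (exists P' : spec A, spec_set P' = P).
    apply: (sub_finite_set (B := [set f P'])); last exact: finite_set1.
    by move=> z [P'' P''E <-]; rewrite (@spec_eq _ P'' P') // P''E.
  by rewrite (_ : mkset _ = set0) // -subset0 => z [P' E' _]; apply: h; exists P'.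
apply: sub_finite_set => z [cz [P fPz EP]]; rewrite -fPz in cz *.
have pP : spec_set p `<=` spec_set P by case: cz => h _; apply/(chart_closure hf).
have [PI _ _] := spec_prime P.
have JP : J `<=` spec_set P by apply: iadd_sub => // x; apply.
have [P' sP' P'P] := s3 _ (spec_prime P) JP.
have hP' : prime_ideal P' by exact: s1.
have pP' : spec_set p `<=` P'.
  by apply: subset_trans (s2 _ sP'); apply: iaddl; exact: ideal_span_ideal.
have [P'p|<-] := @codim1_sandwich p (Spec hP') P cz pP' P'P; last by exists (Spec hP').
exfalso; apply: Ep; rewrite -P'p; apply: subset_trans (s2 _ sP') => x Ex.
by apply: iaddr => // I [_]; apply.
Qed.

(** Otherwise p is a minimal prime. For an irreducible Z through f p, the intersection of the primes
    of the chart lying on Z is a prime inside p, hence p; so Z is covered by the closure of f p and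
    the complement of the chart, and equals that closure. The closure of f p would then be a
    component of X and of F. *)
Lemma closed_generization (F : set X) p : closed F -> positive_codimension F -> F (f p) ->
  exists2 p' : spec A, spec_set p' `<=` spec_set p & p' <> p.
Proof.
move=> Fc Fcod Fp; apply: contrapT => nex.
pose U : opens X := chart_image hf (opensT (spec A)).
have Up : open_set U (f p) by exists p.
have main Z : irreducible Z -> closure [set f p] `<=` Z -> Z = closure [set f p].
  move=> [_ Zirr] pZ; apply/seteqP; split=> //.
  have Zp : Z (f p) by apply: pZ; exact: subset_closure.
  pose p' := [set a | forall P : spec A, Z (f P) -> spec_set P a].
  have hp' : prime_ideal p'.
    split.
    - split=> [P _|a b ha hb P ZP|a b hb P ZP]; have [PI _ _] := spec_prime P.
      + exact: idl0.
      + by apply: idlD => //; [exact: ha|exact: hb].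
      + by apply: idlM => //; exact: hb.
    - by move=> /(_ p Zp); have [] := spec_prime p.
    - move=> a b hab.
      pose V c : opens X := chart_image hf (basic_open c).
      have [||z Zz|h|h] := Zirr (~` V a) (~` V b).
      + exact: open_closedC (open_setP (V a)).
      + exact: open_closedC (open_setP (V b)).
      + apply: contrapT => /not_orP[/contrapT[P Pa fP] /contrapT[P' P'b fP']].
        have E : P' = P by case: (hf) => inj _ _; apply: inj; rewrite fP fP'.
        have [_ _ Pp] := spec_prime P.
        have ZP : Z (f P) by rewrite fP.
        have [/Pa //|Pb] := Pp _ _ (hab P ZP).
        by apply: P'b; rewrite E.
      + by left=> P ZP; apply: contrapT => Pa; apply: (h _ ZP); exists P.
      + by right=> P ZP; apply: contrapT => Pa; apply: (h _ ZP); exists P.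
  have p'p : spec_set (Spec hp') `<=` spec_set p by move=> a /= h; exact: h.
  have E : Spec hp' = p.
    by apply: contrapT => h; apply: nex; exists (Spec hp').
  have [||z Zz|//|h] := Zirr (closure [set f p]) (~` U).
  - exact: closed_closure.
  - exact: open_closedC (open_setP U).
  - have [[P _ fP]|nU] := pselect (open_set U z); [left|by right].
    rewrite -fP; apply/(chart_closure hf); rewrite -E => a; apply.
    by rewrite fP.
  - by have := h _ Zp.
have pF : closure [set f p] `<=` F.
  by rewrite ((closure_id F).1 Fc); apply: closure_subset => _ ->.
apply: (Fcod (closure [set f p])).
  by split=> //; [exact: irreducible_closure1|move=> Z' _; exact: main].
by split=> //; [exact: irreducible_closure1|move=> Z' _; exact: main].
Qed.

End Codim1.

(** * Stalks and finiteness on a noetherian scheme *)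

Section NoetherianScheme.
Variable X : scheme.

Lemma scheme_chart (x : X) : exists A (f : rs_morphism (Spec_space A) X),
  open_immersion f /\ exists P, f P = x.
Proof.
have [U [[A [f [hf fU]]] Ux]] := scheme_affine x.
exists A, f; split=> //; move: Ux; rewrite -fU => -[P _ fP]; by exists P.
Qed.

Lemma stalk_local (x : X) : local_at (max_ideal (stalk x)).
Proof.
have [A [f [hf [P <-]]]] := scheme_chart x; exact: (chart_stalk_local hf P).
Qed.

Hypothesis X_noeth : noetherian_scheme X.

Lemma noetherian_chart (x : X) : exists A (f : rs_morphism (Spec_space A) X),
  [/\ acc A, open_immersion f & exists P, f P = x].
Proof.
have [C [_ CT CA]] := X_noeth; have [U CU Ux] : (\bigcup_(U in C) U) x by rewrite CT.
have [A [noeth [f [hf fU]]]] := CA U CU.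
exists A, f; split=> //; first exact: noetherian_acc.
by move: Ux; rewrite -fU => -[P _ fP]; exists P.
Qed.

Lemma stalk_acc (x : X) : acc (stalk x).
Proof.
have [A [f [hacc hf [P <-]]]] := noetherian_chart x.
exact: localization_acc (theta_localization hf P) hacc.
Qed.

(** The condition on B says that, in a chart containing eta, its points of codimension 1 lie in a
    closed subset that misses eta. A chart that misses eta contains no specialization of eta. *)
Lemma codim1_finite (eta : X) (B : set X) :
  (forall A (f : rs_morphism (Spec_space A) X) (hf : open_immersion f) (p : spec A),
    acc A -> f p = eta -> exists E : set A, ~ E `<=` spec_set p /\
      forall P : spec A, codim1 eta (f P) -> B (f P) -> E `<=` spec_set P) ->
  finite_set [set z | codim1 eta z /\ B z].
Proof.
move=> hB; have [C [Cfin CT CA]] := X_noeth.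
apply: (sub_finite_set (B := \bigcup_(U in C) [set z | [/\ codim1 eta z, B z & U z]])).
  move=> z [cz Bz]; have [U CU Uz] : (\bigcup_(U in C) U) z by rewrite CT.
  by exists U.
apply: bigcup_finite => // U /CA[A [noeth [f [hf fU]]]].
have hacc := noetherian_acc noeth.
have [[p pE]|h] := pselect (exists p, f p = eta).
  have [E [Ep EP]] := hB A f hf p hacc pE.
  apply: sub_finite_set (codim1_finite_chart hf hacc Ep) => z [cz Bz].
  rewrite -fU => -[P _ fP]; split; first by rewrite pE.
  by exists P => //; apply: EP; rewrite fP.
rewrite (_ : mkset _ = set0) // -subset0 => z [[hz _] _]; rewrite -fU => -[P _ fP].
by apply: h; apply: (chart_generization hf (P := P)); rewrite fP.
Qed.

End NoetherianScheme.

(** * Lengths in a local domain A/K of dimension at most one *)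

Section PrimeLength.
Variables (A : comPzRingType) (m K : set A).
Hypotheses (hacc : acc A) (hm : local_at m) (hK : prime_ideal K).
Hypothesis K_max : forall I, prime_ideal I -> K `<=` I -> I <> m -> I = K.

Let KI : is_ideal K. Proof. by case: hK. Qed.

Lemma one_dim_pow a : ~ K a -> exists n, ideal_exp m n `<=` iaddp K a.
Proof.
move=> Ka; apply: prime_only_pow => //; first exact: is_ideal_iaddp.
move=> P hP KP; apply: contrapT => Pm; apply: Ka.
rewrite -(K_max hP _ Pm); first by apply: KP; exact: iaddpr.
by apply: subset_trans KP; exact: iaddpl.
Qed.

Lemma one_dim_fin a : ~ K a -> ifin (iaddp K a) setT.
Proof.
move=> /one_dim_pow[n mn]; have hKa := is_ideal_iaddp a KI.
by apply: (@ifin_exp _ m n) => // x y /mn ? _; exact: idlMr.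
Qed.

(** Multiplication by a identifies A/(K + b) with (K + a)/(K + ab), as K is prime. This additivity
    makes orders independent of the chosen fraction. *)
Lemma one_dim_ilenM a b : ~ K a -> ~ K b ->
  ilen (iaddp K (a * b)) setT = (ilen (iaddp K a) setT + ilen (iaddp K b) setT)%N.
Proof.
move=> Ka Kb; have hKa := is_ideal_iaddp a KI; have hKb := is_ideal_iaddp b KI.
have hKab := is_ideal_iaddp (a * b) KI; have [_ _ Kp] := hK.
have Kab : ~ K (a * b) by move=> /Kp[].
have sub : iaddp K (a * b) `<=` iaddp K a.
  by apply: iaddp_sub => //; [exact: iaddpl|apply: idlMr => //; exact: iaddpr].
have h1 y : iaddp K b y -> iaddp K (a * b) (a * y).
  move=> /iaddpP[w [k Kk ->]]; apply/iaddpP; exists w, (a * k); first exact: idlM.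
  by rewrite mulrDr mulrA.
have h2 y : [set: A] y -> iaddp K (a * b) (a * y) -> iaddp K b y.
  move=> _ /iaddpP[w [k Kk yE]]; apply/iaddpP; exists w, (y - b * w); last by rewrite subrK.
  have [|//|//] := Kp a (y - b * w).
  by rewrite mulrBr yE mulrA addrK.
have E : iadd (iaddp K (a * b)) (iscale a setT) = iaddp K a.
  apply/seteqP; split.
    by apply: iadd_sub => // _ [y _ ->]; apply: idlMr => //; exact: iaddpr.
  by apply: iadd_mono => //; exact: iaddpl.
have := ilen_mul is_idealT hKab (@subsetT _ _) h1 h2; rewrite E => ->.
have [||_ ->] := ilen_add hKab hKa is_idealT sub (@subsetT _ _).
- by apply: ifin_sub (one_dim_fin Kab).
- exact: one_dim_fin.
- by rewrite addnC.
Qed.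

Lemma ilen_unit a b : a * b = 1 -> ilen (iaddp K a) setT = 0%N.
Proof.
move=> ab; have hKa := is_ideal_iaddp a KI.
rewrite (idlT_eq hKa); first by rewrite (ilen_refl is_idealT).2.
by rewrite -ab; apply: idlMr => //; exact: iaddpr.
Qed.

End PrimeLength.

(** * Local rings of the reduced structure as quotients of stalks *)

Section ReducedKernel.
Variables (X : scheme) (Y : set X).
Local Notation R := (reduced_space Y).

Lemma specialization_id (x : X) (h : closure [set x] x) a : specialization h a = a.
Proof. by have [U [Ux [s ->]]] := germ_surj a; rewrite (specialization_germ h Ux Ux). Qed.

Lemma quot_pi_max_eq0 (x : X) (g : stalk x) :
  quot_pi (max_ideal (stalk x)) g = 0 <-> max_ideal (stalk x) g.
Proof.
have [mI _ _] := stalk_local x.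
rewrite -(raddf0 (quot_pi (max_ideal (stalk x)))) quot_piP subr0.
by split=> [|mg I [_]]; [apply; split|apply].
Qed.

Variables (e : R) (e_gen : forall y : R, closure [set e] y).

(** A section of the reduced structure induced from X vanishes as soon as its value at the generic
    point does: if its germ were a unit at some z, it would remain one after specialization to e. *)
Lemma red_eq0 (y : R) (h : closure [set (set_val e : X)] (set_val y)) a :
  red a = 0 :> stalk y <-> gen_prime h a.
Proof.
have [U [Uy [s ->]]] := germ_surj a; have Ue := open_specialization h Uy.
rewrite red_germ /gen_prime /mkset (specialization_germ h Uy Ue); split.
  rewrite -(germ_zero (X := R) (Uy : open_set (preim_opens (@set_val_continuous X Y) U) y)).
  move=> /germ_eqP[W [WU [WV [Wy E]]]].
  have We := open_specialization (@e_gen y) Wy.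
  have /= := congr1 (fun t => lsec_val t We) E.
  rewrite /residue_val /= => /quot_pi_max_eq0.
  by rewrite (germ_irr Ue (WU e We)).
move=> ms.
rewrite -(germ_zero (X := R) (Uy : open_set (preim_opens (@set_val_continuous X Y) U) y)).
congr germ; apply: lsecP => z Uz /=; rewrite /residue_val /=.
apply/quot_pi_max_eq0; apply: contrapT => nms.
have [_ _ mu] := stalk_local (set_val z : X); have [b sb] := mu _ nms.
have hz := closure_set_val (@e_gen z).
have [mI m1 _] := stalk_local (set_val e : X); apply: m1.
rewrite -(rmorph1 (specialization hz)) -sb rmorphM /= (specialization_germ hz Uz Ue).
exact: idlMr.
Qed.

Lemma red_ker (y : R) (h : closure [set (set_val e : X)] (set_val y)) :
  [set a | red a = 0 :> stalk y] = gen_prime h.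
Proof. by apply/seteqP; split=> a /red_eq0. Qed.

Hypothesis X_noeth : noetherian_scheme X.

Lemma scheme_gen_prime (x z : X) (h : closure [set z] x) : prime_ideal (gen_prime h).
Proof.
have [A [f [hf [P fP]]]] := scheme_chart x; case: _ / fP in h *.
have [p pE] := chart_generization hf h; case: _ / pE in h *.
exact: gen_prime_prime.
Qed.

(** The local ring of Y at y is the quotient of the stalk of X by [gen_prime h], so its prime chains
    are the chains of primes over [gen_prime h]. *)
Lemma krull_dim1P (y : R) : krull_dim (stalk y) = 1%N <->
  codim1 (set_val e : X) (set_val y).
Proof.
have h := closure_set_val (@e_gen y); have hp := scheme_gen_prime h.
have hm := stalk_local (set_val y : X); have mp := local_prime hm.
have [gI g1 _] := hp; have gm := local_sub hm gI g1.
have chE n : has_chain [set P | prime_ideal P /\ gen_prime h `<=` P] n <->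
    has_chain (@prime_ideal (stalk y)) n.
  rewrite -(red_ker h); exact: (has_prime_chain_surj (@red_surj X Y y)).
have Isub (I : set (stalk (set_val y : X))) : prime_ideal I -> I `<=` max_ideal _.
  by case=> ? ? _; exact: local_sub.
split=> [kd|[h' [gm' gmax]]].
  (* The value 1 is not the default value 0, so it is an attained maximum. *)
  have [|c1 cmax] := @chain_height_gt0 _ (@prime_ideal (stalk y)).
    by rewrite -/(krull_dim (stalk y)) kd.
  rewrite -/(krull_dim (stalk y)) kd in c1 cmax.
  exists h; split.
    move=> E; have [c [cP cS]] := (chE 1%N).2 c1.
    have [cp0 g0] := cP 0%N isT; have [cp1 g1'] := cP 1%N isT.
    have [_] := cS 0%N isT; apply; rewrite E in g0.
    by apply: subset_trans g0; exact: Isub.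
  move=> I hI gI' Im; apply: contrapT => nE.
  suff /chE /cmax : has_chain [set P | prime_ideal P /\ gen_prime h `<=` P] 2 by [].
  exists (fun i => if i is i'.+1 then (if i' is 0%N then I else max_ideal _) else gen_prime h).
  split=> [[|[|i]] _|[|[|i]] //]; try by split.
    by move=> _; split=> // Ig; apply: nE; apply/seteqP.
  move=> _; split; first exact: Isub.
  by move=> mI; apply: Im; apply/seteqP; split=> //; exact: Isub.
rewrite (Prop_irrelevance h' h) in gm' gmax.
apply: chain_height_max.
  apply/chE; exists (fun i => if i is 0%N then gen_prime h else max_ideal _).
  split=> [[|i] _|[|i] //]; first by split.
    by split.
  by move=> _; split=> // mg; apply: gm'; apply/seteqP.
move=> n /chE[c [cP cS]]; rewrite leqNgt; apply/negP => n1.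
have [p0 g0] := cP 0%N isT; have [p1 g1'] := cP 1%N (ltnW n1); have [p2 g2] := cP 2%N n1.
have [s01 n01] := cS 0%N (ltnW n1); have [s12 n12] := cS 1%N n1.
have [E|nE] := pselect (c 1%N = max_ideal _).
  by apply: n12; rewrite E; exact: Isub.
by apply: n01; rewrite (gmax _ p1 g1' nE).
Qed.

End ReducedKernel.

(** * Divisors of rational functions *)

Lemma subz_of_add (i j k l : nat) : (i + j = k + l)%N -> j%:Z - l%:Z = k%:Z - i%:Z.
Proof.
move=> E; apply/eqP; rewrite subr_eq addrAC eq_sym subr_eq -!PoszD addnC; apply/eqP.
by rewrite addnC -E addnC.
Qed.

(** With gamma = a/s, both a and s are outside p, and gamma is a quotient of units wherever as does
    not vanish: E consists of the single element as. *)
Lemma unit_fraction_chart (X : scheme) (A : comPzRingType)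
    (f : rs_morphism (Spec_space A) X) (p : spec A) (eta : X) (gamma : stalk eta) :
  open_immersion f -> f p = eta -> ~ max_ideal (stalk eta) gamma ->
  exists E : set A, ~ E `<=` spec_set p /\
    forall (P : spec A) (h : closure [set eta] (f P)), ~ E `<=` spec_set P ->
    exists a b a' b' : stalk (f P),
      [/\ a * a' = 1, b * b' = 1 & gamma * specialization h b = specialization h a].
Proof.
move=> hf pE; case: _ / pE in gamma * => gamma_nz.
have hp := theta_localization hf p; have [L1 L2 L3] := hp.
have [a [s [ps E]]] := L2 gamma.
have pa : ~ spec_set p a.
  move=> pa; apply: gamma_nz.
  have [mI m1 mu] := stalk_local (f p); have [b sb] := L1 s ps.
  rewrite -[gamma]mulr1 -sb mulrA E; apply: idlMr => //.
  exact/max_ideal_theta.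
exists [set a * s]; split.
  by move=> /(_ _ erefl); have [_ _ pp] := spec_prime p; move=> /pp[].
move=> P h nP; have Pas : ~ spec_set P (a * s) by move=> Pas; apply: nP => _ ->.
have [PI _ _] := spec_prime P; have [L1' _ _] := theta_localization hf P.
have [a' aa] : exists b, theta hf P a * b = 1 by apply: L1' => Pa; apply: Pas; exact: idlMr.
have [s' ss] : exists b, theta hf P s * b = 1 by apply: L1' => Ps; apply: Pas; exact: idlM.
exists (theta hf P a), (theta hf P s), a', s'; split=> //.
by rewrite !theta_specialization.
Qed.

Section RationalFunction.
Variables (X : scheme) (X_noeth : noetherian_scheme X) (eta : X).
Local Notation Y := (point_closure eta).
Local Notation R := (reduced_space Y).

Definition closure_point (z : X) (h : closure [set eta] z) : R :=
  SigSub (mem_set (h : (Y : set X) z)).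

Lemma closure_self : closure [set eta] eta.
Proof. by apply: subset_closure. Qed.

Definition generic_point : R := closure_point closure_self.

Lemma generic_pointP (y : R) : closure [set generic_point] y.
Proof.
move=> B; rewrite nbhsE => -[V [Vo Vy] VB]; exists generic_point; split=> //; apply: VB.
have [W Wo WV] : exists2 W : set X, open W & (set_val : R -> X) @^-1` W = V by exact: Vo.
move: Vy; rewrite -WV => Wy.
have /(_ W (open_nbhs_nbhs (conj Wo Wy))) : closure [set eta] (set_val y : X).
  exact: (set_valP y).
by move=> [_ [-> ]].
Qed.

Variables (gamma : stalk eta) (gamma_nz : ~ max_ideal (stalk eta) gamma).

Let hy (y : R) : closure [set eta] (set_val y : X) := closure_set_val (@generic_pointP y).

Lemma rat_function_neq0 : red (y := generic_point) gamma <> 0.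
Proof.
move=> /(red_eq0 (@generic_pointP) (@hy generic_point)).
by rewrite /gen_prime /mkset specialization_id.
Qed.

Lemma generic_closure : closure [set generic_point] = setT.
Proof. by apply/seteqP; split=> // y _; exact: @generic_pointP. Qed.

Definition ratf : rat_function X :=
  @RatFunction X Y generic_point generic_closure (red (y := generic_point) gamma)
    rat_function_neq0.

(** [ord] selects some fraction a1/b1. Lifted to the stalk of X as a'/b', it satisfies ba' = ab'
    modulo the prime of Y, and additivity of lengths gives the same difference. *)
Lemma ordE (x : R) (h : closure [set eta] (set_val x : X)) (a b : stalk (set_val x : X)) :
  codim1 eta (set_val x : X) -> ~ gen_prime h a -> ~ gen_prime h b ->
  gamma * specialization h b = specialization h a ->
  ord (f := ratf) x = (ilen (iaddp (gen_prime h) a) setT)%:Z -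
                      (ilen (iaddp (gen_prime h) b) setT)%:Z.
Proof.
move=> [h0 [hm hmax]] ha hb E; rewrite (Prop_irrelevance h0 h) in hm hmax.
have hp := scheme_gen_prime h; have hacc := @stalk_acc X X_noeth (set_val x : X).
have hloc := stalk_local (set_val x : X).
have kerE := red_ker (@generic_pointP) h.
have lenE c : quot_length [set red (y := x) c] = ilen (iaddp (gen_prime h) c) setT.
  by rewrite (quot_length_surj (@red_surj X Y x)) kerE.
have nz c : red (y := x) c <> 0 <-> ~ gen_prime h c.
  by split=> k; apply: contra_not k => /(red_eq0 (@generic_pointP) h).
have hs : closure [set generic_point] x by exact: @generic_pointP.
rewrite /ord; case: xgetP => [n _ [a1 [b1 [a10 b10 E1 ->]]]|/(_ _)/= none].
  have [a' a'E] := red_surj a1; have [b' b'E] := red_surj b1; rewrite -a'E -b'E in a10 b10 E1 *.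
  rewrite !lenE; move/nz: a10 => a10; move/nz: b10 => b10.
  have : gen_prime h (b * a' - a * b').
    rewrite /gen_prime /mkset rmorphB !rmorphM /= -E.
    move: E1; rewrite /= (@red_specialization X Y x generic_point _ h b').
    rewrite (@red_specialization X Y x generic_point _ h a') -rmorphM => E1.
    have : red (y := generic_point)
        (specialization h a' - gamma * specialization h b') = 0.
      by rewrite rmorphB /= -E1 subrr.
    move=> /(red_eq0 (@generic_pointP) (@hy generic_point)).
    rewrite /gen_prime /mkset specialization_id => k.
    have [mI _ _] := stalk_local eta.
    have -> : specialization h b * specialization h a' -
        gamma * specialization h b * specialization h b' =
      specialization h b * (specialization h a' - gamma * specialization h b') by ring.
    exact: idlM.
  move=> k.
  have [KI _ _] := hp.
  have sub c d : gen_prime h (c - d) -> iaddp (gen_prime h) c `<=` iaddp (gen_prime h) d.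
    move=> cd; have hd := is_ideal_iaddp d KI; apply: iaddp_sub => //; first exact: iaddpl.
    by rewrite -(subrK d c); apply: idlD => //; [exact: iaddpl|exact: iaddpr].
  have kE : iaddp (gen_prime h) (b * a') = iaddp (gen_prime h) (a * b').
    apply/seteqP; split; apply: sub => //.
    by rewrite -opprB; exact: ideal_opp.
  have e1 := one_dim_ilenM hacc hloc hp hmax hb a10.
  have e2 := one_dim_ilenM hacc hloc hp hmax ha b10.
  have e3 := congr1 (fun I => ilen I setT) kE.
  exact: (subz_of_add (etrans (esym e1) (etrans e3 e2))).
case: (none ((ilen (iaddp (gen_prime h) a) setT)%:Z -
  (ilen (iaddp (gen_prime h) b) setT)%:Z)).
exists (red (y := x) a), (red (y := x) b); split; [exact/nz|exact/nz| |].
  rewrite /= (@red_specialization X Y x generic_point _ h b).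
  by rewrite (@red_specialization X Y x generic_point _ h a) -E rmorphM.
by rewrite !lenE.
Qed.

Lemma ord_unit (x : R) (h : closure [set eta] (set_val x : X))
    (a b a' b' : stalk (set_val x : X)) :
  codim1 eta (set_val x : X) -> a * a' = 1 -> b * b' = 1 ->
  gamma * specialization h b = specialization h a -> ord (f := ratf) x = 0.
Proof.
move=> cx aa bb E; have hp := scheme_gen_prime h; have [KI K1 _] := hp.
have nK c c' : c * c' = 1 -> ~ gen_prime h c.
  by move=> cc Kc; apply: K1; rewrite -cc; exact: idlMr.
rewrite (ordE (h := h) (a := a) (b := b)) //; [|exact: nK aa|exact: nK bb].
by rewrite (ilen_unit hp aa) (ilen_unit hp bb).
Qed.

Lemma set_val_finite (S : set X) : finite_set S -> finite_set [set x : R | S (set_val x)].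
Proof.
move=> fS; apply: (sub_finite_set (B := \bigcup_(z in S) [set x : R | (set_val x : X) = z])).
  by move=> x Sx; exists (set_val x).
apply: bigcup_finite => // z _.
have [[x xz]|n] := pselect (exists x : R, (set_val x : X) = z).
  apply: (sub_finite_set (B := [set x])); last exact: finite_set1.
  by move=> x' /= x'z; apply: val_inj; rewrite -set_valE x'z xz.
by rewrite (_ : mkset _ = set0) // -subset0 => x /= xz; apply: n; exists x.
Qed.

Lemma ord_support_finite :
  finite_set [set x : R | krull_dim (stalk x) = 1%N /\ ord (f := ratf) x <> 0].
Proof.
(* The points where gamma is not a quotient of units; elsewhere the order is 0. *)
pose B z := ~ exists (h : closure [set eta] z) (a b a' b' : stalk z),
  [/\ a * a' = 1, b * b' = 1 & gamma * specialization h b = specialization h a].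
apply: (sub_finite_set (B := [set x : R | [set z | codim1 eta z /\ B z] (set_val x)])).
  move=> x [kd ox]; have cx := (krull_dim1P (@generic_pointP) x).1 kd; split=> //.
  by move=> [h [a [b [a' [b' [aa bb E]]]]]]; apply: ox; exact: ord_unit cx aa bb E.
apply: set_val_finite; apply: codim1_finite => // A f hf p hacc pE.
have [E [Ep EP]] := unit_fraction_chart hf pE gamma_nz.
exists E; split=> // P [h _] nex; apply: contrapT => nEP; apply: nex; exists h.
exact: EP.
Qed.

Lemma coeff_div (Z : integral_closed X) (x1 : R) : krull_dim (stalk x1) = 1%N ->
  (forall x : R, krull_dim (stalk x) = 1%N -> point_closure (set_val x : X) = Z -> x <> x1 ->
    ord (f := ratf) x = 0) ->
  coeff Z (div ratf) = ord (f := ratf) x1 * (point_closure (set_val x1 : X) == Z)%:R.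
Proof.
move=> kd1 h0; have fin := ord_support_finite.
pose F (x : R) : cycle_group X := << ord (f := ratf) x *g point_closure (set_val x : X) >>.
(* x1 is put into the list even if its order is 0, so that its term can always be split off. *)
have [r ur rE] : exists2 r : seq R, uniq r &
    [set x : R | krull_dim (stalk x) = 1%N /\ ord (f := ratf) x <> 0] `|` [set x1] = [set` r].
  have /finite_seqP[s sE] : finite_set ([set x : R | krull_dim (stalk x) = 1%N /\
      ord (f := ratf) x <> 0] `|` [set x1]) by rewrite finite_setU; split.
  exists (undup s); first exact: undup_uniq.
  by rewrite sE; apply/seteqP; split=> x /=; rewrite mem_undup.
have x1r : x1 \in r by have : [set` r] x1 by rewrite -rE; right.
have D1 x : x \in r -> krull_dim (stalk x) = 1%N.
  by move=> xr; have : [set` r] x by []; rewrite -rE => -[[]//|->].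
have -> : div ratf = \sum_(x <- r) F x.
  rewrite /div (@fsbigE _ _ _ _ _ r) //.
  - by rewrite big_seq_cond [RHS]big_seq; apply: eq_bigl => x;
      case xr: (x \in r) => //=; apply/mem_set; exact: D1.
  - move=> x kd xr; apply/eqP; rewrite freegU_eq0; apply/eqP; apply: contrapT => ox.
    by move: xr; have -> : x \in r by have : [set` r] x by rewrite -rE; left.
rewrite raddf_sum (bigD1_seq x1) //= coeffU big1_seq ?addr0 // => x /andP[xx1 xr].
rewrite coeffU; have [E|/eqP/negPf ->] := pselect (point_closure (set_val x : X) = Z).
  by rewrite h0 ?mul0r //; [exact: D1|exact/eqP].
by rewrite mulr0.
Qed.

End RationalFunction.

(** * The moving lemma *)

Lemma rmorph_ideal_exp (A B : comPzRingType) (phi : {rmorphism A -> B})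
    (q : set A) (m : set B) n :
  (forall x, q x -> m (phi x)) -> forall x, ideal_exp q n x -> ideal_exp m n (phi x).
Proof.
move=> qm; elim: n => [//|n IH].
have hI := is_ideal_exp m n.+1.
apply: (ideal_mul_sub (K := [set x | ideal_exp m n.+1 (phi x)])).
  split=> [|x y hx hy|a x hx]; rewrite /mkset.
  - by rewrite rmorph0; exact: (idl0 hI).
  - by rewrite rmorphD; exact: (idlD hI).
  - by rewrite rmorphM; exact: (idlM _ hI).
by move=> x y qx qy; rewrite /mkset rmorphM; apply: ideal_mul_in; [exact: qm|exact: IH].
Qed.

Lemma avoid_primes (A : comPzRingType) (t : seq (spec A)) (J : set A) (a : A) : is_ideal J ->
  (forall P, List.In P t -> ~ J `<=` spec_set P) ->
  exists2 x, J x & forall P, List.In P t -> ~ spec_set P (a + x).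
Proof.
move=> hJ tJ; apply: (avoid_coset (mem := @spec_set A)
  (le := fun P P' => spec_set P `<=` spec_set P')).
- exact: idl0.
- by move=> x y; exact: idlD.
- by move=> P _ x y; have [PI _ _] := spec_prime P; exact: idlB.
- by move=> P P' _ _; apply.
move=> P tP; have [PI P1 Pp] := spec_prime P.
have JP := tJ P tP; elim: t {tJ tP} => [|P' t IH].
  by have /existsNP[h /not_implyP[Jh Ph]] := JP; exists h.
have [h [Jh Ph hP]] := IH.
have [le1|/existsNP[b /not_implyP[P'b Pb]]] := pselect (spec_set P' `<=` spec_set P).
  by exists h; split=> // P'' [<- /(_ le1)//|]; exact: hP.
exists (b * h); split; [exact: idlM|by move=> /Pp[]|].
have [P'I _ _] := spec_prime P'.
move=> P'' [<- _|tP'' le2]; first exact: idlMr.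
by have [P''I _ _] := spec_prime P''; apply: idlM => //; exact: hP.
Qed.

Lemma iaddp_unit (A : comPzRingType) (K : set A) (u v w : A) : is_ideal K -> v * w = 1 ->
  iaddp K (u * v) = iaddp K u.
Proof.
move=> KI vw; have h1 := is_ideal_iaddp (u * v) KI; have h2 := is_ideal_iaddp u KI.
apply/seteqP; split; apply: iaddp_sub => //; try exact: iaddpl.
  by apply: idlMr => //; exact: iaddpr.
have uE : u = u * v * w by rewrite -mulrA vw mulr1.
by rewrite {2}uE; apply: idlMr => //; exact: iaddpr.
Qed.

Lemma iaddp_addr (A : comPzRingType) (K : set A) (u k : A) : is_ideal K -> K k ->
  iaddp K (u + k) = iaddp K u.
Proof.
move=> KI Kk; have h1 := is_ideal_iaddp (u + k) KI; have h2 := is_ideal_iaddp u KI.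
apply/seteqP; split; apply: iaddp_sub => //; try exact: iaddpl.
  by apply: idlD => //; [exact: iaddpr|exact: iaddpl].
have uE : u = u + k - k by rewrite addrK.
by rewrite {2}uE; apply: idlB => //; [exact: iaddpr|exact: iaddpl].
Qed.

Section Approximation.
Variables (X : scheme) (X_noeth : noetherian_scheme X).
Variables (A : comPzRingType) (f : rs_morphism (Spec_space A) X).
Hypothesis hf : open_immersion f.

(** Replace a by the numerator b of a fraction, which generates the same ideal modulo the prime of
    Y, and perturb b by a highly vanishing x at q to avoid t. A prime P of t containing a power of q
    contains q, so q = p or q = P; the first is impossible because b is in q but not in p, the
    second by hypothesis. *)
Lemma chart_approximation (p q : spec A) (h : closure [set f p] (f q)) (a : stalk (f q))
    (t : seq (spec A)) :
  codim1 (f p) (f q) -> max_ideal (stalk (f q)) a -> ~ gen_prime h a ->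
  (forall P, List.In P t -> codim1 (f p) (f P) /\ P <> q) ->
  exists c : A, [/\ ~ spec_set p c, forall P, List.In P t -> ~ spec_set P c
    & iaddp (gen_prime h) (theta hf q c) = iaddp (gen_prime h) a].
Proof.
move=> [h0 [hm hmax]] ma Ka ht; rewrite (Prop_irrelevance h0 h) in hm hmax.
have hacc := @stalk_acc X X_noeth (f q); have hloc := stalk_local (f q).
have [mI m1 mu] := hloc; have hK := scheme_gen_prime h; have [KI K1 Kp] := hK.
have hL := theta_localization hf q; have [L1 L2 _] := hL.
have [b [s [qs E]]] := L2 a; have [s' ss] := L1 s qs.
have pq : spec_set p `<=` spec_set q by apply/(chart_closure hf).
have [qI _ _] := spec_prime q.
have aE : iaddp (gen_prime h) (theta hf q b) = iaddp (gen_prime h) a.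
  by rewrite -[theta hf q b]E; exact: iaddp_unit ss.
have qb : spec_set q b by apply/(max_ideal_theta hf); rewrite -[theta hf q b]E; exact: idlMr.
have Kb : ~ gen_prime h (theta hf q b).
  rewrite -[theta hf q b]E => /Kp[//|Ks]; apply: K1; rewrite -ss; exact: idlMr.
have pb : ~ spec_set p b by move=> pb; apply: Kb; apply/(gen_prime_theta hf).
have [N mN] := one_dim_pow hacc hK hmax Kb.
(* The exponent N already puts x into K + (b), K the prime of Y. One more factor puts it into K +
   bm, so that b + x is b(1 + u) modulo K with u in m and 1 + u a unit. *)
have [x qx xt] : exists2 x, ideal_exp (spec_set q) N.+1 x &
    forall P, List.In P t -> ~ spec_set P (b + x).
  apply: avoid_primes; first exact: is_ideal_exp.
  move=> P /ht[cP Pq] qP.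
  have pP : spec_set p `<=` spec_set P by case: cP => hp _; apply/(chart_closure hf).
  have qP' : spec_set q `<=` spec_set P.
    elim: N.+1 qP => [|k IH]; first by have [_ P1 _] := spec_prime P; move=> /(_ 1 I).
    by move=> /(prime_subM (spec_prime P))[|/IH].
  by have [qp|qP''] := codim1_sandwich hf cP pq qP'; [apply: pb; rewrite -qp|apply: Pq].
have mx : ideal_exp (max_ideal (stalk (f q))) N.+1 (theta hf q x).
  apply: (rmorph_ideal_exp (q := spec_set q)) qx => y qy; exact/(max_ideal_theta hf).
have [k [_ [Kk [u mu' ->] xE]]] : iadd (gen_prime h)
    (iscale (theta hf q b) (max_ideal (stalk (f q)))) (theta hf q x).
  have hS : is_ideal (iadd (gen_prime h) (iscale (theta hf q b) (max_ideal (stalk (f q))))).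
    by apply: is_ideal_iadd => //; exact: is_ideal_iscale.
  apply: (ideal_mul_sub hS) mx => u v mu' /mN/iaddpP[w [k Kk ->]].
  exists (u * k), (theta hf q b * (u * w)); split; first exact: idlM.
    by exists (u * w) => //; exact: idlMr.
  by rewrite mulrDr [u * (_ * w)]mulrCA.
have [v uv] : exists v, (1 + u) * v = 1.
  by apply: mu => mu1; apply: m1; rewrite -(addrK u 1); exact: idlB.
have cE : iaddp (gen_prime h) (theta hf q (b + x)) = iaddp (gen_prime h) a.
  rewrite -aE; have E2 : theta hf q (b + x) = theta hf q b * (1 + u) + k.
    have := rmorphD (theta hf q) b x; rewrite /= xE => ->.
    by rewrite mulrDr mulr1 addrA addrAC.
  by rewrite E2 iaddp_addr //; exact: iaddp_unit uv.
exists (b + x); split=> // pc; apply: Ka.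
have : iaddp (gen_prime h) a `<=` gen_prime h.
  by rewrite -cE; apply: iaddp_sub => //; apply/(gen_prime_theta hf).
by apply; exact: iaddpr.
Qed.

(** Every point of codimension 1 of Y in F other than f q comes from t, where gamma = a/b is a
    quotient of units. Over F only the term at f q is left, and the subtraction cancels it. *)
Lemma div_avoids (F : set X) (p q : spec A) (h : closure [set f p] (f q)) (t : seq (spec A))
    (gamma : stalk (f p)) (nz : ~ max_ideal (stalk (f p)) gamma) (a b : A) :
  codim1 (f p) (f q) ->
  (forall z, codim1 (f p) z -> F z -> z <> f q -> exists2 P, List.In P t & f P = z) ->
  ~ spec_set p a -> ~ spec_set p b ->
  (forall P, List.In P t -> ~ spec_set P a /\ ~ spec_set P b) ->
  gamma * theta hf p b = theta hf p a ->
  generically_avoids F (<< (ilen (iaddp (gen_prime h) (theta hf q a)) setT)%:Z -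
      (ilen (iaddp (gen_prime h) (theta hf q b)) setT)%:Z *g point_closure (f q) >>
    - div (ratf nz) : cycle_group X).
Proof.
move=> cq tP pa pb abt E Z; rewrite mem_dom => /eqP cZ ZF; apply: cZ.
pose x1 : reduced_space (point_closure (f p)) := closure_point h.
have kd1 : krull_dim (stalk x1) = 1%N.
  by apply/(krull_dim1P (@generic_pointP X (f p))).
rewrite coeffB coeffU (coeff_div (gamma_nz := nz) X_noeth kd1).
  rewrite (ordE X_noeth nz (x := x1) (h := h) (a := theta hf q a) (b := theta hf q b)) //.
  - by rewrite subrr.
  - by move=> /(gen_prime_theta hf).
  - by move=> /(gen_prime_theta hf).
  - by rewrite !theta_specialization.
move=> x kd xZ xx1.
have cx := (krull_dim1P (@generic_pointP X (f p)) x).1 kd.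
have Fx : F (set_val x : X).
  by apply: ZF; rewrite -xZ; apply: subset_closure.
have [|P tP' fP] := tP _ cx Fx.
  by move=> xq; apply: xx1; apply: val_inj; rewrite -set_valE xq.
have [Pa Pb] := abt P tP'.
(* z is kept variable so that the equality f P = z can be eliminated in the types of stalks. *)
have key (z : X) : f P = z -> closure [set f p] z ->
    exists (h' : closure [set f p] z) (a1 b1 a2 b2 : stalk z), [/\ a1 * a2 = 1, b1 * b2 = 1
      & gamma * specialization h' b1 = specialization h' a1].
  move=> zE; case: _ / zE => h'; have [L1 _ _] := theta_localization hf P.
  have [a2 a2E] := L1 a Pa; have [b2 b2E] := L1 b Pb.
  exists h', (theta hf P a), (theta hf P b), a2, b2; split=> //.
  by rewrite !theta_specialization.
have [|h' [a1 [b1 [a2 [b2 [e1 e2 e3]]]]]] := key _ fP; first by case: cx.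
exact: (ord_unit X_noeth nz cx e1 e2 e3).
Qed.

End Approximation.

Section Moving.
Variables (X : scheme) (F : set X) (x0 : X).

Definition movable (n : int) := exists fs : seq (rat_function X),
  generically_avoids F (<< n *g point_closure x0 >> - \sum_(f <- fs) div f : cycle_group X).

Lemma generically_avoids_coeff (Z : cycle_group X) : generically_avoids F Z <->
  forall Y : integral_closed X, Y `<=` F -> coeff Y Z = 0.
Proof.
split=> [h Y YF|h Y + YF]; last by rewrite mem_dom h ?eqxx.
by apply: contrapT => cY; apply: (h Y) => //; rewrite mem_dom; apply/eqP.
Qed.

Lemma movable0 : movable 0.
Proof.
exists [::]; apply/generically_avoids_coeff => Y _.
by rewrite big_nil subr0 coeffU mul0r.
Qed.

Lemma movableD m n : movable m -> movable n -> movable (m + n).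
Proof.
move=> [fs /generically_avoids_coeff hf] [gs /generically_avoids_coeff hg]; exists (fs ++ gs).
apply/generically_avoids_coeff => Y YF; have := hf Y YF; have := hg Y YF.
rewrite big_cat /= !coeffB coeffD !coeffU mulrDl => /eqP; rewrite subr_eq0 => /eqP ->.
by move=> /eqP; rewrite subr_eq0 => /eqP ->; rewrite subrr.
Qed.

Lemma bad_points_list (A : comPzRingType) (f : spec A -> X) (S : set X) : finite_set S ->
  (forall z, S z -> exists P, f P = z) ->
  exists t : seq (spec A), (forall P, List.In P t -> S (f P)) /\
    forall z, S z -> exists2 P, List.In P t & f P = z.
Proof.
move=> /finite_seqP[s ->]; elim: s => [|z s IH] h; first by exists [::].
have [|t [t1 t2]] := IH; first by move=> y ys; apply: h; rewrite /= inE; apply/orP; right.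
have [|P Pz] := h z; first by rewrite /= inE eqxx.
exists (P :: t); split=> [P' [<-|/t1 tP']|y] /=.
- by rewrite /= inE Pz eqxx.
- by rewrite /= inE; apply/orP; right.
- rewrite inE => /orP[/eqP ->|/t2[P' tP' fP']]; first by exists P; [left|].
  by exists P'; [right|].
Qed.

End Moving.

(** Since eta is not in F, the points of codimension 1 of Y in F are finitely many, and the FA
    property applies. The function c gives the length, its inverse at eta gives the negative. *)
Lemma movable_length (X : scheme) (X_noeth : noetherian_scheme X) (X_FA : FA_scheme X)
    (F : set X) (F_closed : closed F) (x0 eta : X) (h : closure [set eta] x0) (a : stalk x0) :
  codim1 eta x0 -> ~ F eta -> max_ideal (stalk x0) a -> ~ gen_prime h a ->
  movable F x0 (ilen (iaddp (gen_prime h) a) setT)%:Z /\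
  movable F x0 (- (ilen (iaddp (gen_prime h) a) setT)%:Z).
Proof.
move=> cx Feta ma Ka.
pose S := [set z | codim1 eta z /\ (F z /\ z <> x0)].
have Sfin : finite_set S.
  apply: codim1_finite => // A f hf p hacc pE; have [E EP] := chart_closed f F_closed.
  exists E; split; first by move=> /EP; rewrite pE.
  by move=> P _ [FP _]; apply/EP.
have [|U [[A [f [hf fU]]] SU]] := X_FA (S `|` [set x0]).
  by rewrite finite_setU; split.
have [q fq] : exists q, f q = x0.
  have : U x0 by apply: SU; right.
  by rewrite -fU => -[q _ fq]; exists q.
have [p fp] : exists p, f p = eta by apply: (chart_generization hf (P := q)); rewrite fq.
have [t [t1 t2]] : exists t : seq (spec A), (forall P, List.In P t -> S (f P)) /\
    forall z, S z -> exists2 P, List.In P t & f P = z.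
  apply: bad_points_list => // z Sz; have : U z by apply: SU; left.
  by rewrite -fU => -[P _ fP]; exists P.
subst x0 eta.
have tq P : List.In P t -> codim1 (f p) (f P) /\ P <> q.
  by move=> /t1[cP [_ Pq]]; split=> // E; apply: Pq; rewrite E.
have tF z : codim1 (f p) z -> F z -> z <> f q -> exists2 P, List.In P t & f P = z.
  by move=> cz Fz zq; apply: t2; split.
have [c [pc tc cE]] := chart_approximation X_noeth hf cx ma Ka tq.
have hK := scheme_gen_prime h; have hp := theta_localization hf p.
have one1 (P : spec A) : ~ spec_set P 1 by case: (spec_prime P).
have len1 : ilen (iaddp (gen_prime h) (theta hf q 1)) setT = 0%N.
  by apply: (ilen_unit hK (b := 1)); rewrite mulr1 (rmorph1 (theta hf q)).
have nz1 : ~ max_ideal (stalk (f p)) (theta hf p c) by move=> /max_ideal_theta.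
have [L1 _ _] := hp; have [b cb] := L1 c pc.
have nz2 : ~ max_ideal (stalk (f p)) b.
  by have [mI m1 _] := stalk_local (f p); move=> mb; apply: m1; rewrite -cb; exact: idlM.
split.
  exists [:: ratf nz1]; rewrite big_seq1.
  have := @div_avoids X X_noeth A f hf F p q h t _ nz1 c 1 cx tF pc (one1 p).
  rewrite len1 subr0 cE; apply; first by move=> P tP; split; [exact: tc|exact: one1].
  by rewrite [theta hf p 1](rmorph1 (theta hf p)) mulr1.
exists [:: ratf nz2]; rewrite big_seq1.
have := @div_avoids X X_noeth A f hf F p q h t _ nz2 1 c cx tF (one1 p) pc.
rewrite len1 sub0r cE; apply; first by move=> P tP; split; [exact: one1|exact: tc].
by rewrite [theta hf p 1](rmorph1 (theta hf p)) mulrC.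
Qed.

Lemma stalk_closed (X : scheme) (F : set X) (x : X) : closed F ->
  exists IF : set (stalk x), is_ideal IF /\
    forall eta (h : closure [set eta] x), IF `<=` gen_prime h <-> F eta.
Proof.
move=> Fc; have [A [f [hf [q fq]]]] := scheme_chart x; subst x.
have [E EP] := chart_closed f Fc.
exists (ideal_span [set theta hf q a | a in E]); split; first exact: ideal_span_ideal.
move=> eta h; have [p fp] := chart_generization hf h; subst eta.
have [gI _ _] := scheme_gen_prime h; rewrite EP; split=> [sub a Ea|Ep].
  apply/(gen_prime_theta hf h); apply: sub => I [_]; apply; by exists a.
by move=> g; apply; split=> // _ [a Ea <-]; apply/(gen_prime_theta hf h); exact: Ep.
Qed.

Lemma stalk_prime_point (X : scheme) (x : X) (I : set (stalk x)) : prime_ideal I ->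
  exists eta (h : closure [set eta] x), I = gen_prime h.
Proof.
have [A [f [hf [q fq]]]] := scheme_chart x; subst x => hI.
by have [p [h ->]] := gen_prime_surj hf hI; exists (f p), h.
Qed.

(** Positive codimension, expressed in the stalk: the prime of a point of F is never minimal. *)
Lemma stalk_generization (X : scheme) (F : set X) (x eta : X) (h : closure [set eta] x) :
  closed F -> positive_codimension F -> F eta ->
  exists I : set (stalk x), prime_ideal I /\ I `<` gen_prime h.
Proof.
move=> Fc Fcod Feta; have [A [f [hf [q fq]]]] := scheme_chart x; subst x.
have [p fp] := chart_generization hf h; subst eta.
have [p' p'p np'] := closed_generization hf Fc Fcod Feta.
have pq : spec_set p `<=` spec_set q by apply/(chart_closure hf).
have h' : closure [set f p'] (f q) by apply/(chart_closure hf); exact: subset_trans pq.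
exists (gen_prime h'); split; first exact: scheme_gen_prime.
split; first exact/(gen_prime_sub hf).
by move=> /(gen_prime_sub hf h h') pp'; apply: np'; apply: spec_eq; apply/seteqP.
Qed.

Lemma primary_to_maximal (A : comPzRingType) (m Q : set A) : acc A -> local_at m ->
  primary_to m Q -> [/\ is_ideal Q, Q `<=` m & exists n, ideal_exp m n `<=` Q].
Proof.
move=> hacc hm [[hQ Q1 Qp] rQ]; have Qm : Q `<=` m.
  by move=> x Qx; rewrite -rQ; exists 1%N.
split=> //; apply: prime_only_pow => // P hP QP; have [PI P1 Pp] := hP.
apply/seteqP; split; first exact: local_sub.
move=> x; rewrite -rQ => -[n /QP]; elim: n => [//|n IH].
by rewrite exprS => /Pp[//|].
Qed.

Lemma iadd0_exp (A : comPzRingType) (Q : set A) n : iadd [set 0] (ideal_exp Q n) = ideal_exp Q n.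
Proof.
apply/seteqP; split; last by apply: iaddr; exact: is_ideal1.
by move=> _ [_ [q [-> Qq ->]]]; rewrite add0r.
Qed.

Lemma quot_length_exp (A : comPzRingType) (Q : set A) n :
  quot_length (ideal_exp Q n) = ilen (iadd [set 0] (ideal_exp Q n)) setT.
Proof.
rewrite quot_lengthE iadd0_exp; congr (ilen _ _); apply/seteqP.
by split=> [x|x Qx I [_]]; [apply; split=> //; exact: is_ideal_exp|exact].
Qed.

Theorem theorem6p5 (X : scheme) (X_noeth : noetherian_scheme X)
    (X_FA : FA_scheme X) (F : set X) (F_closed : closed F)
    (F_codim : positive_codimension F) (x0 : X) (Q : set (stalk x0))
    (Q_primary : primary_to (max_ideal (stalk x0)) Q) :
  exists Z : cycle_group X,
    rationally_equivalent
      (<< (hs_multiplicity Q)%:Z *g point_closure x0 >> : cycle_group X) Z /\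
    generically_avoids F Z.
Proof.
suff [fs hfs] : movable F x0 (hs_multiplicity Q)%:Z.
  exists (<< (hs_multiplicity Q)%:Z *g point_closure x0 >> - \sum_(f <- fs) div f).
  by split=> //; exists fs; rewrite opprB addrCA subrr addr0.
have hacc := @stalk_acc X X_noeth x0; have hm := stalk_local x0.
have [hQ Qm [M mQ]] := primary_to_maximal hacc hm Q_primary.
have [IF [hIF IFP]] := stalk_closed x0 F_closed.
(* If no integer qualifies, [hs_multiplicity] is 0 by default, and 0 is movable. *)
rewrite /hs_multiplicity; case: xgetP => [e _ [p [[N hN] sp eE]]|_]; last exact: movable0.
have hN' n : (N <= n)%N -> (ilen (iadd [set 0] (ideal_exp Q n)) setT)%:R = p.[n%:R].
  by move=> /hN; rewrite quot_length_exp.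
have gen_m (h : closure [set x0] x0) : gen_prime h = max_ideal (stalk x0).
  by apply/seteqP; split=> g; rewrite /gen_prime /mkset specialization_id.
case dE : (krull_dim (stalk x0)) => [|d] in sp eE.
  (* [krull_dim] is 0, possibly by default. Then p is constant, which yields Q^N = 0, so m is the
     only prime; by positive codimension x0 is not in F, and the empty list of functions
     suffices. *)
  have QN : ideal_exp Q N `<=` [set 0].
    apply: (stable_exp_sub hacc hm hQ Qm mQ (is_ideal1 _)) => n Nn.
    apply/eqP; rewrite -(eqr_nat rat) !hN' //.
    by have /eqP/size_poly1P[c _ ->] := sp; rewrite !hornerC.
  exists [::]; rewrite big_nil subr0; apply/generically_avoids_coeff => Y YF.
  rewrite coeffU; case: eqP => [xY|_]; last by rewrite mulr0.
  have Fx0 : F x0 by apply: YF; rewrite -xY; apply: subset_closure.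
  have hx : closure [set x0] x0 by apply: subset_closure.
  have [J [hJ [_ []]]] := stalk_generization hx F_closed F_codim Fx0.
  rewrite gen_m => y my; apply: contrapT => Jy.
  have Jm : J <> max_ideal (stalk x0) by move=> E; apply: Jy; rewrite E.
  apply: (prime_nonmax hm mQ hJ Jm) => {y my Jy}.
  have : ideal_exp Q N `<=` J by move=> y /QN ->; case: hJ => -[].
  elim: N {hN hN' QN} => [|n IH]; first by case: hJ => _ J1 _ /(_ 1 I).
  by move=> /(prime_subM hJ)[|/IH].
have [|_ cmax] := @chain_height_gt0 _ (@prime_ideal (stalk x0)).
  by rewrite -/(krull_dim (stalk x0)) dE.
rewrite -/(krull_dim (stalk x0)) dE in cmax.
have top J n c : strict_chain (nonmax_primes (max_ideal (stalk x0)) J) n c ->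
    exists2 c', strict_chain (@prime_ideal (stalk x0)) n.+1 c' & c' n.+1 = max_ideal (stalk x0).
  move=> [cP cS]; apply: (has_chain_rcons (c := c)).
  - by split=> // i /cP[].
  - exact: local_prime.
  - have [hp hpm _] := cP n (leqnn n); have [pI p1 _] := hp.
    have sub := local_sub hm pI p1.
    by split=> // sub'; apply: hpm; apply/seteqP.
have H1 : ~ has_chain (nonmax_primes (max_ideal (stalk x0)) [set 0]) d.+1.
  move=> [c cP]; have [c' c'P _] := top _ _ _ cP.
  by have := cmax _ (ex_intro _ c' c'P); rewrite ltnn.
pose G (n : int) := movable F x0 n /\ movable F x0 (- n).
suff [] : G e%:Z by [].
apply: (local_multiplicity hacc hm hQ Qm mQ (G := G) (IF := IF) _ _ _ hIF _
  (d := d) (J := [set 0]) (p := p)).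
- by split; rewrite ?oppr0; exact: movable0.
- by move=> n n' [? ?] [? ?]; rewrite /G opprD; split; exact: movableD.
- by move=> n [? ?]; rewrite /G opprK.
- move=> P a hP Pm IFPn Pmax ma Pa.
  have [eta [h PE]] := stalk_prime_point hP; subst P.
  apply: movable_length => //; last by move=> /IFP.
  by exists h; split=> // I hI gI Im; exact: Pmax.
- exact: is_ideal1.
- by rewrite sp.
- exact: eE.
- by exists N.
- exact: H1.
(* The first prime of a chain over IF is the prime of a point of F, so there is a smaller prime;
   putting it in front gives a chain of length d + 1, against H1. *)
- move=> [c cP]; apply: H1.
  have [hc0 c0m Jc0] := cP.1 0%N (leq0n d).
  have [eta [h c0E]] := stalk_prime_point hc0.
  have Feta : F eta.
    by apply/(IFP _ h); rewrite -c0E; apply: subset_trans Jc0; apply: iaddr; exact: is_ideal1.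
  have [J [hJ Jc]] := stalk_generization h F_closed F_codim Feta; rewrite -c0E in Jc.
  apply: (has_chain_cons (c := c) (X := J)) => //.
    case: cP => cP cS; split=> // i /cP[hc cm _]; split=> // x ->.
    by case: hc => -[].
  split=> //; last by move=> x ->; case: hJ => -[].
  move=> Jm; case: Jc => _; apply; rewrite Jm.
  by have [cI c1 _] := hc0; exact: local_sub.
Qed.
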